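(* Let $\chi=(\alpha,\beta,\xi,\delta,\gamma)$ with $\alpha,\beta,\xi,\delta>0$ and $\gamma\in\mathbb{R}$. (I) Suppose $\alpha+\beta+\xi+\delta\neq 2\gamma$. Then the $*$-algebra $\mathcal{A}_{\widetilde D_4,\chi}$ has an irreducible non-degenerate $*$-representation of generalized dimension $v$ if and only if there exist $t\in\{0,1\}$, an integer $k\ge k_t$ and a permutation $\tau\in\{e,(1\,2),(1\,3),(1\,4)\}$ (with $\tau=e$ if $t=0$) such that 1. $v=\tau d^{(t)}_k$, and 2. $\mathrm{A}_{t,k}\,\tau\chi\ge_t 0$. The permutation $\tau$ and the numbers $t,k$ are determined uniquely, and the irreducible representation of $\mathcal{A}_{\widetilde D_4,\chi}$ corresponding to this generalized dimension and this $\chi$ is unique (up to unitary equivalence). (II) Suppose $\alpha+\beta+\xi+\delta=2\gamma$. Then irreducible non-degenerate $*$-representations of $\mathcal{A}_{\widetilde D_4,\chi}$ may exist only in the generalized dimension $(1,1,1,1;2)$, and they exist if and only if $$\alpha+\beta+\xi>\gamma,\quad \alpha+\xi+\delta>\gamma,\quad \alpha+\beta+\delta>\gamma,\quad \beta+\xi+\delta>\gamma .$$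
   Context: Algebra. $\mathcal{A}_{\widetilde D_4,\chi}$ is the unital $*$-algebra generated by self-adjoint $A_1,A_2,A_3,A_4$ with relations $A_1(A_1-\alpha)=0$, $A_2(A_2-\beta)=0$, $A_3(A_3-\xi)=0$, $A_4(A_4-\delta)=0$, $A_1+A_2+A_3+A_4=\gamma e$. A $*$-representation is by bounded operators on a Hilbert space $H$. It is non-degenerate if for each $j$ the spectral projections of $\pi(A_j)$ for the nonzero eigenvalue and for the eigenvalue $0$ are both nonzero. Its generalized dimension is $(n_1,n_2,n_3,n_4,n_0)$, where $n_1,\dots,n_4$ are the ranks of the spectral projections of $\pi(A_1),\dots,\pi(A_4)$ for the eigenvalues $\alpha,\beta,\xi,\delta$ respectively, and $n_0=\dim H$. All vectors are indexed in the order $(x_1,x_2,x_3,x_4,x_0)$. A permutation $\tau$ of $\{1,2,3,4\}$ acts on vectors (including $\chi$) by permuting the first four coordinates. For a vector $u$ and an index $t\in\{0,1,2,3,4\}$, $u\ge_t 0$ means $u_t=0$ and $u_j>0$ for all $j\ne t$. Roots. $\delta_G=(1,1,1,1,2)$. Let $m_1=4$ and $(v^{(1)}_0,\dots,v^{(1)}_3)=\big((1,0,0,0,0),(1,0,0,0,1),(0,1,1,1,1),(0,1,1,1,2)\big)$; let $m_0=2$ and $(v^{(0)}_0,v^{(0)}_1)=\big((0,0,0,0,1),(1,1,1,1,1)\big)$. Put $d^{(t)}_k=v^{(t)}_{k \bmod m_t}+\lfloor k/m_t\rfloor\,\delta_G$. Put $k_1=5$, $k_0=2$. Matrices (acting on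 column vectors $(x_1,x_2,x_3,x_4,x_0)^T$). Let $\overset{\bullet}{C}$ be the map replacing $x_0$ by $-x_0+x_1+x_2+x_3+x_4$ and fixing $x_1,\dots,x_4$; let $\overset{\circ}{C}$ be the map replacing $x_i$ by $-x_i+x_0$ for $i=1,\dots,4$ and fixing $x_0$; let $C=\overset{\bullet}{C}\,\overset{\circ}{C}$. Let $$D_{1,5}=\begin{pmatrix}-2&-1&-1&-1&3\\-1&0&-1&-1&2\\-1&-1&0&-1&2\\-1&-1&-1&0&2\\-3&-1&-1&-1&4\end{pmatrix},\qquad D_{0,2}=\begin{pmatrix}-1&0&0&0&1\\0&-1&0&0&1\\0&0&-1&0&1\\0&0&0&-1&1\\-1&-1&-1&-1&3\end{pmatrix}.$$ Then $\mathrm{A}_{1,k}=D_{1,5}C^{s-3}\overset{\bullet}{C}$ if $k=2s$ and $\mathrm{A}_{1,k}=D_{1,5}C^{s-3}$ if $k=2s-1$; and $\mathrm{A}_{0,k}=D_{0,2}C^{s-1}$ if $k=2s$ and $\mathrm{A}_{0,k}=D_{0,2}C^{s-1}\overset{\bullet}{C}$ if $k=2s+1$. *)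

(* Defs.v *)
From HB Require Import structures.
From mathcomp Require Import all_boot all_order all_algebra all_fingroup.
From mathcomp Require Import sesquilinear.
From mathcomp Require Import all_classical all_reals all_analysis.
From mathcomp Require Import complex.

Set Implicit Arguments.
Unset Strict Implicit.
Unset Printing Implicit Defensive.

Import Order.TTheory GRing.Theory Num.Theory.
Import numFieldNormedType.Exports.

Local Open Scope classical_set_scope.
Local Open Scope ring_scope.
Local Open Scope complex_scope.

Record hilbert (R : realType) := Hilbert {
  hspace :> completeNormedModType R[i];
  inner : {dot hspace for (@Num.conj R[i])};
  inner_norm : forall x : hspace, `|x| ^+ 2 = inner x x
}.

Section Operators.
Variables (R : realType) (H : hilbert R).

Definition linear_subspace (S : set H) : Prop :=
  S 0 /\ forall (c : R[i]) (x y : H), S x -> S y -> S (c *: x + y).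

Definition has_basis (S : set H) (n : nat) : Prop :=
  exists e : 'I_n -> H,
    [/\ forall i, S (e i),
        forall c : 'I_n -> R[i], \sum_i c i *: e i = 0 -> forall i, c i = 0
      & forall x, S x -> exists c : 'I_n -> R[i], x = \sum_i c i *: e i].

(* [Some n] is the finite dimension n, [None] an infinite dimension. *)
Definition has_dim (S : set H) (d : option nat) : Prop :=
  if d is Some n then has_basis S n else forall n, ~ has_basis S n.

(* For a self-adjoint A, the spectral projection of A for the point a is the
   orthogonal projection onto Ker (A - a). *)
Definition spectral_proj (A : H -> H) (a : R[i]) (P : H -> H) : Prop :=
  forall x, A (P x) = a *: P x /\
    forall y, A y = a *: y -> inner H (x - P x) y = 0.

End Operators.

(* Vectors are indexed in the order (x_1, x_2, x_3, x_4, x_0): the coordinate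
   x_j, j = 1, ..., 4, is at [first4 (j-1)] and x_0 is at [ord_max]. *)
Definition first4 (j : 'I_4) : 'I_5 := lift ord_max j.

Definition vec (T : nmodType) (s : seq T) : 'cV[T]_5 := \col_i s`_i.

Definition permv (T : Type) (tau : 'S_4) (u : 'cV[T]_5) : 'cV[T]_5 :=
  row_perm (lift_perm ord_max ord_max tau^-1%g) u.

(* [ord_pred] is the cyclic predecessor: the label t = 1, ..., 4 is sent to the
   position t - 1 and the label t = 0 to the last position. *)
Definition coord_pos (t : 'I_5) : 'I_5 := ord_pred t.

Definition ge_at (R : realType) (t : 'I_5) (u : 'cV[R]_5) : Prop :=
  u (coord_pos t) ord0 = 0 /\
  forall j : 'I_5, j != t -> 0 < u (coord_pos j) ord0.

Inductive star_poly (R : realType) : Type :=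
| Gen of 'I_4
| Cst of R[i]
| Add of star_poly R & star_poly R
| Mul of star_poly R & star_poly R
| Star of star_poly R.

Arguments Gen {R}.

Section StarAlgebra.
Variables (R : realType) (chi : 'cV[R]_5).

Definition weight (j : 'I_4) : R[i] := (chi (first4 j) ord0)%:C.

Definition GenSum : star_poly R :=
  Add (Add (Add (Gen (inord 0)) (Gen (inord 1))) (Gen (inord 2)))
      (Gen (inord 3)).

(* The smallest congruence containing the axioms of unital *-algebras over C
   and the defining relations: the algebra is [star_poly R] modulo [alg_eq]. *)
Inductive alg_eq : star_poly R -> star_poly R -> Prop :=
| eqRefl a : alg_eq a a
| eqSym a b : alg_eq a b -> alg_eq b a
| eqTrans a b c : alg_eq a b -> alg_eq b c -> alg_eq a c
| eqAdd a a' b b' : alg_eq a a' -> alg_eq b b' -> alg_eq (Add a b) (Add a' b')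
| eqMul a a' b b' : alg_eq a a' -> alg_eq b b' -> alg_eq (Mul a b) (Mul a' b')
| eqStar a a' : alg_eq a a' -> alg_eq (Star a) (Star a')
| eq_addA a b c : alg_eq (Add a (Add b c)) (Add (Add a b) c)
| eq_addC a b : alg_eq (Add a b) (Add b a)
| eq_add0 a : alg_eq (Add (Cst 0) a) a
| eq_addN a : alg_eq (Add (Mul (Cst (- 1)) a) a) (Cst 0)
| eq_mulA a b c : alg_eq (Mul a (Mul b c)) (Mul (Mul a b) c)
| eq_mul1 a : alg_eq (Mul (Cst 1) a) a
| eq_mulDl a b c : alg_eq (Mul (Add a b) c) (Add (Mul a c) (Mul b c))
| eq_mulDr a b c : alg_eq (Mul a (Add b c)) (Add (Mul a b) (Mul a c))
| eq_cstD (x y : R[i]) : alg_eq (Cst (x + y)) (Add (Cst x) (Cst y))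
| eq_cstM (x y : R[i]) : alg_eq (Cst (x * y)) (Mul (Cst x) (Cst y))
| eq_cstC (x : R[i]) a : alg_eq (Mul (Cst x) a) (Mul a (Cst x))
| eq_starK a : alg_eq (Star (Star a)) a
| eq_starD a b : alg_eq (Star (Add a b)) (Add (Star a) (Star b))
| eq_starM a b : alg_eq (Star (Mul a b)) (Mul (Star b) (Star a))
| eq_starC (x : R[i]) : alg_eq (Star (Cst x)) (Cst (Num.conj x))
| eq_gen_selfadjoint j : alg_eq (Star (Gen j)) (Gen j)
| eq_gen_spectrum j :
    alg_eq (Mul (Gen j) (Add (Gen j) (Cst (- weight j)))) (Cst 0)
| eq_gen_sum : alg_eq GenSum (Cst (chi ord_max ord0)%:C).

(* A unital *-homomorphism from the quotient of [star_poly R] by [alg_eq] to the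
   bounded operators on H. *)
Record star_rep (H : hilbert R) := StarRep {
  rep :> star_poly R -> {linear H -> H};
  rep_bounded : forall a, exists M : R[i], forall x : H, `|rep a x| <= M * `|x|;
  rep_eq : forall a b, alg_eq a b -> rep a =1 rep b;
  rep_cst : forall c x, rep (Cst c) x = c *: x;
  rep_add : forall a b x, rep (Add a b) x = rep a x + rep b x;
  rep_mul : forall a b x, rep (Mul a b) x = rep a (rep b x);
  rep_star : forall a x y, inner H (rep a x) y = inner H x (rep (Star a) y)
}.

Section Representation.
Variables (H : hilbert R) (pi : star_rep H).

Definition irreducible_rep : Prop :=
  (exists x : H, x != 0) /\
  forall S : set H, linear_subspace S -> closed S ->
    (forall a x, S x -> S (pi a x)) -> S = [set 0] \/ S = setT.

Definition nondegenerate_rep : Prop :=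
  forall j : 'I_4, forall a : R[i], a = weight j \/ a = 0 ->
    exists P, spectral_proj (pi (Gen j)) a P /\ exists x, P x != 0.

Definition has_gendim (v : 'cV[option nat]_5) : Prop :=
  (forall j : 'I_4, exists P, spectral_proj (pi (Gen j)) (weight j) P /\
     has_dim (range P) (v (first4 j) ord0)) /\
  has_dim [set: H] (v ord_max ord0).

End Representation.

Definition unitarily_equivalent (H1 H2 : hilbert R)
    (pi1 : star_rep H1) (pi2 : star_rep H2) : Prop :=
  exists U : {linear H1 -> H2},
    [/\ bijective U,
        forall x y, inner H2 (U x) (U y) = inner H1 x y
      & forall a x, U (pi1 a x) = pi2 a (U x)].

End StarAlgebra.

Definition deltaG : 'cV[nat]_5 := vec [:: 1; 1; 1; 1; 2]%N.

Definition roots0 (t : 'I_2) : seq 'cV[nat]_5 :=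
  if t == ord0 then [:: vec [:: 0; 0; 0; 0; 1]; vec [:: 1; 1; 1; 1; 1]]%N
  else [:: vec [:: 1; 0; 0; 0; 0]; vec [:: 1; 0; 0; 0; 1];
           vec [:: 0; 1; 1; 1; 1]; vec [:: 0; 1; 1; 1; 2]]%N.

Definition root_vec (t : 'I_2) (k : nat) : 'cV[nat]_5 :=
  let m := size (roots0 t) in
  (roots0 t)`_(k %% m) + deltaG *+ (k %/ m).

Definition kmin (t : 'I_2) : nat := if t == ord0 then 2 else 5.

Section Matrices.
Variable R : realType.

Definition mx_of_rows (s : seq (seq int)) : 'M[R]_5 :=
  \matrix_(i, j) ((nth [::] s i)`_j)%:~R.

Definition Cblack : 'M[R]_5 := mx_of_rows
  [:: [:: 1; 0; 0; 0;  0];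
      [:: 0; 1; 0; 0;  0];
      [:: 0; 0; 1; 0;  0];
      [:: 0; 0; 0; 1;  0];
      [:: 1; 1; 1; 1; -1]].

Definition Cwhite : 'M[R]_5 := mx_of_rows
  [:: [:: -1;  0;  0;  0; 1];
      [::  0; -1;  0;  0; 1];
      [::  0;  0; -1;  0; 1];
      [::  0;  0;  0; -1; 1];
      [::  0;  0;  0;  0; 1]].

Definition Cox : 'M[R]_5 := Cblack *m Cwhite.

Definition D15 : 'M[R]_5 := mx_of_rows
  [:: [:: -2; -1; -1; -1; 3];
      [:: -1;  0; -1; -1; 2];
      [:: -1; -1;  0; -1; 2];
      [:: -1; -1; -1;  0; 2];
      [:: -3; -1; -1; -1; 4]].

Definition D02 : 'M[R]_5 := mx_of_rows
  [:: [:: -1;  0;  0;  0; 1];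
      [::  0; -1;  0;  0; 1];
      [::  0;  0; -1;  0; 1];
      [::  0;  0;  0; -1; 1];
      [:: -1; -1; -1; -1; 3]].

(* Used for k >= kmin t only, so the truncated subtractions are exact.  For
   t = 1, k = 2s or k = 2s - 1 gives s = uphalf k; for t = 0, k = 2s or
   k = 2s + 1 gives s = k./2. *)
Definition Amx (t : 'I_2) (k : nat) : 'M[R]_5 :=
  if t == ord0 then
    if odd k then D02 *m Cox ^+ (k./2 - 1) *m Cblack
    else D02 *m Cox ^+ (k./2 - 1)
  else
    if odd k then D15 *m Cox ^+ (uphalf k - 3)
    else D15 *m Cox ^+ (uphalf k - 3) *m Cblack.

Definition taus : seq 'S_4 :=
  [:: 1%g; tperm (inord 0) (inord 1); tperm (inord 0) (inord 2);
      tperm (inord 0) (inord 3)].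

Definition admissible (chi : 'cV[R]_5) (v : 'cV[option nat]_5)
    (t : 'I_2) (k : nat) (tau : 'S_4) : Prop :=
  [/\ (kmin t <= k)%N,
      tau \in taus,
      t = ord0 -> tau = 1%g,
      v = map_mx Some (permv tau (root_vec t k))
    & ge_at (widen_ord (isT : 2 <= 5)%N t) (Amx t k *m permv tau chi)].

End Matrices.

(* Main.v *)
(* Put X_j = 2 A_j / a_j - 1, where a_j is the nonzero eigenvalue of A_j.  A
   representation becomes a family of four self-adjoint involutions with
   sum_j a_j X_j = lam, where lam = 2 gamma - sum_j a_j, and the rank of the j-th
   spectral projection is read off the trace of X_j.

   Let lam <> 0.  The commutator K of X_0 and X_1 anticommutes with
   T = a_0 X_0 + a_1 X_1, and the commutator L of X_2 and X_3 anticommutes with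
   lam - T.  Hence L K shifts T by a multiple of lam; since T is bounded, some
   nonzero vector is killed by K or by L, and it yields a joint eigenvector of
   one of the pairs.  Applying X_2 and X_0 alternately to this vector produces
   eigenvectors of T whose eigenvalues form, up to sign, an arithmetic
   progression of step lam.  This chain has to stop, it spans an invariant
   subspace, and each link of the chain is a pair of involutions of a plane, so
   all matrix entries are determined by the starting signs.  The chain can be
   traversed from either end, and comparing the two ends leaves only the chains
   whose traces are all 1 and those with one distinguished index; the inequalities
   that keep the intermediate links nondegenerate are the conditions
   A_{t,k} tau chi >=_t 0.  The case lam < 0 is reduced to lam > 0 by X_j -> - X_j.

   Let lam = 0.  Squaring a_0 X_0 + a_1 X_1 = - (a_2 X_2 + a_3 X_3) shows that the
   anticommutators of the X_j are central, and so is i (X_0 X_1 X_2 - X_2 X_1 X_0).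
   By a Schur lemma for bounded self-adjoint operators they are scalars, which
   forces dimension 2.  A representation then amounts to a closed quadrilateral
   with sides a_j that does not lie on a line. *)

Require Import Defs.
From HB Require Import structures.
From mathcomp Require Import all_boot all_order all_algebra all_fingroup.
From mathcomp Require Import sesquilinear.
From mathcomp Require Import all_classical all_reals all_analysis.
From mathcomp Require Import complex.
From mathcomp Require Import ring lra zify.

Set Implicit Arguments.
Unset Strict Implicit.
Unset Printing Implicit Defensive.

Import Order.TTheory GRing.Theory Num.Theory.
Import numFieldNormedType.Exports.

Local Open Scope classical_set_scope.
Local Open Scope ring_scope.
Local Open Scope complex_scope.

(** * The Hilbert space of n-tuples *)

(** Nothing bounds the dimension of [H] in advance, so eigenvectors have to be produced from
    boundedness alone; likewise the functional calculus behind the Schur lemma is replaced by an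
    explicit iteration for a square root. The chain rests on one step. If [e] is a unit vector with
    [(a X + b Y) e = z e] and [z <> 0], put [c = (z^2 + a^2 - b^2) / (2 a z)]; then [X e - c e]
    belongs to the eigenvalue [- z] and has squared norm [1 - c^2]. Up to sign, [c] is the cosine of
    an angle in a triangle with sides [a], [b], [|z|]: the chain goes on while this triangle is
    nondegenerate and stops when it is flat, at [c^2 = 1]. The obstacle is [z = 0], where [c] is
    undefined. It dictates the choice of the starting vector. If one of the two pair sums has a
    kernel, a joint eigenvector inside this kernel is taken, and then the [l]-th value of the
    progression is [l lam], nonzero for [l > 0]. Otherwise both pair sums are injective, and no
    vector of the chain can have the value 0. *)

Lemma Re_le_normc (R : rcfType) (z : R[i]) : (complex.Re z)%:C <= `|z|.
Proof.
rewrite normc_def lecR (le_trans (ler_norm _)) // -sqrtr_sqr.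
by apply: ler_wsqrtr; rewrite lerDl sqr_ge0.
Qed.

Lemma abs_Re_le_normc (R : rcfType) (z : R[i]) : `|complex.Re z|%:C <= `|z|.
Proof.
by rewrite normc_def lecR -sqrtr_sqr; apply: ler_wsqrtr; rewrite lerDl sqr_ge0.
Qed.

Lemma abs_Im_le_normc (R : rcfType) (z : R[i]) : `|complex.Im z|%:C <= `|z|.
Proof.
by rewrite normc_def lecR -sqrtr_sqr; apply: ler_wsqrtr; rewrite lerDr sqr_ge0.
Qed.

Lemma normc_le_ReIm (R : rcfType) (z : R[i]) :
  `|z| <= (`|complex.Re z| + `|complex.Im z|)%:C.
Proof.
have s0 : 0 <= `|complex.Re z| + `|complex.Im z| by rewrite addr_ge0.
rewrite normc_def lecR -[leRHS](ger0_norm s0) -[leRHS]sqrtr_sqr.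
apply: ler_wsqrtr.
by rewrite sqrrD !real_normK ?num_real // lerD2r lerDl mulrn_wge0 ?mulr_ge0.
Qed.

(** An alias of the row vectors that keeps their module structure but receives the Euclidean norm in
    place of the sup norm of matrices. *)
Definition cspace (R : realType) (n : nat) := 'rV[R[i]]_n.

Section CSpace.
Variables (R : realType) (n : nat).
Local Notation C := R[i].
Local Notation V := (cspace R n).

HB.instance Definition _ := GRing.Lmodule.copy V 'rV[R[i]]_n.

Definition cdot (x y : V) : C := \sum_i x ord0 i * Num.conj (y ord0 i).

Lemma cdot_bilinear : bilinear_for *%R (Num.conj \; *%R) cdot.
Proof.
split=> [y c x x'|x c y y']; rewrite /cdot /= mulr_sumr -big_split /=;
  apply: eq_bigr => i _; rewrite !mxE.
  by rewrite mulrDl mulrA.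
by rewrite rmorphD rmorphM /= mulrDr mulrCA.
Qed.

HB.instance Definition _ := bilinear_isBilinear.Build C V V C *%R
  (Num.conj \; *%R) cdot cdot_bilinear.

Lemma cdot_hermitian (x y : V) : cdot x y = (-1) ^+ false * Num.conj (cdot y x).
Proof.
rewrite expr0 mul1r /cdot rmorph_sum; apply: eq_bigr => i _ /=.
by rewrite rmorphM /= conjCK mulrC.
Qed.

HB.instance Definition _ :=
  isHermitianSesquilinear.Build C V false Num.conj cdot cdot_hermitian.

Lemma cdot_def (x : V) : x != 0 -> 0 < cdot x x.
Proof.
move=> x0; have [i xi] : exists i, x ord0 i != 0.
  apply: contrapT => /forallNP h; move/eqP: x0; apply.
  by apply/rowP => i; rewrite mxE; apply/eqP; move/negP: (h i); rewrite negbK.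
rewrite /cdot (bigD1 i) //= ltr_pwDl //.
  by rewrite mul_conjC_gt0.
by apply: sumr_ge0 => j _; exact: mul_conjC_ge0.
Qed.

HB.instance Definition _ := isDotProduct.Build C V cdot cdot_def.

Definition cnorm (x : V) : C := sqrtC (cdot x x).

Lemma cnorm_ge0 x : 0 <= cnorm x.
Proof. by rewrite sqrtC_ge0; exact: (dnorm_ge0 cdot). Qed.

Lemma cnorm_sqr x : cnorm x ^+ 2 = cdot x x.
Proof. exact: sqrtCK. Qed.

Lemma cnorm_coord (x : V) : cnorm x ^+ 2 = \sum_i `|x ord0 i| ^+ 2.
Proof. by rewrite cnorm_sqr; apply: eq_bigr => i _; rewrite normCK. Qed.

Lemma ler_cnormD x y : cnorm (x + y) <= cnorm x + cnorm y.
Proof.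
rewrite -ler_sqr ?nnegrE ?addr_ge0 ?cnorm_ge0 // sqrrD !cnorm_sqr.
rewrite (dnormD cdot) -[leRHS]addrA [_ *+ 2 + _]addrC addrA lerD2l.
have [cs _] := CauchySchwarz_sqrt cdot x y.
rewrite mulr2n -/(cnorm x) -/(cnorm y) in cs *.
rewrite [X in X <= _](addcJ (cdot x y)) mulr_natl mulr2n.
by rewrite lerD //; apply: le_trans cs; exact: Re_le_normc.
Qed.

Lemma cnormZ (c : C) x : cnorm (c *: x) = `|c| * cnorm x.
Proof.
by rewrite /cnorm (dnormZ cdot) sqrtCM ?nnegrE ?exprn_ge0 ?(dnorm_ge0 cdot) // exprCK.
Qed.

Lemma cnorm0_eq0 x : cnorm x = 0 -> x = 0.
Proof. by move/eqP; rewrite sqrtC_eq0 (dnorm_eq0 cdot) => /eqP. Qed.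

HB.instance Definition _ :=
  Lmodule_isNormed.Build C V ler_cnormD cnormZ cnorm0_eq0.

Lemma cspace_coord_le (x : V) i : `|x ord0 i| <= `|x|.
Proof.
rewrite -ler_sqr ?nnegrE // [leRHS]cnorm_coord (bigD1 i) //= lerDl.
by apply: sumr_ge0 => j _; rewrite exprn_ge0.
Qed.

Lemma cspace_norm_le (x : V) : `|x| <= \sum_i `|x ord0 i|.
Proof.
rewrite -ler_sqr ?nnegrE ?sumr_ge0 // [leLHS]cnorm_coord.
rewrite expr2 mulr_suml ler_sum // => i _.
rewrite expr2 ler_wpM2l // (bigD1 i) //= lerDl sumr_ge0 //.
Qed.

Lemma cspace_complete (F : set_system V) : ProperFilter F -> cauchy F -> cvg F.
Proof.
move=> FF /cauchyP Fc.
have coordB (x y : V) i : (x - y) ord0 i = x ord0 i - y ord0 i by rewrite !mxE.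
have cvRe i : cvg ((fun x : V => complex.Re (x ord0 i)) @ F).
  apply: cauchy_cvg; apply: cauchy_exP => e e0.
  have [|x Fx] := Fc e%:C; first by rewrite ltcR.
  exists (complex.Re (x ord0 i)); move: Fx; apply: (@filterS _ F) => y.
  rewrite -!ball_normE /= => xy; rewrite -ltcR; apply: le_lt_trans xy.
  apply: le_trans (cspace_coord_le _ i); rewrite [X in _ <= `|X|](coordB x y i) -raddfB.
  exact: abs_Re_le_normc.
have cvIm i : cvg ((fun x : V => complex.Im (x ord0 i)) @ F).
  apply: cauchy_cvg; apply: cauchy_exP => e e0.
  have [|x Fx] := Fc e%:C; first by rewrite ltcR.
  exists (complex.Im (x ord0 i)); move: Fx; apply: (@filterS _ F) => y.
  rewrite -!ball_normE /= => xy; rewrite -ltcR; apply: le_lt_trans xy.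
  apply: le_trans (cspace_coord_le _ i); rewrite [X in _ <= `|X|](coordB x y i) -raddfB.
  exact: abs_Im_le_normc.
pose L : V := \row_i ((lim ((fun x : V => complex.Re (x ord0 i)) @ F)) +i*
  (lim ((fun x : V => complex.Im (x ord0 i)) @ F))).
apply/cvg_ex; exists L; apply/(@cvgrPdist_lt _ _ _ _ _ id) => e e0.
have [r r0 eE] : exists2 r : R, 0 < r & e = r%:C.
  by case: e e0 => r s; rewrite ltcE /= => /andP[/eqP -> r0]; exists r.
(* The factor 2 splits the radius between real and imaginary parts; [n.+1] instead of [n] also
   covers [n = 0] and makes the final sum over [n] coordinates strictly smaller than [r]. *)
have d0 : 0 < r / (n.+1 * 2)%:R by rewrite divr_gt0 // ltr0n.
have h i : \forall x \near F, `|(L - x) ord0 i| < (r / n.+1%:R)%:C.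
  have h1 : {near F, forall x : V,
      `|complex.Re (L ord0 i) - complex.Re (x ord0 i)| < r / (n.+1 * 2)%:R}.
    by rewrite mxE; apply: cvgr_dist_lt d0; exact: cvRe.
  have h2 : {near F, forall x : V,
      `|complex.Im (L ord0 i) - complex.Im (x ord0 i)| < r / (n.+1 * 2)%:R}.
    by rewrite mxE; apply: cvgr_dist_lt d0; exact: cvIm.
  apply: filterS2 h1 h2 => x h1 h2.
  apply: le_lt_trans (normc_le_ReIm _) _; rewrite ltcR.
  have -> : r / n.+1%:R = r / (n.+1 * 2)%:R + r / (n.+1 * 2)%:R.
    by rewrite -mulr2n natrM invfM mulrA -[RHS]mulr_natr divfK // pnatr_eq0.
  rewrite [X in complex.Re X](coordB L x i) [X in complex.Im X](coordB L x i).
  by rewrite !raddfB; exact: ltrD.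
have hall : \forall x \near F, forall i, `|(L - x) ord0 i| < (r / n.+1%:R)%:C.
  exact: filter_forall.
near=> x; rewrite eE; apply: le_lt_trans (cspace_norm_le _) _.
apply: (@le_lt_trans _ _ (\sum_(i < n) (r / n.+1%:R)%:C)).
  by apply: ler_sum => i _; apply: ltW; move: i; near: x.
have lt_r : r / n.+1%:R *+ n < r.
  by rewrite -(mulr_natr _ n) mulrAC ltr_pdivrMr ?ltr0n // ltr_pM2l // ltr_nat.
by rewrite sumr_const card_ord -(raddfMn (real_complex R)) ltcR.
Unshelve. all: by end_near. Qed.

HB.instance Definition _ := Uniform_isComplete.Build V cspace_complete.

Lemma cspace_inner_norm (x : V) : `|x| ^+ 2 = cdot x x.
Proof. exact: cnorm_sqr. Qed.

Definition chilbert : hilbert R := @Hilbert R V cdot cspace_inner_norm.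

End CSpace.

(** * Orthonormal bases and traces *)

(* The square-zero extension of a field by a vector space: it turns identities
   between linear combinations of vectors into ring identities. *)
Definition sqzero (F : fieldType) (V : lmodType F) := (F * V)%type.

Section SquareZero.
Variables (F : fieldType) (V : lmodType F).
Local Notation T := (sqzero V).

HB.instance Definition _ := GRing.Zmodule.copy T (F * V)%type.

Definition sqzero_mul (x y : T) : T := (x.1 * y.1, x.1 *: y.2 + y.1 *: x.2).

Lemma sqzero_mulA : associative sqzero_mul.
Proof.
move=> [a u] [b v] [c w]; congr (_, _) => /=; first by rewrite mulrA.
by rewrite !scalerDr !scalerA addrA [c * a]mulrC [c * b]mulrC.
Qed.

Lemma sqzero_mulC : commutative sqzero_mul.
Proof. by move=> [a u] [b v]; congr (_, _) => /=; rewrite 1?mulrC 1?addrC. Qed.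

Lemma sqzero_mul1 : left_id ((1, 0) : T) sqzero_mul.
Proof.
by move=> [a u]; rewrite /sqzero_mul /= mul1r scale1r scaler0 addr0.
Qed.

Lemma sqzero_mulDl : left_distributive sqzero_mul +%R.
Proof.
move=> [a u] [b v] [c w]; congr (_, _) => /=; first by rewrite mulrDl.
by rewrite scalerDl scalerDr addrACA.
Qed.

Lemma sqzero_one_neq0 : ((1, 0) : T) != 0.
Proof. by apply/eqP => -[/eqP]; rewrite oner_eq0. Qed.

HB.instance Definition _ := GRing.Zmodule_isComNzRing.Build T
  sqzero_mulA sqzero_mulC sqzero_mul1 sqzero_mulDl sqzero_one_neq0.

Definition sqzero_scal (c : F) : T := (c, 0).
Definition sqzero_vec (v : V) : T := (0, v).

Lemma sqzero_scal_additive : zmod_morphism sqzero_scal.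
Proof. by move=> a b; congr (_, _); rewrite subr0. Qed.

Lemma sqzero_scal_multiplicative : monoid_morphism sqzero_scal.
Proof. by split=> // a b; congr (_, _); rewrite /= !scaler0 addr0. Qed.

HB.instance Definition _ :=
  GRing.isZmodMorphism.Build F T sqzero_scal sqzero_scal_additive.
HB.instance Definition _ :=
  GRing.isMonoidMorphism.Build F T sqzero_scal sqzero_scal_multiplicative.

Lemma sqzero_vecD u v : sqzero_vec (u + v) = sqzero_vec u + sqzero_vec v.
Proof. by congr (_, _); rewrite addr0. Qed.

Lemma sqzero_vecN u : sqzero_vec (- u) = - sqzero_vec u.
Proof. by congr (_, _); rewrite oppr0. Qed.

Lemma sqzero_vec0 : sqzero_vec 0 = 0. Proof. by []. Qed.

Lemma sqzero_vecZ c u : sqzero_vec (c *: u) = sqzero_scal c * sqzero_vec u.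
Proof. by congr (_, _); rewrite /= ?mulr0 // scale0r addr0. Qed.

Lemma sqzero_vec_inj : injective sqzero_vec.
Proof. by move=> u v [->]. Qed.

Definition sqzero_vecE := (sqzero_vecD, sqzero_vecN, sqzero_vec0, sqzero_vecZ).

End SquareZero.

Ltac lmod := apply: sqzero_vec_inj; rewrite ?sqzero_vecE; ring.


Section Hilbert.
Variables (R : realType) (H : hilbert R).
Local Notation "<| x , y |>" := (inner H x y) (format "<| x ,  y |>").

Lemma innerDl x y z : <|x + y, z|> = <|x, z|> + <|y, z|>.
Proof. by rewrite linearDl. Qed.

Lemma innerDr x y z : <|x, y + z|> = <|x, y|> + <|x, z|>.
Proof. by rewrite linearDr. Qed.

Lemma innerNl x y : <|- x, y|> = - <|x, y|>.
Proof. by rewrite linearNl. Qed.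

Lemma innerNr x y : <|x, - y|> = - <|x, y|>.
Proof. by rewrite linearNr. Qed.

Lemma innerZl c x y : <|c *: x, y|> = c * <|x, y|>.
Proof. by rewrite linearZl_LR. Qed.

Lemma innerZr c x y : <|x, c *: y|> = Num.conj c * <|x, y|>.
Proof. by rewrite linearZr_LR. Qed.

Lemma inner0l x : <|0, x|> = 0.
Proof. by rewrite linear0l. Qed.

Lemma inner0r x : <|x, 0|> = 0.
Proof. by rewrite linear0r. Qed.

Lemma innerC x y : <|x, y|> = Num.conj <|y, x|>.
Proof. by rewrite (hermC (inner H)) expr0 mul1r. Qed.

Lemma inner_suml (I : Type) (r : seq I) (P : pred I) (f : I -> H) y :
  <|\sum_(i <- r | P i) f i, y|> = \sum_(i <- r | P i) <|f i, y|>.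
Proof. by apply: (big_morph (fun x => <|x, y|>)) => [u v|]; rewrite (innerDl, inner0l). Qed.

Lemma inner_sumr (I : Type) (r : seq I) (P : pred I) (f : I -> H) y :
  <|y, \sum_(i <- r | P i) f i|> = \sum_(i <- r | P i) <|y, f i|>.
Proof. by apply: (big_morph (fun x => <|y, x|>)) => [u v|]; rewrite (innerDr, inner0r). Qed.

Lemma conjCr (r : R) : Num.conj (r%:C : R[i]) = r%:C.
Proof. exact: conjc_real. Qed.

Lemma innerRr (r : R) x y : <|x, r%:C *: y|> = r%:C * <|x, y|>.
Proof. by rewrite innerZr conjCr. Qed.

Lemma innerxx_ge0 x : 0 <= <|x, x|>.
Proof. by have [->|/neq0_dnorm_gt0/ltW] := eqVneq x 0; rewrite ?linear0r. Qed.

Lemma innerxx_eq0 x : (<|x, x|> == 0) = (x == 0).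
Proof. exact: (dnorm_eq0 (inner H)). Qed.

Definition innerE :=
  (innerDl, innerDr, innerNl, innerNr, innerRr, innerZl, innerZr, inner0l, inner0r).

Lemma normR (x : H) : exists2 r : R, 0 <= r & `|x| = r%:C.
Proof.
have: 0 <= `|x| by []; case: `|x| => a b; rewrite lecE /= => /andP[/eqP -> a0].
by exists a.
Qed.

Lemma ex_unit (x : H) : x != 0 ->
  exists2 c : R[i], c != 0 & <|c *: x, c *: x|> = 1.
Proof.
move=> x0; have [r _ E] := normR x.
have r0 : r != 0.
  by apply: contraNneq x0 => r0; rewrite -normr_eq0 E r0.
exists (r^-1)%:C; first by rewrite fmorph_eq0 invr_eq0.
rewrite innerZl innerRr -inner_norm E -rmorphXn -!rmorphM /=.
by rewrite expr2 mulKf // mulVf.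
Qed.

(** The component of [x] orthogonal to [e] has a nonnegative square. *)
Lemma inner_unit_le (x e : H) : <|e, e|> = 1 -> `|<|x, e|>| <= `|x|.
Proof.
move=> e1; rewrite -ler_sqr ?nnegrE // inner_norm -subr_ge0 normCK.
suff <- : <|x - <|x, e|> *: e, x - <|x, e|> *: e|> =
    <|x, x|> - <|x, e|> * Num.conj <|x, e|> by exact: innerxx_ge0.
by rewrite !innerE e1 [<|e, x|>]innerC; ring.
Qed.

(** If [f x] is nonzero, the ball of radius [|f x| / M] around [x] misses the kernel. Additivity is
    assumed rather than linearity, so that maps not packaged as linear ones are covered. *)
Lemma closed_kernel (K : hilbert R) (f : H -> K) (M : R[i]) :
  {morph f : x y / x - y} -> (forall x, `|f x| <= M * `|x|) ->
  closed [set x | f x = 0].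
Proof.
move=> fB fM x clx; have [//|fx0] := eqVneq (f x) 0; exfalso.
have x0 : x != 0 by apply: contraNneq fx0 => ->; rewrite -(subrr 0) fB subrr.
have {}fx0 : 0 < `|f x| by rewrite normr_gt0.
have M0 : 0 < M by rewrite -(pmulr_lgt0 _ (_ : 0 < `|x|)) ?normr_gt0 // (lt_le_trans fx0).
have e0 : 0 < `|f x| / M by rewrite divr_gt0.
have [y [/= fy]] := clx _ (nbhsx_ballx x _ e0).
rewrite -ball_normE /= ltr_pdivlMr // mulrC => /lt_geF /negP; apply.
by apply: le_trans (fM _); rewrite fB fy subr0.
Qed.

End Hilbert.

Section Orthonormal.
Variables (R : realType) (H : hilbert R).
Local Notation "<| x , y |>" := (inner H x y) (format "<| x ,  y |>").

(** Families are indexed by [nat] with a separate length, so that the neighbours of a chain vertex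
    are written [i.-1] and [i.+1] without ordinals. *)
Definition orthonormal_upto (n : nat) (e : nat -> H) : Prop :=
  forall i j, (i < n)%N -> (j < n)%N -> <|e i, e j|> = (i == j)%:R.

Definition orthobasis (n : nat) (e : nat -> H) : Prop :=
  orthonormal_upto n e /\ forall x, x = \sum_(i < n) <|x, e i|> *: e i.

Definition irreducible_family (I : Type) (X : I -> {linear H -> H}) : Prop :=
  (exists x : H, x != 0) /\
  forall S : set H, linear_subspace S -> closed S ->
    (forall j x, S x -> S (X j x)) -> S = [set 0] \/ S = setT.

Definition span_proj (n : nat) (e : nat -> H) (x : H) : H :=
  \sum_(i < n) <|x, e i|> *: e i.

Lemma span_projP n e c x y : span_proj n e (c *: x + y) = c *: span_proj n e x + span_proj n e y.
Proof.
rewrite /span_proj scaler_sumr -big_split; apply: eq_bigr => i _ /=.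
by rewrite !innerE scalerDl scalerA.
Qed.

Lemma span_projB n e x y : span_proj n e (x - y) = span_proj n e x - span_proj n e y.
Proof. by rewrite addrC -scaleN1r span_projP scaleN1r addrC. Qed.

Lemma span_proj0 n e : span_proj n e 0 = 0.
Proof. by have := span_projB n e 0 0; rewrite !subrr. Qed.

Lemma span_proj_sum n e (I : finType) (P : pred I) (c : I -> R[i]) (f : I -> H) :
  span_proj n e (\sum_(i | P i) c i *: f i) = \sum_(i | P i) c i *: span_proj n e (f i).
Proof.
elim/big_rec2: _ => [|i u v _ <-]; first exact: span_proj0.
by rewrite span_projP.
Qed.

Lemma span_proj_id n e i : orthonormal_upto n e -> (i < n)%N -> span_proj n e (e i) = e i.
Proof.
move=> oe ni; rewrite /span_proj (bigD1 (Ordinal ni)) //= oe // eqxx scale1r big1 ?addr0 //.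
by move=> j ji; rewrite oe // [i == j]eq_sym; move: ji; rewrite -(inj_eq val_inj) /= => /negPf ->; rewrite scale0r.
Qed.

Lemma norm_unit (x : H) : <|x, x|> = 1 -> `|x| = 1.
Proof.
by move=> x1; apply/eqP; rewrite -(@eqrXn2 _ 2) // inner_norm x1 expr1n.
Qed.

Lemma span_proj_bound n e x : orthonormal_upto n e ->
  `|x - span_proj n e x| <= n.+1%:R * `|x|.
Proof.
move=> oe; apply: le_trans (ler_normB _ _) _.
rewrite -add1n natrD mulrDl mul1r lerD2l /span_proj.
apply: le_trans (ler_norm_sum _ _ _) _.
rewrite -[n in n%:R]card_ord -sum1_card natr_sum mulr_suml ler_sum // => i _.
have ei : <|e i, e i|> = 1 by rewrite oe // eqxx.
by rewrite normrZ (norm_unit ei) mulr1 mul1r inner_unit_le.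
Qed.

(** The fixed points of the orthogonal projection onto the span form a closed invariant subspace; it
    contains [e 0], so irreducibility makes it the whole space. *)
Lemma irreducible_span (I : Type) (X : I -> {linear H -> H}) n e :
  irreducible_family X -> (0 < n)%N -> orthonormal_upto n e ->
  (forall j i, (i < n)%N -> span_proj n e (X j (e i)) = X j (e i)) -> orthobasis n e.
Proof.
move=> [_ irrX] n0 oe Xe; split=> // x.
pose S := [set x | x - span_proj n e x = 0].
have SE y : S y <-> y = span_proj n e y.
  by split=> [/eqP|E]; rewrite /S /= ?subr_eq0 => //; [move/eqP|rewrite -E subrr].
have [|||S0|ST] := irrX S.
- split=> [|c y z /SE Ey /SE Ez]; apply/SE; first by rewrite span_proj0.
  by rewrite span_projP -Ey -Ez.
- apply: (@closed_kernel _ _ H (fun x => x - span_proj n e x) n.+1%:R).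
    by move=> y z; rewrite span_projB; lmod.
  by move=> y; apply: span_proj_bound.
- move=> j y /SE Ey; apply/SE; rewrite Ey /span_proj linear_sum /=.
  rewrite -/(span_proj n e _); under [in RHS]eq_bigr do rewrite linearZ /=.
  rewrite span_proj_sum; apply: eq_bigr => i _.
  by rewrite linearZ Xe.
- have : S (e 0%N) by apply/SE; rewrite span_proj_id.
  rewrite S0 /= => e00; have := oe 0%N 0%N n0 n0.
  by rewrite e00 inner0l => /esym/eqP; rewrite oner_eq0.
- by apply/SE; rewrite ST.
Qed.

Section Trace.
Variables (n : nat) (e : nat -> H) (be : orthobasis n e).

Definition comb (u : 'rV[R[i]]_n) : H := \sum_(j < n) u ord0 j *: e j.

Definition coords (x : H) : 'rV[R[i]]_n := \row_j <|x, e j|>.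

Lemma coordsK x : comb (coords x) = x.
Proof. by rewrite [RHS]be.2; apply: eq_bigr => i _; rewrite mxE. Qed.

Lemma combK u : coords (comb u) = u.
Proof.
apply/rowP => j; rewrite mxE inner_suml (bigD1 j) //= innerZl be.1 // eqxx mulr1.
rewrite big1 ?addr0 // => k; rewrite -(inj_eq val_inj) /= => /negPf kj.
by rewrite innerZl be.1 // kj mulr0.
Qed.

Lemma comb_sum (r : nat) (c : 'rV[R[i]]_r) (B : 'M[R[i]]_(r, n)) :
  comb (c *m B) = \sum_k c ord0 k *: comb (row k B).
Proof.
under [RHS]eq_bigr do rewrite /comb scaler_sumr.
rewrite exchange_big /=; apply: eq_bigr => j _; rewrite mxE scaler_suml.
by apply: eq_bigr => k _; rewrite mxE scalerA.
Qed.

Variable P : {linear H -> H}.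
Hypothesis PP : forall x, P (P x) = P x.

Let M : 'M[R[i]]_n := \matrix_(i, j) <|P (e i), e j|>.

Lemma linear_comb u : P (comb u) = comb (u *m M).
Proof.
rewrite comb_sum /comb linear_sum; apply: eq_bigr => k _; rewrite linearZ /=.
by congr (_ *: _); rewrite [LHS]be.2; apply: eq_bigr => j _; rewrite !mxE.
Qed.

Lemma has_basis_range : has_basis (range P) (\rank M).
Proof.
exists (fun k => comb (row k (row_base M))); split.
- move=> k; have /submxP[u ->] : (row k (row_base M) <= M)%MS.
    by rewrite (submx_trans (row_sub _ _)) // eq_row_base.
  by exists (comb u); rewrite ?linear_comb.
- move=> c; pose u : 'rV[R[i]]_(\rank M) := \row_k c k => h i.
  have : comb (u *m row_base M) = 0.
    by rewrite comb_sum -[RHS]h; apply: eq_bigr => k _; rewrite mxE.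
  move/(congr1 coords); rewrite combK => E.
  have : u *m row_base M = 0 *m row_base M.
    by rewrite mul0mx E; apply/rowP => k; rewrite !mxE inner0l.
  move/(row_free_inj (row_base_free M)) => u0.
  by have := congr1 (fun v : 'rV[R[i]]_(\rank M) => v ord0 i) u0; rewrite !mxE.
- move=> _ [y _ <-]; rewrite -(coordsK y) linear_comb.
  have /submxP[u ->] : (coords y *m M <= row_base M)%MS.
    by rewrite eq_row_base submxMl.
  by exists (fun k => u ord0 k); rewrite comb_sum.
Qed.

(** Factor the matrix of [P] as [F B], with [F] the coordinates of [P (e i)] in the basis [b] of the
    range and [B] those of [b k] in [e]. Idempotence gives [B F = 1], so the trace of [F B] is
    [r]. *)
Lemma has_basis_trace r : has_basis (range P) r ->
  r%:R = \sum_(i < n) <|P (e i), e i|>.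
Proof.
move=> [b [bP bfree bgen]].
have /choice[c cE] (i : 'I_n) : exists c : 'I_r -> R[i], P (e i) = \sum_k c k *: b k.
  by apply: bgen; exists (e i).
pose F : 'M[R[i]]_(n, r) := \matrix_(i, k) c i k.
pose B : 'M[R[i]]_(r, n) := \matrix_(k, i) <|b k, e i|>.
have BF : B *m F = 1%:M.
  apply/matrixP => k l; apply/eqP; rewrite -subr_eq0; apply/eqP.
  move: l; apply: bfree.
  have -> : \sum_i ((B *m F) k i - (1%:M : 'M[R[i]]_r) k i) *: b i =
      \sum_i (B *m F) k i *: b i - b k.
    under eq_bigr do rewrite scalerBl.
    rewrite sumrB; congr (_ - _); rewrite (bigD1 k) //= mxE eqxx scale1r.
    by rewrite big1 ?addr0 // => j jk; rewrite mxE eq_sym (negPf jk) scale0r.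
  apply/eqP; rewrite subr_eq0; apply/eqP.
  have [y _ yb] := bP k; have Pb : P (b k) = b k by rewrite -yb PP.
  rewrite -[RHS]Pb [in X in _ = X](be.2 (b k)) linear_sum /=.
  under [RHS]eq_bigr => i _ do rewrite linearZ /= cE scaler_sumr.
  rewrite exchange_big /=; apply: eq_bigr => j _; rewrite mxE scaler_suml.
  by apply: eq_bigr => i _; rewrite !mxE scalerA.
rewrite -(mxtrace1 _ r) -BF mxtrace_mulC /mxtrace; apply: eq_bigr => i _.
rewrite cE inner_suml mxE; apply: eq_bigr => k _.
by rewrite !mxE innerZl.
Qed.

Lemma has_dim_range d : has_dim (range P) d <->
  exists2 r, d = Some r & r%:R = \sum_(i < n) <|P (e i), e i|>.
Proof.
have hb := has_basis_range; have tr := has_basis_trace hb.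
split=> [|[r -> rE]] /=.
  case: d => [r /has_basis_trace rE|/(_ (\rank M))//]; by exists r.
suff -> : r = \rank M by [].
by apply/eqP; rewrite -(eqr_nat R[i]) rE tr.
Qed.

End Trace.

Lemma has_dim_setT n e d : orthobasis n e -> has_dim [set: H] d <-> d = Some n.
Proof.
move=> be; have -> : [set: H] = range (idfun : {linear H -> H}).
  by apply/seteqP; split=> x // _; exists x.
have tr : \sum_(i < n) <|e i, e i|> = n%:R.
  rewrite (eq_bigr (fun=> 1)) => [|i _]; last by rewrite be.1 // eqxx.
  by rewrite sumr_const card_ord.
rewrite (has_dim_range be) //= tr; split=> [[r -> /eqP]|->]; last by exists n.
by rewrite eqr_nat => /eqP ->.
Qed.

End Orthonormal.

(** * Representations and systems of involutions *)

Section Involutions.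
Variables (R : realType) (H : hilbert R).
Local Notation "<| x , y |>" := (inner H x y) (format "<| x ,  y |>").

Definition involution_system (a : 'I_4 -> R) (lam : R)
    (X : 'I_4 -> {linear H -> H}) : Prop :=
  [/\ forall j x, X j (X j x) = x,
      forall j x y, <|X j x, y|> = <|x, X j y|>
    & forall x, \sum_j (a j)%:C *: X j x = lam%:C *: x].

Definition nonscalar_family (X : 'I_4 -> {linear H -> H}) : Prop :=
  forall j (b : bool), exists2 x, x != 0 & X j x = (-1) ^+ b *: x.

(* X is the symmetry 2 P - 1 attached to the projection P = A / w. *)
Definition symmetry_of (w : R) (A : {linear H -> H}) : {linear H -> H} :=
  ((2 / w)%:C \*: A) \- idfun.

Lemma symmetry_ofE w A x : symmetry_of w A x = (2 / w)%:C *: A x - x.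
Proof. by []. Qed.

Section OneProjection.
Variables (w : R) (A : {linear H -> H}).
Hypothesis w0 : w != 0.
Hypothesis AA : forall x, A (A x) = w%:C *: A x.
Hypothesis Asa : forall x y, <|A x, y|> = <|x, A y|>.

Lemma symmetry_invol x : symmetry_of w A (symmetry_of w A x) = x.
Proof.
rewrite !symmetry_ofE linearB linearZ /= AA.
have -> : (2 / w)%:C *: ((2 / w)%:C *: (w%:C *: A x) - A x) =
    ((2 / w)%:C * ((2 / w * w)%:C - 1)) *: A x by lmod.
have -> : (2 / w * w)%:C - 1 = 1 :> R[i] by rewrite divfK // rmorph_nat; ring.
by lmod.
Qed.

Lemma symmetry_selfadj x y : <|symmetry_of w A x, y|> = <|x, symmetry_of w A y|>.
Proof. by rewrite !symmetry_ofE !innerE Asa. Qed.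

Lemma spectral_proj_weight : spectral_proj A w%:C (fun x => (w^-1)%:C *: A x).
Proof.
move=> x; split=> [|y Ay]; first by rewrite linearZ /= AA !scalerA mulrC.
rewrite !innerE Asa Ay innerRr mulrA -rmorphM mulVf // mul1r subrr //.
Qed.

Lemma spectral_proj_zero :
  spectral_proj A 0 (fun x => x - (w^-1)%:C *: A x).
Proof.
move=> x; split=> [|y Ay].
  by rewrite linearB linearZ /= AA scalerA -rmorphM mulVf // scale1r scale0r subrr.
by rewrite opprB addrC subrK innerZl Asa Ay scale0r inner0r mulr0.
Qed.

(** The difference [P x - Q x] lies in the eigenspace to which both residues are orthogonal. This
    identifies the unspecified projection in [has_gendim] with [A / w]. *)
Lemma spectral_proj_uniq (b : R[i]) (P Q : H -> H) :
  spectral_proj A b P -> spectral_proj A b Q -> P =1 Q.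
Proof.
move=> hP hQ x; have [AP oP] := hP x; have [AQ oQ] := hQ x.
have E : A (P x - Q x) = b *: (P x - Q x) by rewrite linearB /= AP AQ scalerBr.
apply/eqP; rewrite -subr_eq0 -innerxx_eq0.
have -> : <|P x - Q x, P x - Q x|> = <|x - Q x, P x - Q x|> - <|x - P x, P x - Q x|>.
  by rewrite -[- <|_, _|>]innerNl -innerDl; congr (inner H _ _); lmod.
by rewrite oP // oQ // subrr.
Qed.

End OneProjection.

End Involutions.

Lemma sum4 (V : zmodType) (F : 'I_4 -> V) :
  \sum_j F j = F (inord 0) + F (inord 1) + F (inord 2) + F (inord 3).
Proof.
rewrite 4!big_ord_recl big_ord0 addr0 !addrA.
by congr (F _ + F _ + F _ + F _); apply: val_inj; rewrite /= inordK.
Qed.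

Section FromRep.
Variables (R : realType) (chi : 'cV[R]_5) (H : hilbert R) (pi : star_rep chi H).
Local Notation "<| x , y |>" := (inner H x y) (format "<| x ,  y |>").
Let w j := chi (first4 j) ord0.
Let lam := 2 * chi ord_max ord0 - \sum_j w j.
Hypothesis w_gt0 : forall j, 0 < w j.

Let w_neq0 j : w j != 0. Proof. by rewrite gt_eqF. Qed.

Definition rep_symmetry j := symmetry_of (w j) (pi (Gen j)).

Lemma rep_gen_quad j x : pi (Gen j) (pi (Gen j) x) = (w j)%:C *: pi (Gen j) x.
Proof.
have := rep_eq pi (eq_gen_spectrum chi j) x.
rewrite rep_mul rep_add !rep_cst linearD linearZ /= scale0r => /eqP.
by rewrite scaleNr subr_eq0 => /eqP.
Qed.

Lemma rep_gen_selfadj j x y : <|pi (Gen j) x, y|> = <|x, pi (Gen j) y|>.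
Proof. by rewrite rep_star (rep_eq pi (eq_gen_selfadjoint chi j)). Qed.

Lemma rep_system : involution_system w lam rep_symmetry.
Proof.
split=> [j x|j x y|x].
- by apply: symmetry_invol => // y; exact: rep_gen_quad.
- by apply: symmetry_selfadj => // u v; exact: rep_gen_selfadj.
- have := rep_eq pi (eq_gen_sum chi) x; rewrite /GenSum !rep_add rep_cst => E.
  rewrite (eq_bigr (fun j => 2 *: pi (Gen j) x - (w j)%:C *: x)) => [|j _]; last first.
    rewrite symmetry_ofE scalerBr scalerA -rmorphM mulrC divfK //.
    by rewrite rmorph_nat.
  rewrite sumrB -scaler_sumr -scaler_suml sum4 E /lam -rmorph_sum.
  by lmod.
Qed.

Lemma rep_irreducible : irreducible_rep pi -> irreducible_family rep_symmetry.
Proof.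
move=> [x0 irr]; split=> // S linS clS Sinv; apply: irr => //.
have S0 := linS.1; have SD := linS.2.
have SZ c x : S x -> S (c *: x) by move=> Sx; rewrite -[_ *: _]addr0; exact: SD.
have Sadd x y : S x -> S y -> S (x + y) by move=> Sx Sy; rewrite -[x]scale1r; exact: SD.
have SGen j x : S x -> S (pi (Gen j) x).
  move=> Sx; have -> : pi (Gen j) x = (w j / 2)%:C *: (rep_symmetry j x + x).
    have E : w j / 2 * (2 / w j) = 1 by field; exact: w_neq0.
    by rewrite symmetry_ofE subrK scalerA -rmorphM E scale1r.
  by apply: SZ; apply: Sadd => //; exact: Sinv.
(* [a] and [Star a] are treated together: [Star] is a constructor, and it reverses products, so
   neither half is inductive alone. *)
suff: forall a, (forall x, S x -> S (pi a x)) /\ (forall x, S x -> S (pi (Star a) x)).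
  by move=> h a; have [] := h a.
elim=> [j|c|a [ha hsa] b [hb hsb]|a [ha hsa] b [hb hsb]|a [ha hsa]].
- by split=> x /SGen // /(_ j); rewrite (rep_eq pi (eq_gen_selfadjoint chi j)).
- by split=> x Sx; rewrite ?(rep_eq pi (eq_starC chi c)) rep_cst; exact: SZ.
- split=> x Sx; rewrite ?(rep_eq pi (eq_starD chi a b)) rep_add; apply: Sadd;
    by [exact: ha|exact: hb|exact: hsa|exact: hsb].
- split=> x Sx; rewrite ?(rep_eq pi (eq_starM chi a b)) rep_mul.
    by apply: ha; exact: hb.
  by apply: hsb; exact: hsa.
- by split=> // x Sx; rewrite (rep_eq pi (eq_starK chi a)); exact: ha.
Qed.

Lemma rep_nonscalar : nondegenerate_rep pi <-> nonscalar_family rep_symmetry.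
Proof.
have qj := rep_gen_quad; have sj := rep_gen_selfadj.
have rE j x : rep_symmetry j x = (2 / w j)%:C *: pi (Gen j) x - x by [].
have two : (2 : R[i]) != 0 by rewrite pnatr_eq0.
split=> [nd j b|ns j a ha].
  have hb : (if b then 0 else (w j)%:C) = weight chi j \/ (if b then 0 else (w j)%:C) = 0.
    by case: b; [right|left].
  have [P [hP [x Px]]] := nd j _ hb.
  exists (P x) => //; rewrite rE (hP x).1; case: b {hb Px} hP => hP /=.
    by rewrite !scale0r scaler0 sub0r expr1 scaleN1r.
  rewrite scalerA -rmorphM divfK // rmorph_nat expr0; lmod.
case: ha => ->.
  exists (fun x => ((w j)^-1)%:C *: pi (Gen j) x); split; first exact: (spectral_proj_weight (w_neq0 j) (qj j) (sj j)).
  have [x x0] := ns j false; rewrite rE expr0 => E; exists x.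
  apply: contraNneq x0 => E2; have : 2 *: (0 : H) = 2 *: x.
    rewrite -E2 scalerA -(rmorph_nat (real_complex R)) -rmorphM.
    by move/eqP: E; rewrite subr_eq => /eqP ->; rewrite rmorph_nat; lmod.
  by rewrite scaler0 => /esym/eqP; rewrite scaler_eq0 (negPf two).
exists (fun x => x - ((w j)^-1)%:C *: pi (Gen j) x); split; first exact: (spectral_proj_zero (w_neq0 j) (qj j) (sj j)).
have [x x0] := ns j true; rewrite rE expr1 scaleN1r => E; exists x.
suff -> : pi (Gen j) x = 0 by rewrite scaler0 subr0.
move/eqP: E; rewrite subr_eq addNr scaler_eq0 => /orP[|/eqP//].
by rewrite fmorph_eq0 mulf_eq0 invr_eq0 pnatr_eq0 (negPf (w_neq0 j)).
Qed.

(** The symmetry is [2 P - 1] for the spectral projection [P], and the rank of [P] is its trace. *)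
Lemma rep_gendim n e v : orthobasis n e ->
  has_gendim pi v <->
  (v ord_max ord0 = Some n /\ forall j, exists2 r,
     v (first4 j) ord0 = Some r &
     2 * r%:R = n%:R + \sum_(i < n) <|rep_symmetry j (e i), e i|>).
Proof.
move=> be; have qj := rep_gen_quad; have sj := rep_gen_selfadj.
pose P j : {linear H -> H} := ((w j)^-1)%:C \*: pi (Gen j).
have PP j x : P j (P j x) = P j x.
  rewrite /P /= linearZ /= qj !scalerA; congr (_ *: _).
  by rewrite -!rmorphM -mulrA mulVf // mulr1.
have trP j : 2 * (\sum_(i < n) <|P j (e i), e i|>) =
    n%:R + \sum_(i < n) <|rep_symmetry j (e i), e i|>.
  have -> : n%:R = \sum_(i < n) <|e i, e i|>.
    rewrite (eq_bigr (fun=> 1)) => [|i _]; last by rewrite be.1 // eqxx.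
    by rewrite sumr_const card_ord.
  rewrite mulr_sumr -big_split; apply: eq_bigr => i _ /=.
  rewrite !innerE rmorphM rmorph_nat. ring.
have two : (2 : R[i]) != 0 by rewrite pnatr_eq0.
have sp j : spectral_proj (pi (Gen j)) (weight chi j) (P j).
  exact: (spectral_proj_weight (w_neq0 j) (qj j) (sj j)).
rewrite /has_gendim; split=> [[h1 h2]|[h1 h2]].
  split; first by apply/(has_dim_setT _ be).
  move=> j; have [Q [hQ]] := h1 j.
  rewrite (_ : Q = P j); last by apply/funext; exact: spectral_proj_uniq hQ (sp j).
  move/(has_dim_range be (PP j)) => [r -> rE]; exists r => //.
  by rewrite -trP rE.
split; last by apply/(has_dim_setT _ be).
move=> j; exists (P j); split=> //; apply/(has_dim_range be (PP j)).
have [r -> rE] := h2 j; exists r => //.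
by apply: (mulfI two); rewrite rE trP.
Qed.

End FromRep.

Section ToRep.
Variables (R : realType) (chi : 'cV[R]_5) (H : hilbert R).
Local Notation "<| x , y |>" := (inner H x y) (format "<| x ,  y |>").
Let w j := chi (first4 j) ord0.
Let lam := 2 * chi ord_max ord0 - \sum_j w j.
Hypothesis w_gt0 : forall j, 0 < w j.
Variable X : 'I_4 -> {linear H -> H}.
Hypothesis sysX : involution_system w lam X.

Let w_neq0 j : w j != 0. Proof. by rewrite gt_eqF. Qed.

Definition gen_op j : {linear H -> H} := ((w j / 2)%:C \*: (X j \+ idfun)).

Lemma gen_opE j x : gen_op j x = (w j / 2)%:C *: (X j x + x).
Proof. by []. Qed.

(* [eval_poly true p] is the adjoint of [eval_poly false p]. *)
Fixpoint eval_poly (b : bool) (p : star_poly R) : {linear H -> H} :=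
  match p with
  | Gen j => gen_op j
  | Cst c => (if b then Num.conj c else c) \*: idfun
  | Add p q => eval_poly b p \+ eval_poly b q
  | Mul p q => if b then (eval_poly b q \o eval_poly b p : {linear H -> H})
               else (eval_poly b p \o eval_poly b q : {linear H -> H})
  | Star p => eval_poly (~~ b) p
  end.

Lemma eval_poly_adj p b x y : <|eval_poly b p x, y|> = <|x, eval_poly (~~ b) p y|>.
Proof.
have [_ Xsa _] := sysX.
elim: p b x y => [j|c|p IHp q IHq|p IHp q IHq|p IHp] b x y /=.
- by rewrite !innerE Xsa.
- by rewrite innerZl innerZr; case: b => //=; rewrite conjCK.
- by rewrite !innerE IHp IHq.
- by case: b => /=; rewrite ?IHp ?IHq /= ?IHp ?IHq.
- by rewrite IHp.
Qed.

(** Both values of [b] are carried along, because the congruence rule for [Star] exchanges them. *)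
Lemma eval_poly_eq p q : alg_eq chi p q -> forall b, eval_poly b p =1 eval_poly b q.
Proof.
have [XX Xsa Xsum] := sysX.
elim=> {p q} /=.
- by [].
- by move=> p q _ IH b x; rewrite IH.
- by move=> p q r _ IH1 _ IH2 b x; rewrite IH1 IH2.
- by move=> p p' q q' _ IHp _ IHq b x /=; rewrite IHp IHq.
- by move=> p p' q q' _ IHp _ IHq [] x /=; rewrite IHp IHq.
- by move=> p p' _ IH b x; rewrite IH.
- by move=> p q r b x /=; rewrite addrA.
- by move=> p q b x /=; rewrite addrC.
- by move=> p [] x /=; rewrite ?rmorph0 scale0r add0r.
- move=> p [] x /=; rewrite ?rmorphN ?rmorph1 ?rmorph0 scale0r scaleN1r ?linearN addNr //.
- by move=> p q r [].
- by move=> p [] x /=; rewrite ?rmorph1 scale1r.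
- by move=> p q r [] x //=; rewrite linearD.
- by move=> p q r [] x //=; rewrite linearD.
- by move=> c d [] x /=; rewrite ?rmorphD scalerDl.
- by move=> c d [] x /=; rewrite ?rmorphM scalerA // mulrC.
- by move=> c p [] x /=; rewrite linearZ.
- by move=> p b x; rewrite negbK.
- by move=> p q b x.
- by move=> p q [].
- by move=> c [] x /=; rewrite ?conjCK.
- by [].
- move=> j b x.
  suff E y : gen_op j (gen_op j y) + - (weight chi j) *: gen_op j y = 0.
    case: b.
      transitivity (gen_op j (gen_op j x) + Num.conj (- weight chi j) *: gen_op j x) => //.
      have -> : Num.conj (- weight chi j) = - weight chi j by rewrite rmorphN; congr (- _); exact: conjCr.
      by rewrite E /= rmorph0 scale0r.
    transitivity (gen_op j (gen_op j x + (- weight chi j) *: x)) => //.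
    have L (f : {linear H -> H}) u c v : f (u + c *: v) = f u + c *: f v.
      by rewrite linearD linearZ.
    by rewrite L E [RHS]scale0r.
  rewrite !gen_opE [X j (_ *: _)]linearZ [X j (_ + _)]linearD /= XX /weight -/(w j).
  by have := splitr (w j); set h := w j / 2 => ->; lmod.
- move=> b x /=.
  have E y : \sum_j gen_op j y = (chi ord_max ord0)%:C *: y.
    rewrite (eq_bigr (fun j => (2^-1)%:C *: ((w j)%:C *: X j y + (w j)%:C *: y))) => [|j _].
      rewrite -scaler_sumr big_split /= Xsum -scaler_suml.
      have -> : \sum_j (w j)%:C = (\sum_j w j)%:C :> R[i] by rewrite rmorph_sum.
      by rewrite -scalerDl scalerA -rmorphD -rmorphM /lam subrK mulKf // pnatr_eq0.
    by rewrite gen_opE rmorphM; lmod.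
  have := E x; rewrite sum4 => ->.
  by case: b; rewrite ?conjCr.
Qed.

Lemma involution_isometry j x : `|X j x| = `|x|.
Proof.
have [XX Xsa _] := sysX.
by apply/eqP; rewrite -(@eqrXn2 _ 2) // !inner_norm Xsa XX.
Qed.

Lemma eval_poly_bounded p b :
  exists2 M : R[i], 0 <= M & forall x, `|eval_poly b p x| <= M * `|x|.
Proof.
elim: p b => [j|c|p IHp q IHq|p IHp q IHq|p IHp] b /=.
- exists (`|(w j / 2)%:C| * 2) => [|x]; first by rewrite mulr_ge0.
  rewrite normrZ -mulrA ler_wpM2l // mulr_natl mulr2n.
  by apply: le_trans (ler_normD _ _) _; rewrite involution_isometry.
- by exists `|if b then Num.conj c else c| => // x; rewrite normrZ.
- have [M M0 hM] := IHp b; have [N N0 hN] := IHq b.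
  exists (M + N) => [|x]; first exact: addr_ge0.
  by apply: le_trans (ler_normD _ _) _; rewrite mulrDl lerD.
- have [M M0 hM] := IHp b; have [N N0 hN] := IHq b.
  exists (M * N) => [|x]; first exact: mulr_ge0.
  case: b hM hN => hM hN /=.
    by apply: le_trans (hN _) _; rewrite [M * N]mulrC -mulrA ler_wpM2l.
  by apply: le_trans (hM _) _; rewrite -mulrA ler_wpM2l.
- exact: IHp.
Qed.

Lemma rep_of_system : exists pi : star_rep chi H,
  forall j x, rep_symmetry pi j x = X j x.
Proof.
have bnd p : exists M : R[i], forall x, `|eval_poly false p x| <= M * `|x|.
  by have [M _ hM] := eval_poly_bounded p false; exists M.
unshelve eexists (@StarRep R chi H (eval_poly false) bnd _ _ _ _ _).
- by move=> p q /eval_poly_eq.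
- by [].
- by [].
- by [].
- by move=> p x y; rewrite eval_poly_adj.
move=> j x; rewrite /rep_symmetry symmetry_ofE /= scalerA -rmorphM.
have -> : 2 / w j * (w j / 2) = 1 by field; exact: w_neq0.
by rewrite scale1r addrK.
Qed.

Lemma irreducible_rep_of_family (pi : star_rep chi H) :
  (forall j x, rep_symmetry pi j x = X j x) ->
  irreducible_family X -> irreducible_rep pi.
Proof.
move=> piX [x0 irr]; split=> // S linS clS Sinv; apply: irr => // j x Sx.
rewrite -piX /rep_symmetry symmetry_ofE.
by apply: linS.2; [exact: Sinv|rewrite -scaleN1r -[_ *: _]addr0; apply: linS.2 => //; exact: linS.1].
Qed.

End ToRep.

(** * Unitary equivalence from equal matrices *)

Section Equivalence.
Variables (R : realType) (chi : 'cV[R]_5).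
Variables (H1 H2 : hilbert R) (pi1 : star_rep chi H1) (pi2 : star_rep chi H2).
Hypothesis w_gt0 : forall j, 0 < chi (first4 j) ord0.

(** The unitary sends [e1 i] to [e2 i]. It intertwines the symmetries, hence the generators
    [w (X + 1) / 2], hence all polynomials in them. *)
Lemma unitary_of_bases n (e1 : nat -> H1) (e2 : nat -> H2)
    (M : 'I_4 -> nat -> nat -> R[i]) :
  orthobasis n e1 -> orthobasis n e2 ->
  (forall j i, (i < n)%N ->
     rep_symmetry pi1 j (e1 i) = \sum_(k < n) M j i k *: e1 k) ->
  (forall j i, (i < n)%N ->
     rep_symmetry pi2 j (e2 i) = \sum_(k < n) M j i k *: e2 k) ->
  unitarily_equivalent pi1 pi2.
Proof.
move=> b1 b2 X1 X2.
pose U (x : H1) : H2 := \sum_(i < n) inner H1 x (e1 i) *: e2 i.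
pose V (x : H2) : H1 := \sum_(i < n) inner H2 x (e2 i) *: e1 i.
have Ulin : linear U.
  move=> c x y; rewrite /U scaler_sumr -big_split; apply: eq_bigr => i _ /=.
  by rewrite !innerE scalerDl scalerA.
pose UL : {linear H1 -> H2} := HB.pack U (GRing.isLinear.Build _ _ _ _ U Ulin).
have cU x i : (i < n)%N -> inner H2 (U x) (e2 i) = inner H1 x (e1 i).
  move=> ni; rewrite inner_suml (bigD1 (Ordinal ni)) //= innerZl b2.1 // eqxx mulr1.
  rewrite big1 ?addr0 // => k; rewrite -(inj_eq val_inj) /= => /negPf ki.
  by rewrite innerZl b2.1 // ki mulr0.
have cV x i : (i < n)%N -> inner H1 (V x) (e1 i) = inner H2 x (e2 i).
  move=> ni; rewrite inner_suml (bigD1 (Ordinal ni)) //= innerZl b1.1 // eqxx mulr1.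
  rewrite big1 ?addr0 // => k; rewrite -(inj_eq val_inj) /= => /negPf ki.
  by rewrite innerZl b1.1 // ki mulr0.
have VU x : V (U x) = x.
  by rewrite [RHS]b1.2; apply: eq_bigr => i _; rewrite cU.
have UV x : U (V x) = x.
  by rewrite [RHS]b2.2; apply: eq_bigr => i _; rewrite cV.
have Uiso x y : inner H2 (U x) (U y) = inner H1 x y.
  rewrite {2}/U inner_sumr [in RHS](b1.2 y) inner_sumr.
  by apply: eq_bigr => i _; rewrite !innerZr cU.
have Ucomb (c : nat -> R[i]) : U (\sum_(i < n) c i *: e1 i) = \sum_(i < n) c i *: e2 i.
  apply: eq_bigr => k _; congr (_ *: _); rewrite inner_suml (bigD1 k) //=.
  rewrite innerZl b1.1 // eqxx mulr1 big1 ?addr0 // => l; rewrite -(inj_eq val_inj).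
  by move=> /negPf kl; rewrite innerZl b1.1 // kl mulr0.
have Xcomb (K : hilbert R) (T : {linear K -> K}) (e : nat -> K) (N : nat -> nat -> R[i])
    (c : nat -> R[i]) :
    (forall i, (i < n)%N -> T (e i) = \sum_(k < n) N i k *: e k) ->
    T (\sum_(i < n) c i *: e i) = \sum_(k < n) (\sum_(i < n) c i * N i k) *: e k.
  move=> TE; rewrite linear_sum /=.
  under eq_bigr => i _ do rewrite linearZ /= TE // scaler_sumr.
  rewrite exchange_big /=; apply: eq_bigr => k _; rewrite scaler_suml.
  by apply: eq_bigr => i _; rewrite scalerA.
have UX j x : U (rep_symmetry pi1 j x) = rep_symmetry pi2 j (U x).
  rewrite {1}(b1.2 x) (Xcomb _ _ _ (M j) (fun i => inner H1 x (e1 i)) (X1 j)).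
  rewrite (Ucomb (fun k => \sum_(i < n) inner H1 x (e1 i) * M j i k)) /U.
  by rewrite (Xcomb _ _ _ (M j) (fun i => inner H1 x (e1 i)) (X2 j)).
have UG j x : U (pi1 (Gen j) x) = pi2 (Gen j) (U x).
  set w := chi (first4 j) ord0.
  have w0 : w != 0 by rewrite gt_eqF ?w_gt0.
  have E (K : hilbert R) (pi : star_rep chi K) y :
      pi (Gen j) y = (w / 2)%:C *: (rep_symmetry pi j y + y).
    rewrite /rep_symmetry symmetry_ofE subrK scalerA -rmorphM.
    have -> : w / 2 * (2 / chi (first4 j) ord0) = 1 by rewrite -/w; field.
    by rewrite scale1r.
  by rewrite !E -UX -![U _]/(UL _) linearZ linearD.
exists UL; split=> //; first by exists V.
move=> a; rewrite /=.
suff: (forall x, U (pi1 a x) = pi2 a (U x)) /\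
      (forall x, U (pi1 (Star a) x) = pi2 (Star a) (U x)) by case.
elim: a => [j|c|a [ha hsa] b [hb hsb]|a [ha hsa] b [hb hsb]|a [ha hsa]].
- by split=> x; rewrite ?(rep_eq _ (eq_gen_selfadjoint chi j)) UG.
- by split=> x; rewrite ?(rep_eq _ (eq_starC chi c)) !rep_cst -![U _]/(UL _) linearZ.
- split=> x; rewrite ?(rep_eq _ (eq_starD chi a b)) !rep_add -![U _]/(UL _) linearD /=.
    by rewrite ha hb.
  by rewrite hsa hsb.
- split=> x; rewrite ?(rep_eq _ (eq_starM chi a b)) !rep_mul.
    by rewrite ha hb.
  by rewrite hsb hsa.
- by split=> // x; rewrite !(rep_eq _ (eq_starK chi a)) ha.
Qed.

End Equivalence.

(** * Systems built from pairings of a basis *)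

Lemma sum_ord_in (n : nat) (V : nmodType) (F : 'I_n -> V) i :
  (forall k, k != i -> F k = 0) -> \sum_k F k = F i.
Proof. by move=> F0; rewrite (bigD1 i) //= big1 ?addr0. Qed.

Section Pairing.
Variables (R : realType) (n : nat).
Local Notation H := (chilbert R n).
Local Notation V := (cspace R n).
Local Notation "<| x , y |>" := (inner H x y) (format "<| x ,  y |>").

Lemma chilbert_inner (x y : V) :
  inner H x y = \sum_i x ord0 i * Num.conj (y ord0 i).
Proof. by []. Qed.

Definition std (k : nat) : H := (\row_i (i == k :> nat)%:R : V).

Lemma stdE (i k : 'I_n) : (std k : V) ord0 i = (i == k)%:R.
Proof. by rewrite mxE. Qed.

Lemma coordD (x y : H) i : (x + y : V) ord0 i = (x : V) ord0 i + (y : V) ord0 i.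
Proof. by rewrite mxE. Qed.

Lemma coordZ c (x : H) i : (c *: x : V) ord0 i = c * (x : V) ord0 i.
Proof. by rewrite mxE. Qed.

Lemma coordN (x : H) i : (- x : V) ord0 i = - (x : V) ord0 i.
Proof. by rewrite mxE. Qed.

Definition coordE := (coordD, coordZ, coordN).

Lemma inner_std (x : V) (i : 'I_n) : <|x, std i|> = x ord0 i.
Proof.
rewrite chilbert_inner (sum_ord_in (i := i)) => [|k /negPf ki]; rewrite stdE.
  by rewrite eqxx rmorph1 mulr1.
by rewrite ki rmorph0 mulr0.
Qed.

Lemma std_basis : orthobasis n std.
Proof.
split=> [i j ni nj|x].
  by rewrite (inner_std _ (Ordinal nj)) (stdE _ (Ordinal ni)) eq_sym.
apply/rowP => i; rewrite summxE (sum_ord_in (i := i)) => [|k ki].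
  by rewrite mxE stdE eqxx mulr1 inner_std.
by rewrite mxE stdE eq_sym (negPf ki) mulr0.
Qed.

(** On the plane of [i] and [sg i] this is the matrix with diagonal [d i], [d (sg i)] and
    off-diagonal entry [t]: a reflection when [d (sg i) = - d i] and [d ^+ 2 + t ^+ 2 = 1]. *)
Definition pairing_fun (sg : 'I_n -> 'I_n) (d t : 'I_n -> R) (x : V) : V :=
  \row_i ((d i)%:C * x ord0 i + (t i)%:C * x ord0 (sg i)).

Lemma pairing_linear sg d t : linear (pairing_fun sg d t : H -> H).
Proof.
by move=> c x y; apply/rowP => i; rewrite !mxE; ring.
Qed.

HB.instance Definition _ sg d t :=
  GRing.isLinear.Build R[i] H H *:%R (pairing_fun sg d t) (pairing_linear sg d t).

Definition pairing_op sg d t : {linear H -> H} := pairing_fun sg d t.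

Lemma pairing_opE sg d t (x : V) i :
  (pairing_op sg d t x : V) ord0 i = (d i)%:C * x ord0 i + (t i)%:C * x ord0 (sg i).
Proof. by rewrite mxE. Qed.

Section OnePairing.
Variables (sg : 'I_n -> 'I_n) (d t : 'I_n -> R).
Hypothesis sgK : involutive sg.
Hypothesis t_sg : forall i, t (sg i) = t i.
Hypothesis td : forall i, t i * (d i + d (sg i)) = 0.
Hypothesis dt1 : forall i, d i ^+ 2 + t i ^+ 2 = 1.

Lemma pairing_invol x : pairing_op sg d t (pairing_op sg d t x) = x.
Proof.
apply/rowP => i; rewrite !pairing_opE sgK t_sg.
have E1 : (d i)%:C ^+ 2 + (t i)%:C ^+ 2 = 1 :> R[i].
  by rewrite -!rmorphXn -rmorphD dt1.
have E2 : (t i)%:C * ((d i)%:C + (d (sg i))%:C) = 0 :> R[i].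
  by rewrite -rmorphD -rmorphM td.
rewrite -[RHS]mul1r -E1 -[RHS]addr0 -(mul0r (x ord0 (sg i))) -E2; ring.
Qed.

Lemma pairing_selfadj x y :
  <|pairing_op sg d t x, y|> = <|x, pairing_op sg d t y|>.
Proof.
rewrite !chilbert_inner.
under eq_bigr do rewrite pairing_opE mulrDl.
under [RHS]eq_bigr do rewrite pairing_opE rmorphD !rmorphM /= !conjCr mulrDr.
rewrite !big_split /=; congr (_ + _); first by apply: eq_bigr => i _; ring.
rewrite (reindex_inj (inv_inj sgK)) /=; apply: eq_bigr => i _.
by rewrite t_sg sgK; ring.
Qed.

Lemma pairing_std (i : 'I_n) :
  pairing_op sg d t (std i) = (d i)%:C *: std i + (t i)%:C *: std (sg i).
Proof.
apply/rowP => k; rewrite pairing_opE !coordE !stdE.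
congr (_ + _).
  by case: eqP => [->//|_]; rewrite !mulr0.
by rewrite (inv_eq sgK); case: eqP => [->|_]; rewrite ?t_sg // !mulr0.
Qed.

Lemma pairing_nonscalar (i : 'I_n) (b : bool) : sg i != i -> t i != 0 ->
  exists2 x, x != 0 & pairing_op sg d t x = (-1) ^+ b *: x.
Proof.
move=> si ti; exists (pairing_op sg d t (std i) + (-1) ^+ b *: std i).
  apply/eqP => /rowP /(_ (sg i)); rewrite pairing_std !coordE !stdE mxE eqxx (negPf si) !mulr0 mulr1 add0r addr0 => /eqP.
  by rewrite fmorph_eq0 (negPf ti).
rewrite linearD linearZ /= pairing_invol scalerDr scalerA -expr2 sqrr_sign scale1r.
by rewrite addrC.
Qed.

Lemma pairing_trace_std (i : 'I_n) : (sg i = i -> t i = 0) ->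
  <|pairing_op sg d t (std i), std i|> = (d i)%:C.
Proof.
move=> h; rewrite inner_std pairing_opE !stdE eqxx mulr1.
by have [/h ->|_] := eqVneq; rewrite ?mul0r ?mulr0 addr0.
Qed.

End OnePairing.

(** [a X + b Y] is diagonal with distinct entries [m i], so a product of factors [a X + b Y - m k]
    over [k != i] isolates the [i]-th coordinate of a vector of [S]. *)
Lemma std_invariant (X Y : {linear H -> H}) (a b : R) (m : 'I_n -> R) (S : set H) :
  (forall x y, <|X x, y|> = <|x, X y|>) -> (forall x y, <|Y x, y|> = <|x, Y y|>) ->
  injective m -> (forall i : 'I_n, a%:C *: X (std i) + b%:C *: Y (std i) = (m i)%:C *: std i) ->
  linear_subspace S -> (forall x, S x -> S (X x)) -> (forall x, S x -> S (Y x)) ->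
  forall (x : V) (i : 'I_n), S x -> x ord0 i != 0 -> S (std i).
Proof.
move=> Xsa Ysa minj mE [S0 SD] SX SY.
pose D (r : R) (x : V) : V := \row_k ((m k - r)%:C * x ord0 k).
have DE r (x : H) : D r x = a%:C *: X x + b%:C *: Y x - r%:C *: x.
  apply/rowP => k; rewrite mxE -[in RHS]inner_std.
  have E : a%:C * <|X x, std k|> + b%:C * <|Y x, std k|> = (m k)%:C * (x : V) ord0 k.
    by rewrite Xsa Ysa -!innerRr -innerDr mE innerRr inner_std.
  by rewrite !innerE E inner_std rmorphB; ring.
have SB x c y : S x -> S y -> S (x + c *: y) by move=> Sx Sy; rewrite addrC; exact: SD.
have SZ c x : S x -> S (c *: x) by move=> Sx; rewrite -[_ *: _]addr0; exact: SD.
have SDr r x : S x -> S (D r x).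
  by move=> Sx; rewrite DE -scaleNr; apply: (SB) => //; apply: (SB); [exact: (SZ _ _ (SX _ Sx))|exact: SY].
move=> x i Sx xi.
(* Induction over the indices to be annihilated: a factor [D (m k)] kills the coordinate [k] and
   multiplies the coordinate [i] by [m i - m k]. *)
have h (l : seq 'I_n) : exists2 y : V, S y &
    y ord0 i = (\prod_(k <- l | k != i) (m i - m k))%:C * x ord0 i /\
    forall k, k \in l -> k != i -> y ord0 k = 0.
  elim: l => [|k l [y Sy [yi yl]]]; first by exists x; rewrite ?big_nil ?mul1r.
  have [ki|ki] := eqVneq k i.
    exists y => //; split=> [|l']; first by rewrite big_cons ki eqxx.
    by rewrite inE => /orP[/eqP->|]; [rewrite ki eqxx|exact: yl].
  exists (D (m k) y); first exact: SDr.
  split=> [|l']; first by rewrite mxE yi big_cons ki [in RHS]rmorphM mulrA.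
  rewrite inE mxE => /orP[/eqP ->|lk ki']; first by rewrite subrr mul0r.
  by rewrite yl // mulr0.
have [y Sy [yi y0]] := h (index_enum 'I_n).
have yi0 : y ord0 i != 0.
  rewrite yi mulf_neq0 // fmorph_eq0 prodf_seq_neq0; apply/allP => k _.
  by apply/implyP; rewrite subr_eq0 (inj_eq minj) eq_sym.
have -> : std i = (y ord0 i)^-1 *: (y : H).
  apply/rowP => k; rewrite stdE coordZ.
  have [->|ki] := eqVneq k i; first by rewrite mulVf.
  by rewrite (y0 k) ?mem_index_enum ?mulr0.
exact: SZ.
Qed.

End Pairing.

Definition fam4 (T : Type) (x0 x1 x2 x3 : T) (j : 'I_4) : T :=
  nth x0 [:: x0; x1; x2; x3] j.

Lemma fam4E (T : Type) (x0 x1 x2 x3 : T) :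
  [/\ fam4 x0 x1 x2 x3 (inord 0) = x0, fam4 x0 x1 x2 x3 (inord 1) = x1,
      fam4 x0 x1 x2 x3 (inord 2) = x2 & fam4 x0 x1 x2 x3 (inord 3) = x3].
Proof. by split; rewrite /fam4 inordK. Qed.

Lemma ord4P (P : 'I_4 -> Prop) :
  P (inord 0) -> P (inord 1) -> P (inord 2) -> P (inord 3) -> forall j, P j.
Proof.
move=> h0 h1 h2 h3 j; rewrite -(inord_val j).
by case: j => [[|[|[|[|]]]]].
Qed.

Section PairingSystem.
Variables (R : realType) (n : nat).
Local Notation H := (chilbert R n).
Local Notation V := (cspace R n).
Local Notation "<| x , y |>" := (inner H x y) (format "<| x ,  y |>").

(** [m] is the diagonal of [a X + b Y]. The last equation is the law of cosines for sides [a], [b],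
    [m i]; it makes the partner [Y = (m - a X) / b] an involution again. *)
Definition pairing_data (a b : R) (sg : 'I_n -> 'I_n) (d t m : 'I_n -> R) : Prop :=
  [/\ involutive sg, forall i, t (sg i) = t i & forall i, t i * (d i + d (sg i)) = 0] /\
  [/\ forall i, d i ^+ 2 + t i ^+ 2 = 1, forall i, t i * (m i + m (sg i)) = 0 &
      forall i, m i ^+ 2 + a ^+ 2 - b ^+ 2 = 2 * a * m i * d i].

Variables (a0 a1 a2 a3 lam : R) (sK sL : 'I_n -> 'I_n).
Variables (dK tK dL tL m : 'I_n -> R).
Hypotheses (a0_gt0 : 0 < a0) (a1_gt0 : 0 < a1) (a2_gt0 : 0 < a2) (a3_gt0 : 0 < a3).
Hypothesis pK : pairing_data a0 a1 sK dK tK m.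
Hypothesis pL : pairing_data a2 a3 sL dL tL (fun i => lam - m i).

Definition partner_op (a b : R) sg (d t m : 'I_n -> R) : {linear H -> H} :=
  pairing_op sg (fun i => (m i - a * d i) / b) (fun i => - (a * t i) / b).

Lemma partner_data a b sg d t mu : 0 < a -> 0 < b -> pairing_data a b sg d t mu ->
  pairing_data b a sg (fun i => (mu i - a * d i) / b) (fun i => - (a * t i) / b) mu.
Proof.
move=> /gt_eqF/negbT a_neq0 /gt_eqF/negbT b_neq0 [[sgK tsg td] [dt tm md]].
split; split=> // i.
- by rewrite tsg.
- have -> : - (a * t i) / b * ((mu i - a * d i) / b + (mu (sg i) - a * d (sg i)) / b)
    = a * (a * (t i * (d i + d (sg i))) - t i * (mu i + mu (sg i))) / (b * b).
    by field.
  by rewrite td tm !mulr0 subr0 mulr0 mul0r.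
- have -> : ((mu i - a * d i) / b) ^+ 2 + (- (a * t i) / b) ^+ 2
    = (mu i ^+ 2 - 2 * a * mu i * d i + a ^+ 2 * (d i ^+ 2 + t i ^+ 2)) / b ^+ 2.
    by field.
  by rewrite dt -md; field.
- have -> : - (a * t i) / b * (mu i + mu (sg i)) = - a * (t i * (mu i + mu (sg i))) / b.
    by ring.
  by rewrite tm mulr0 mul0r.
- have -> : 2 * b * mu i * ((mu i - a * d i) / b) = 2 * mu i ^+ 2 - 2 * a * mu i * d i.
    by field.
  by rewrite -md; ring.
Qed.

Lemma partner_sum a b sg d t mu (x : H) : 0 < b ->
  a%:C *: pairing_op sg d t x + b%:C *: partner_op a b sg d t mu x =
  ((\row_i ((mu i)%:C * (x : V) ord0 i) : V) : H).
Proof.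
move=> /gt_eqF/negbT b_neq0; apply/rowP => i; rewrite !coordE !pairing_opE mxE.
have E1 : (((mu i - a * d i) / b)%:C : R[i]) = (mu i - a * d i)%:C * b%:C^-1.
  by rewrite rmorphM fmorphV.
have E2 : ((- (a * t i) / b)%:C : R[i]) = - (a * t i)%:C * b%:C^-1.
  by rewrite rmorphM fmorphV rmorphN.
rewrite E1 E2 !rmorphB !rmorphM /=; have bC : (b%:C : R[i]) != 0 by rewrite fmorph_eq0.
by move: (b%:C) bC => B bC; field.
Qed.

Definition pairing_system : 'I_4 -> {linear H -> H} :=
  fam4 (pairing_op sK dK tK) (partner_op a0 a1 sK dK tK m)
       (pairing_op sL dL tL) (partner_op a2 a3 sL dL tL (fun i => lam - m i)).

Lemma pairing_systemP : involution_system (fam4 a0 a1 a2 a3) lam pairing_system.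
Proof.
have [[sK1 sK2 sK3] [sK4 _ _]] := pK; have [[sL1 sL2 sL3] [sL4 _ _]] := pL.
have [[_ K2 K3] [K4 _ _]] := partner_data a0_gt0 a1_gt0 pK.
have [[_ L2 L3] [L4 _ _]] := partner_data a2_gt0 a3_gt0 pL.
have [X0 X1 X2 X3] := fam4E (pairing_op sK dK tK) (partner_op a0 a1 sK dK tK m)
       (pairing_op sL dL tL) (partner_op a2 a3 sL dL tL (fun i => lam - m i)).
have [A0 A1 A2 A3] := fam4E a0 a1 a2 a3.
split.
- apply: ord4P; rewrite /pairing_system ?X0 ?X1 ?X2 ?X3 => x.
  + exact: (pairing_invol sK1 sK2 sK3 sK4).
  + exact: (pairing_invol sK1 K2 K3 K4).
  + exact: (pairing_invol sL1 sL2 sL3 sL4).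
  + exact: (pairing_invol sL1 L2 L3 L4).
- apply: ord4P; rewrite /pairing_system ?X0 ?X1 ?X2 ?X3 => x y.
  + exact: (pairing_selfadj _ sK1 sK2).
  + exact: (pairing_selfadj _ sK1 K2).
  + exact: (pairing_selfadj _ sL1 sL2).
  + exact: (pairing_selfadj _ sL1 L2).
- move=> x; rewrite sum4 /pairing_system X0 X1 X2 X3 A0 A1 A2 A3 -addrA !partner_sum //.
  by apply/rowP => i; rewrite !coordE !mxE rmorphB; ring.
Qed.

Lemma pairing_system_nonscalar :
  (exists2 i, sK i != i & tK i != 0) -> (exists2 i, sL i != i & tL i != 0) ->
  nonscalar_family pairing_system.
Proof.
move=> [i si ti] [j sj tj].
have [[sK1 sK2 sK3] [sK4 _ _]] := pK; have [[sL1 sL2 sL3] [sL4 _ _]] := pL.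
have [[_ K2 K3] [K4 _ _]] := partner_data a0_gt0 a1_gt0 pK.
have [[_ L2 L3] [L4 _ _]] := partner_data a2_gt0 a3_gt0 pL.
have [X0 X1 X2 X3] := fam4E (pairing_op sK dK tK) (partner_op a0 a1 sK dK tK m)
       (pairing_op sL dL tL) (partner_op a2 a3 sL dL tL (fun i => lam - m i)).
have ti' : - (a0 * tK i) / a1 != 0.
  by rewrite mulNr oppr_eq0 mulf_eq0 invr_eq0 mulf_eq0 (negPf ti) !gt_eqF.
have tj' : - (a2 * tL j) / a3 != 0.
  by rewrite mulNr oppr_eq0 mulf_eq0 invr_eq0 mulf_eq0 (negPf tj) !gt_eqF.
apply: ord4P; rewrite /pairing_system ?X0 ?X1 ?X2 ?X3 => b.
- exact: (pairing_nonscalar sK1 sK2 sK3 sK4 b si ti).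
- exact: (pairing_nonscalar sK1 K2 K3 K4 b si ti').
- exact: (pairing_nonscalar sL1 sL2 sL3 sL4 b sj tj).
- exact: (pairing_nonscalar sL1 L2 L3 L4 b sj tj').
Qed.

(** Distinct values of [m] yield one basis vector in a nonzero invariant subspace, and the
    connectivity hypothesis carries it to all the others. *)
Lemma pairing_system_irreducible : (0 < n)%N -> injective m ->
  (forall P : 'I_n -> Prop, (exists i, P i) ->
     (forall i, tK i != 0 -> P i -> P (sK i)) ->
     (forall i, tL i != 0 -> P i -> P (sL i)) -> forall i, P i) ->
  irreducible_family pairing_system.
Proof.
move=> n0 minj conn; have [XX Xsa Xsum] := pairing_systemP.
have [X0 X1 X2 X3] := fam4E (pairing_op sK dK tK) (partner_op a0 a1 sK dK tK m)
       (pairing_op sL dL tL) (partner_op a2 a3 sL dL tL (fun i => lam - m i)).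
have [[sK1 sK2 sK3] [sK4 _ _]] := pK; have [[sL1 sL2 sL3] [sL4 _ _]] := pL.
split.
  exists (std R n 0); apply/eqP => /rowP/(_ (Ordinal n0)); rewrite !mxE /= => /eqP.
  by rewrite oner_eq0.
move=> S linS _ Sinv; have [S0 SD] := linS.
have SB x c y : S x -> S y -> S (x + c *: y) by move=> Sx Sy; rewrite addrC; exact: SD.
have SZ c x : S x -> S (c *: x) by move=> Sx; rewrite -[_ *: _]addr0; exact: SD.
have [[x]|S00] := pselect (exists x, ~ (S x -> x = 0)); last first.
  left; apply/seteqP; split=> x => [Sx|->//]; apply: contrapT => x0.
  by apply: S00; exists x => /(_ Sx).
move/not_implyP => [Sx x0]; right; apply/seteqP; split=> // y _.
have mE (i : 'I_n) : a0%:C *: pairing_op sK dK tK (std R n i) +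
    a1%:C *: partner_op a0 a1 sK dK tK m (std R n i) = (m i)%:C *: std R n i.
  rewrite partner_sum //; apply/rowP => k; rewrite mxE coordZ !stdE.
  by case: eqP => [->//|_]; rewrite !mulr0.
have Xsa0 := Xsa (inord 0); have Xsa1 := Xsa (inord 1).
rewrite /pairing_system X0 in Xsa0; rewrite /pairing_system X1 in Xsa1.
have SX0 z : S z -> S (pairing_op sK dK tK z).
  by rewrite -X0; exact: Sinv.
have SX1 z : S z -> S (partner_op a0 a1 sK dK tK m z).
  by rewrite -X1; exact: Sinv.
have SX2 z : S z -> S (pairing_op sL dL tL z).
  by rewrite -X2; exact: Sinv.
have Sstd : forall i : 'I_n, S (std R n i).
  have step sg d t : involutive sg -> (forall i, t (sg i) = t i) ->
      (forall z, S z -> S (pairing_op sg d t z)) ->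
      forall i : 'I_n, t i != 0 -> S (std R n i) -> S (std R n (sg i)).
    move=> sgK tsg Sop i ti Si.
    have -> : std R n (sg i) = ((t i)%:C)^-1 *:
        (pairing_op sg d t (std R n i) + - (d i)%:C *: std R n i).
      rewrite pairing_std // scaleNr addrAC subrr add0r scalerA mulVf ?scale1r //.
      by rewrite fmorph_eq0.
    by apply: SZ; apply: SB => //; exact: Sop.
  apply: conn.
  - have /existsNP[i xi] : ~ forall i, (x : V) ord0 i = 0.
      by move=> h; apply: x0; apply/rowP => i; rewrite h mxE.
    exists i; apply: (std_invariant Xsa0 Xsa1 minj mE linS SX0 SX1 Sx).
    exact/eqP.
  - exact: (step _ _ _ sK1 sK2 SX0).
  - exact: (step _ _ _ sL1 sL2 SX2).
rewrite ((std_basis R n).2 y); elim/big_rec: _ => // i z _ Sz.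
exact: SD.
Qed.

End PairingSystem.

(** * Chains of planes: combinatorics and construction *)

Section ChainCoefficients.
Variable R : realType.
Implicit Types (c z : nat -> R) (q : bool).

(* Link [l] of a chain joins the vertices [l - 1] and [l]; even links belong to
   the first pair of symmetries ([q = false]), odd links to the second one. *)
Definition chain_s c (l : nat) : R := Num.sqrt (1 - c l ^+ 2).

(** Vertex [i] lies on the links [i] and [i.+1]; the one of parity [q] belongs to the pair [q]. The
    diagonal entry is [c] at the lower vertex of a link and [- c] at its upper vertex. Applied to
    [z] instead of [c], it gives the eigenvalue of the pair sum. *)
Definition chain_d c q (i : nat) : R := if odd i (+) q then c i.+1 else - c i.

Definition chain_t c q (i : nat) : R :=
  if odd i (+) q then chain_s c i.+1 else chain_s c i.

(** Half-links at the ends are fixed points: the last vertex by the explicit test, vertex 0 because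
    [0.-1] is 0. *)
Definition chain_sg (n : nat) q (i : nat) : nat :=
  if odd i (+) q then (if (i.+1 < n)%N then i.+1 else i) else i.-1.

Definition partner_coef (a0 a1 a2 a3 : R) c z (l : nat) : R :=
  if odd l then (z l - a2 * c l) / a3 else (z l - a0 * c l) / a1.

(** A complete link contributes [c - c = 0], so only the half-links 0 and [n] remain, each for the
    pair of its own parity. *)
Lemma chain_d_sum c q n :
  \sum_(i < n) chain_d c q i =
  (if q then 0 else - c 0%N) + (if odd n == q then c n else 0).
Proof.
elim: n => [|n IHn]; first by rewrite big_ord0; case: q => /=; rewrite ?addr0 // addNr.
rewrite big_ord_recr /= {}IHn /chain_d.
by case: q; case: (odd n); rewrite /= ?addr0 ?addrK -?addrA ?subrr ?addr0 ?add0r.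
Qed.

Lemma chain_sg_lt n q i : (i < n)%N -> (chain_sg n q i < n)%N.
Proof.
rewrite /chain_sg; case: ifP => _; first by case: ifP.
exact: leq_ltn_trans (leq_pred _).
Qed.

Lemma chain_sgK n q i : (i < n)%N -> chain_sg n q (chain_sg n q i) = i.
Proof.
move=> ni; rewrite {2}/chain_sg; case: ifP => lo; last first.
  case: i lo ni => [|i] lo ni; first by rewrite /chain_sg lo.
  by rewrite /chain_sg /=; move: lo; rewrite /=; case: (odd i); case: q => //=; rewrite ni.
case: ifP => ni1; last by rewrite /chain_sg lo ni1.
by rewrite /chain_sg /=; move: lo; case: (odd i); case: q.
Qed.

Lemma arith_progE z lam : (forall i, z i.+1 = z i + lam) ->
  forall l, z l = z 0%N + l%:R * lam.
Proof.
by move=> zS; elim=> [|l IHl]; rewrite ?mul0r ?addr0 // zS IHl -natr1; ring.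
Qed.

(* The values at two vertices of different parity are [z (i + 1)] and [- z j];
   they can only agree if the progression vanishes halfway, at [(i + 1 + j) / 2]. *)
Lemma chain_value_inj z lam n : lam != 0 -> (forall i, z i.+1 = z i + lam) ->
  (forall l, (0 < l < n)%N -> z l != 0) ->
  forall i j, (i < n)%N -> (j < n)%N ->
  chain_d z false i = chain_d z false j -> i = j.
Proof.
move=> lam0 zS z_int; have zE := arith_progE zS.
have par i j : (i < n)%N -> (j < n)%N ->
    odd i -> ~~ odd j -> chain_d z false i = chain_d z false j -> False.
  move=> ni nj oi ej; rewrite /chain_d !addbF oi (negPf ej) => E.
  pose l := (i.+1 + j)./2.
  have ev : ~~ odd (i.+1 + j) by rewrite /= oddD oi (negPf ej).
  have dl : l.*2 = (i.+1 + j)%N by rewrite even_halfK.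
  have lb : (0 < l < n)%N.
    by have : i != j by [apply: contraNneq ej => <-]; move: dl; lia.
  have /eqP := z_int l lb; apply; rewrite zE.
  have : 2 * (z 0%N + l%:R * lam) = 0.
    have -> : 2 * (z 0%N + l%:R * lam) = 2 * z 0%N + (l.*2)%:R * lam.
      by rewrite -mul2n natrM; ring.
    rewrite dl natrD; move: E; rewrite (zE i.+1) (zE j) => E.
    have := congr1 (fun x => x + (z 0%N + j%:R * lam)) E; rewrite addNr => <-; ring.
  by move/eqP; rewrite mulf_eq0 pnatr_eq0 => /eqP.
have lin i j : z i = z j -> i = j.
  by rewrite (zE i) (zE j) => /addrI /(mulIf lam0) /eqP; rewrite eqr_nat => /eqP.
move=> i j ni nj E; case oi : (odd i); case oj : (odd j).
- by move: E; rewrite /chain_d !addbF oi oj => /lin [].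
- by case: (par i j ni nj); rewrite ?oi ?oj.
- by case: (par j i nj ni); rewrite ?oi ?oj.
- by move: E; rewrite /chain_d !addbF oi oj => /oppr_inj /lin.
Qed.

End ChainCoefficients.

Section ChainSystem.
Variables (R : realType) (N : nat).
Local Notation n := N.+1.
Variables (a0 a1 a2 a3 lam : R) (c z : nat -> R).
Hypotheses (a0_gt0 : 0 < a0) (a1_gt0 : 0 < a1) (a2_gt0 : 0 < a2) (a3_gt0 : 0 < a3).
Hypothesis lam0 : lam != 0.
Hypothesis zS : forall i, z i.+1 = z i + lam.
Hypothesis z_rel : forall l, (l <= n)%N ->
  z l ^+ 2 + (if odd l then a2 else a0) ^+ 2 - (if odd l then a3 else a1) ^+ 2 =
  2 * (if odd l then a2 else a0) * z l * c l.
Hypothesis c0 : c 0%N ^+ 2 = 1.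
Hypothesis cn : c n ^+ 2 = 1.
Hypothesis c_int : forall l, (0 < l < n)%N -> c l ^+ 2 < 1.
Hypothesis z_int : forall l, (0 < l < n)%N -> z l != 0.
Hypothesis n_ge3 : (3 <= n)%N.

Let sg q (i : 'I_n) : 'I_n := inord (chain_sg n q i).

Let sgE q i : sg q i = chain_sg n q i :> nat.
Proof. by rewrite inordK // chain_sg_lt. Qed.

Let c_le1 l : (l <= n)%N -> c l ^+ 2 <= 1.
Proof.
case: l => [|l]; first by rewrite c0.
rewrite leq_eqVlt => /orP[/eqP->|ln]; first by rewrite cn.
by apply/ltW/c_int.
Qed.

Let s2 l : (l <= n)%N -> chain_s c l ^+ 2 = 1 - c l ^+ 2.
Proof. by move=> ln; rewrite sqr_sqrtr // subr_ge0 c_le1. Qed.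

Let s0 : chain_s c 0 = 0.
Proof. by rewrite /chain_s c0 subrr sqrtr0. Qed.

Let sn : chain_s c n = 0.
Proof. by rewrite /chain_s cn subrr sqrtr0. Qed.

Let s_int l : (0 < l < n)%N -> chain_s c l != 0.
Proof. by move=> ln; rewrite sqrtr_eq0 -ltNge subr_gt0 c_int. Qed.

Lemma chain_pairing q :
  pairing_data (if q then a2 else a0) (if q then a3 else a1) (sg q)
    (fun i => chain_d c q i) (fun i => chain_t c q i) (fun i => chain_d z q i).
Proof.
have sgl (i : 'I_n) : odd i (+) q -> (i.+1 < n)%N -> sg q i = i.+1 :> nat.
  by move=> lo ni; rewrite sgE /chain_sg lo ni.
have sgu (i : 'I_n) : odd i (+) q = false -> sg q i = i.-1 :> nat.
  by move=> lo; rewrite sgE /chain_sg lo.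
have cases (i : 'I_n) :
   [\/ odd i (+) q /\ (odd (sg q i) (+) q = false /\ i.+1 = sg q i :> nat),
       odd i (+) q /\ (sg q i = i /\ i.+1 = n),
       odd i (+) q = false /\ (odd (sg q i) (+) q /\ i = (sg q i).+1 :> nat) |
       odd i (+) q = false /\ (sg q i = i /\ i = 0%N :> nat)].
  case lo: (odd i (+) q).
    have [ni|ni] := ltnP i.+1 n.
      apply: Or41; split=> //; rewrite sgl //=; split=> //.
      by rewrite addNb lo.
    apply: Or42; split=> //; split; last first.
      by apply/eqP; rewrite eqn_leq ni ltn_ord.
    by apply: val_inj; rewrite /= sgE /chain_sg lo ltnNge ni.
  case: (posnP i) => i0.
    apply: Or44; split=> //; split=> //.
    by apply: val_inj; rewrite /= sgu // i0.
  apply: Or43; split=> //; rewrite sgu // prednK //; split=> //.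
  by move: lo; rewrite -{1}(prednK i0) /= addNb => /negbFE.
split; split.
- move=> i; apply: val_inj; rewrite /= !sgE chain_sgK //.
- move=> i; rewrite /chain_t.
  by case: (cases i) => -[lo [h1 h2]]; rewrite lo ?h1 ?lo -?h2 // h2 ?h1 //.
- move=> i; rewrite /chain_t /chain_d.
  case: (cases i) => -[lo [h1 h2]]; rewrite lo h1.
  + by rewrite -h2 subrr mulr0.
  + by rewrite h2 sn mul0r.
  + by rewrite -h2 addNr mulr0.
  + by rewrite h2 s0 mul0r.
- move=> i; rewrite /chain_t /chain_d; case: ifP => _.
    by rewrite s2 ?ltn_ord // addrC subrK.
  by rewrite sqrrN s2 ?(ltnW (ltn_ord _)) // addrC subrK.
- move=> i; rewrite /chain_t /chain_d.
  case: (cases i) => -[lo [h1 h2]]; rewrite lo h1.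
  + by rewrite -h2 subrr mulr0.
  + by rewrite h2 sn mul0r.
  + by rewrite -h2 addNr mulr0.
  + by rewrite h2 s0 mul0r.
- move=> i; rewrite /chain_d; case: ifP => lo.
    have := z_rel (ltn_ord i); by rewrite /= (addbP lo).
  have := z_rel (ltnW (ltn_ord i)); rewrite (_ : odd i = q); last first.
    by apply/eqP; rewrite -negb_add lo.
  by rewrite sqrrN !mulrN mulNr opprK.
Qed.

Let mK i : chain_d z true i = lam - chain_d z false i.
Proof. by rewrite /chain_d addbF addbT; case: (odd i) => /=; rewrite zS; ring. Qed.

Let X := @pairing_system R n a0 a1 a2 a3 lam (sg false) (sg true)
  (fun i => chain_d c false i) (fun i => chain_t c false i)
  (fun i => chain_d c true i) (fun i => chain_t c true i)
  (fun i => chain_d z false i).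

Let pK := chain_pairing false.
Let pL : pairing_data a2 a3 (sg true) (fun i => chain_d c true i)
  (fun i => chain_t c true i) (fun i => lam - chain_d z false i).
Proof.
have := chain_pairing true; congr (pairing_data _ _ _ _ _ _).
by apply/funext => i; rewrite mK.
Qed.

Let m_inj : injective (fun i : 'I_n => chain_d z false i).
Proof.
by move=> i j /(chain_value_inj lam0 zS z_int (ltn_ord i) (ltn_ord j)) /ord_inj.
Qed.

Let link_conn (P : 'I_n -> Prop) :
  (exists i, P i) ->
  (forall i : 'I_n, chain_t c false i != 0 -> P i -> P (sg false i)) ->
  (forall i : 'I_n, chain_t c true i != 0 -> P i -> P (sg true i)) -> forall i, P i.
Proof.
move=> [i0 Pi0] PK PL.
have step q (i : 'I_n) : chain_t c q i != 0 -> P i -> P (sg q i) by case: q; [exact: PL|exact: PK].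
have up k : (k.+1 < n)%N -> P (inord k) -> P (inord k.+1).
  move=> kn Pk; have kE : (inord k : 'I_n) = k :> nat by rewrite inordK // ltnW.
  have lo : odd k (+) odd k.+1 by rewrite /= addbN addbb.
  have := step (odd k.+1) (inord k); rewrite /chain_t kE lo s_int ?kn //.
  move=> /(_ isT Pk); congr P; apply: ord_inj.
  by rewrite sgE /chain_sg kE lo kn /= inordK.
have down k : (k.+1 < n)%N -> P (inord k.+1) -> P (inord k).
  move=> kn Pk; have kE : (inord k.+1 : 'I_n) = k.+1 :> nat by rewrite inordK.
  have := step (odd k.+1) (inord k.+1); rewrite /chain_t kE addbb s_int ?kn //.
  move=> /(_ isT Pk); congr P; apply: ord_inj.
  by rewrite sgE /chain_sg kE addbb /= inordK // ltnW.
have P0 : P (inord 0).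
  have: P (inord i0) by rewrite inord_val.
  have := ltn_ord i0; elim: (nat_of_ord i0) => // k IHk kn /(down _ kn).
  by apply: IHk; exact: ltnW.
move=> i; rewrite -(inord_val i); have := ltn_ord i.
elim: (nat_of_ord i) => // k IHk kn; apply: up => //; apply: IHk; exact: ltnW.
Qed.

Lemma chain_system_exists : exists (H : hilbert R) (X : 'I_4 -> {linear H -> H}) (e : nat -> H),
  [/\ involution_system (fam4 a0 a1 a2 a3) lam X, irreducible_family X,
      nonscalar_family X, orthobasis n e &
   let c' := partner_coef a0 a1 a2 a3 c z in
   forall j, \sum_(i < n) inner H (X j (e i)) (e i) =
   (fam4 (\sum_(i < n) chain_d c false i) (\sum_(i < n) chain_d c' false i)
         (\sum_(i < n) chain_d c true i) (\sum_(i < n) chain_d c' true i) j)%:C].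
Proof.
exists (chilbert R n), X, (std R n); split.
- exact: pairing_systemP.
- apply: pairing_system_irreducible => //; exact: link_conn.
(* Each pair needs one genuine plane; these are the interior links 2 and 1, and [3 <= n] is what
   makes link 2 interior. *)
- apply: pairing_system_nonscalar => //.
    have e1 : (inord 1 : 'I_n) = 1%N :> nat by rewrite inordK // ltnW.
    exists (inord 1); last by rewrite /= /chain_t e1 s_int.
    by rewrite -(inj_eq (@ord_inj _)) sgE /chain_sg e1 /= n_ge3.
  have e0 : (inord 0 : 'I_n) = 0%N :> nat by rewrite inordK.
  have n1 : (1 < n)%N by exact: ltnW.
  exists (inord 0); last by rewrite /= /chain_t e0 s_int.
  by rewrite -(inj_eq (@ord_inj _)) sgE /chain_sg e0 /= n1.
- exact: std_basis.
- move=> c'.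
  have [[K1 K2 K3] [K4 _ _]] := pK; have [[L1 L2 L3] [L4 _ _]] := pL.
  have fix0 q (i : 'I_n) : sg q i = i -> chain_t c q i = 0.
    move/(congr1 val); rewrite /= sgE /chain_sg /chain_t; case: ifP => lo.
      case: ltnP => [_ /eqP|ni _]; first by rewrite eqn_leq ltnn.
      by rewrite (_ : i.+1 = n) //; apply/eqP; rewrite eqn_leq ni ltn_ord.
    by case: (nat_of_ord i) => [//|k] /eqP; rewrite eqn_leq ltnn andbF.
  have c'K i : (chain_d z false i - a0 * chain_d c false i) / a1 = chain_d c' false i.
    rewrite /chain_d /c' /partner_coef !addbF /=; case: (odd i) => //=.
    by field; rewrite gt_eqF.
  have c'L i : (lam - chain_d z false i - a2 * chain_d c true i) / a3 = chain_d c' true i.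
    rewrite -mK /chain_d /c' /partner_coef !addbT /=; case: (odd i) => //=.
    by field; rewrite gt_eqF.
  have [F0 F1 F2 F3] := fam4E (\sum_(i < n) chain_d c false i) (\sum_(i < n) chain_d c' false i)
         (\sum_(i < n) chain_d c true i) (\sum_(i < n) chain_d c' true i).
  apply: ord4P; rewrite ?F0 ?F1 ?F2 ?F3 rmorph_sum; apply: eq_bigr => i _;
    rewrite /X /pairing_system /fam4 inordK //= pairing_trace_std ?c'K ?c'L //.
  + exact: fix0.
  + by move/fix0 ->; rewrite mulr0 oppr0 mul0r.
  + exact: fix0.
  + by move/fix0 ->; rewrite mulr0 oppr0 mul0r.
Qed.

End ChainSystem.

(** * Chains in irreducible systems *)

Section TwoInvolutions.
Variables (R : realType) (H : hilbert R).
Local Notation "<| x , y |>" := (inner H x y) (format "<| x ,  y |>").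
Variables (X Y : {linear H -> H}) (a b : R).
Hypotheses (a_gt0 : 0 < a) (b_gt0 : 0 < b).
Hypotheses (XX : forall x, X (X x) = x) (YY : forall x, Y (Y x) = x).
Hypotheses (Xsa : forall x y, <|X x, y|> = <|x, X y|>).
Hypotheses (Ysa : forall x y, <|Y x, y|> = <|x, Y y|>).
Local Notation T x := (a%:C *: X x + b%:C *: Y x).

Lemma pair_selfadj x y : <|T x, y|> = <|x, T y|>.
Proof. by rewrite !innerE Xsa Ysa. Qed.

(** Apply [b Y] to [b Y e = z e - a X e] and use [Y Y = 1]. *)
Lemma pair_swap (e : H) (z : R) : T e = z%:C *: e ->
  a%:C *: T (X e) = (z ^+ 2 + a ^+ 2 - b ^+ 2)%:C *: e - (a * z)%:C *: X e.
Proof.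
move=> Te; have Ye : b%:C *: Y e = z%:C *: e - a%:C *: X e.
  by rewrite -Te; lmod.
have E1 : b%:C *: (b%:C *: Y (Y e)) = z%:C *: (b%:C *: Y e) - a%:C *: (b%:C *: Y (X e)).
  transitivity (b%:C *: Y (z%:C *: e - a%:C *: X e)); first by rewrite -Ye [Y (_ *: _)]linearZ.
  by rewrite linearB !linearZ /=; lmod.
rewrite YY Ye in E1.
have E2 : a%:C *: (b%:C *: Y (X e)) =
    z%:C *: (z%:C *: e - a%:C *: X e) - b%:C *: (b%:C *: e).
  by rewrite E1; lmod.
rewrite XX.
have -> : a%:C *: (a%:C *: e + b%:C *: Y (X e)) =
   a%:C *: (a%:C *: e) + a%:C *: (b%:C *: Y (X e)) by lmod.
by rewrite E2; lmod.
Qed.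

Variables (e : H) (z c : R).
Hypothesis e1 : <|e, e|> = 1.
Hypothesis Te : T e = z%:C *: e.
Hypothesis z0 : z != 0.
Hypothesis cE : z ^+ 2 + a ^+ 2 - b ^+ 2 = 2 * a * z * c.
Let y := X e - c%:C *: e.

(** The square of [T] commutes with [X], so [X e] has components for [z] and [- z] only; subtracting
    [c e] removes the first one. *)
Lemma pair_opposite : T y = (- z)%:C *: y.
Proof.
have aC : (a%:C : R[i]) != 0 by rewrite fmorph_eq0 gt_eqF.
have lin (f : {linear H -> H}) : f y = f (X e) - c%:C *: f e.
  by rewrite /y linearB linearZ.
apply: (scalerI aC); rewrite !lin.
have -> : a%:C *: (a%:C *: (X (X e) - c%:C *: X e) + b%:C *: (Y (X e) - c%:C *: Y e))
   = a%:C *: T (X e) - (a * c)%:C *: T e by lmod.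
by rewrite (pair_swap Te) Te cE; lmod.
Qed.

Lemma pair_orth : <|y, e|> = 0.
Proof.
have := pair_selfadj y e; rewrite pair_opposite Te innerRr innerZl => /eqP.
rewrite -subr_eq0 -mulrBl -rmorphB mulf_eq0 fmorph_eq0 => /orP[|/eqP//].
rewrite (_ : - z - z = - (2 * z)); last by ring.
by rewrite oppr_eq0 mulf_eq0 pnatr_eq0 (negPf z0).
Qed.

Lemma pair_norm : <|y, y|> = (1 - c ^+ 2)%:C.
Proof.
have Xe : X e = y + c%:C *: e by rewrite /y subrK.
have oC : <|e, y|> = 0 by rewrite innerC pair_orth rmorph0.
have : <|X e, X e|> = 1 by rewrite Xsa XX.
move: pair_orth oC; rewrite {1 2}Xe; move: y => y' oy oC.
rewrite !innerE oy oC e1 => E.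
rewrite rmorphB rmorph1 rmorphXn /= -E; ring.
Qed.

Lemma pair_image : X y = (1 - c ^+ 2)%:C *: e - c%:C *: y.
Proof. by rewrite /y linearB linearZ /= XX; lmod. Qed.

Lemma pair_c_le1 : c ^+ 2 <= 1.
Proof. by rewrite -subr_ge0 -ler0c -pair_norm innerxx_ge0. Qed.

Lemma pair_end : c ^+ 2 = 1 -> X e = c%:C *: e.
Proof.
move=> c1; apply/eqP; rewrite -subr_eq0 -innerxx_eq0.
by rewrite [<|_, _|>]pair_norm c1 subrr.
Qed.

End TwoInvolutions.

Definition sel (T : Type) (q : bool) (x y : T) := if q then y else x.

Section ChainRelation.
Variable R : realType.

(* [u] and [v] are the signs of the two symmetries of the first pair on the
   starting vertex. *)
Definition chain_z (a b lam u v : R) (l : nat) : R := l%:R * lam - (a * u + b * v).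

(** The value at 0 is set by hand, since [z 0] may vanish; the sign makes the diagonal entry [- c 0]
    at the first vertex equal to [u]. *)
Definition chain_c (a0 a1 a2 a3 lam u v : R) (l : nat) : R :=
  if l == 0%N then - u else
  let z := chain_z a0 a1 lam u v l in
  (z ^+ 2 + sel (odd l) a0 a2 ^+ 2 - sel (odd l) a1 a3 ^+ 2) /
  (2 * sel (odd l) a0 a2 * z).

Lemma chain_c_rel (a0 a1 a2 a3 lam u v : R) l :
  0 < a0 -> 0 < a2 -> u ^+ 2 = 1 -> v ^+ 2 = 1 ->
  (l == 0%N) || (chain_z a0 a1 lam u v l != 0) ->
  chain_z a0 a1 lam u v l ^+ 2 + sel (odd l) a0 a2 ^+ 2 - sel (odd l) a1 a3 ^+ 2 =
  2 * sel (odd l) a0 a2 * chain_z a0 a1 lam u v l * chain_c a0 a1 a2 a3 lam u v l.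
Proof.
move=> a0p a2p u1 v1; case: eqP => [-> _|l0 /= zl].
  rewrite /chain_c /chain_z /sel /=.
  have -> : a1 ^+ 2 = a1 ^+ 2 * v ^+ 2 by rewrite v1 mulr1.
  have -> : a0 ^+ 2 = a0 ^+ 2 * u ^+ 2 by rewrite u1 mulr1.
  by ring.
rewrite /chain_c (negPf (introN eqP l0)) [RHS]mulrC divfK //.
by rewrite !mulf_neq0 ?pnatr_eq0 //; case: (odd l); rewrite gt_eqF.
Qed.

End ChainRelation.

Section ChainAnalysis.
Variables (R : realType) (H : hilbert R).
Local Notation "<| x , y |>" := (inner H x y) (format "<| x ,  y |>").
Variables (X0 X1 X2 X3 : {linear H -> H}) (a0 a1 a2 a3 lam : R).
Hypotheses (a0_gt0 : 0 < a0) (a1_gt0 : 0 < a1) (a2_gt0 : 0 < a2) (a3_gt0 : 0 < a3).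
Hypothesis lam0 : lam != 0.
Hypothesis sysX : involution_system (fam4 a0 a1 a2 a3) lam (fam4 X0 X1 X2 X3).
Hypothesis irrX : irreducible_family (fam4 X0 X1 X2 X3).

Let op q : {linear H -> H} := sel q X0 X2.
Let oq q : {linear H -> H} := sel q X1 X3.
Let wa q : R := sel q a0 a2.
Let wb q : R := sel q a1 a3.
Definition pair_sum q (x : H) : H := (wa q)%:C *: op q x + (wb q)%:C *: oq q x.

Let opK q x : op q (op q x) = x.
Proof.
have [h _ _] := sysX; case: q.
  by have := h (inord 2) x; rewrite /fam4 inordK.
by have := h (inord 0) x; rewrite /fam4 inordK.
Qed.

Let oqK q x : oq q (oq q x) = x.
Proof.
have [h _ _] := sysX; case: q.
  by have := h (inord 3) x; rewrite /fam4 inordK.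
by have := h (inord 1) x; rewrite /fam4 inordK.
Qed.

Let op_sa q x y : <|op q x, y|> = <|x, op q y|>.
Proof.
have [_ h _] := sysX; case: q.
  by have := h (inord 2) x y; rewrite /fam4 inordK.
by have := h (inord 0) x y; rewrite /fam4 inordK.
Qed.

Let oq_sa q x y : <|oq q x, y|> = <|x, oq q y|>.
Proof.
have [_ h _] := sysX; case: q.
  by have := h (inord 3) x y; rewrite /fam4 inordK.
by have := h (inord 1) x y; rewrite /fam4 inordK.
Qed.

Let wa_gt0 q : 0 < wa q. Proof. by case: q. Qed.
Let wb_gt0 q : 0 < wb q. Proof. by case: q. Qed.

Let pair_sumC q x : pair_sum (~~ q) x = lam%:C *: x - pair_sum q x.
Proof.
have [_ _ h] := sysX; have := h x; rewrite sum4 /fam4 !inordK //= => <-.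
by case: q; rewrite /pair_sum /=; lmod.
Qed.

Variables (eps0 eps1 : R) (e0 : H).
Hypotheses (eps0_sq : eps0 ^+ 2 = 1) (eps1_sq : eps1 ^+ 2 = 1).
Hypothesis e0_unit : <|e0, e0|> = 1.
Hypothesis X0e0 : X0 e0 = eps0%:C *: e0.
Hypothesis X1e0 : X1 e0 = eps1%:C *: e0.

Let z := chain_z a0 a1 lam eps0 eps1.

Let c := chain_c a0 a1 a2 a3 lam eps0 eps1.

Fixpoint chain_vec (i : nat) : H :=
  if i is i'.+1 then
    ((chain_s c i)^-1)%:C *: (sel (odd i) X0 X2 (chain_vec i') - (c i)%:C *: chain_vec i')
  else e0.
Local Notation e := chain_vec.

Hypothesis z_ker : forall l v, (0 < l)%N -> z l = 0 -> pair_sum (odd l) v = 0 -> v = 0.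

Let zS i : z i.+1 = z i + lam.
Proof. by rewrite /z /chain_z -natr1; ring. Qed.

Let z_rel l : (l == 0%N) || (z l != 0) ->
  z l ^+ 2 + wa (odd l) ^+ 2 - wb (odd l) ^+ 2 = 2 * wa (odd l) * z l * c l.
Proof. exact: chain_c_rel. Qed.

(** The third clause is the action along the lower link. At [i = 0] the truncated predecessor
    [e i.-1] is harmless, because [chain_s c 0 = 0]. *)
Let inv i : Prop :=
  [/\ <|e i, e i|> = 1, pair_sum (odd i) (e i) = (- z i)%:C *: e i &
      op (odd i) (e i) = (chain_s c i)%:C *: e i.-1 - (c i)%:C *: e i].

Let inv0 : inv 0.
Proof.
split=> //=.
  rewrite /pair_sum /op /oq /wa /wb /sel /= X0e0 X1e0 /z /chain_z; lmod.
have -> : chain_s c 0 = 0 by rewrite /chain_s /c /chain_c /= sqrrN eps0_sq subrr sqrtr0.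
by rewrite X0e0 /c /chain_c /=; lmod.
Qed.

Let inv_next i : inv i ->
  pair_sum (odd i.+1) (e i) = (z i.+1)%:C *: e i /\ z i.+1 != 0.
Proof.
move=> [e1 Te _]; have E : pair_sum (odd i.+1) (e i) = (z i.+1)%:C *: e i.
  by rewrite [odd _]/= pair_sumC Te zS; lmod.
split=> //; apply/eqP => z0; have E0 : pair_sum (odd i.+1) (e i) = 0 by rewrite E z0 scale0r.
have ei0 := z_ker (ltn0Sn i) z0 E0; move: e1; rewrite ei0 inner0l => /esym/eqP.
by rewrite oner_eq0.
Qed.

Let c_le1 i : inv i -> c i.+1 ^+ 2 <= 1.
Proof.
move=> inv_i; have [Te z0] := inv_next inv_i; have [e1 _ _] := inv_i.
apply: (pair_c_le1 (wa_gt0 (odd i.+1)) (opK _) (oqK _) (op_sa _) (oq_sa _) e1 Te z0).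
by apply: z_rel; rewrite z0 orbT.
Qed.

Let inv_end i : inv i -> chain_s c i.+1 = 0 ->
  c i.+1 ^+ 2 = 1 /\ op (odd i.+1) (e i) = (c i.+1)%:C *: e i.
Proof.
move=> inv_i s0; have [Te z0] := inv_next inv_i; have [e1 _ _] := inv_i.
have c1 : c i.+1 ^+ 2 = 1.
  apply/eqP; rewrite eq_le c_le1 //= -subr_le0 leNgt; apply/negP => h.
  by move: s0 => /eqP; rewrite sqrtr_eq0 leNgt h.
split=> //; apply: (pair_end (wa_gt0 (odd i.+1)) (opK _) (oqK _) (op_sa _) (oq_sa _) e1 Te z0) => //.
by apply: z_rel; rewrite z0 orbT.
Qed.

Let inv_step i : inv i -> chain_s c i.+1 != 0 -> inv i.+1 /\
  op (odd i.+1) (e i) = (c i.+1)%:C *: e i + (chain_s c i.+1)%:C *: e i.+1.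
Proof.
move=> inv_i s0; have [Te z0] := inv_next inv_i; have [e1 _ _] := inv_i.
have rel := z_rel (l := i.+1); rewrite z0 orbT in rel; have {}rel := rel isT.
have wq := wa_gt0 (odd i.+1).
have ss : chain_s c i.+1 ^+ 2 = 1 - c i.+1 ^+ 2.
  by rewrite sqr_sqrtr // subr_ge0 c_le1.
have hn := pair_norm wq (opK _) (oqK _) (op_sa _) (oq_sa _) e1 Te z0 rel.
have ho := pair_opposite wq (opK _) (oqK _) Te rel.
have hi := pair_image (opK (odd i.+1)) (e i) (c i.+1).
have eE : e i.+1 = ((chain_s c i.+1)^-1)%:C *:
   (op (odd i.+1) (e i) - (c i.+1)%:C *: e i) by [].
set y := op (odd i.+1) (e i) - (c i.+1)%:C *: e i in hn ho hi eE.
have yE : y = (chain_s c i.+1)%:C *: e i.+1.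
  by rewrite eE scalerA -rmorphM mulfV // scale1r.
split; last by rewrite -yE /y; lmod.
have lin (f : {linear H -> H}) : f (e i.+1) = ((chain_s c i.+1)^-1)%:C *: f y.
  by rewrite eE linearZ.
split.
- rewrite eE innerRr innerZl hn -ss -!rmorphM /=.
  by rewrite expr2 mulKf // mulVf.
- have -> : pair_sum (odd i.+1) (e i.+1) =
     ((chain_s c i.+1)^-1)%:C *: pair_sum (odd i.+1) y.
    by rewrite /pair_sum !lin; lmod.
  by rewrite [pair_sum _ y]ho eE; lmod.
- rewrite lin hi -ss yE scalerBr !scalerA -!rmorphM expr2 mulKf //.
  by rewrite [_ * (c _ * _)]mulrCA mulVf // mulr1.
Qed.

Let norm_op (f : {linear H -> H}) (x : H) :
  (forall x, f (f x) = x) -> (forall x y, <|f x, y|> = <|x, f y|>) -> <|x, x|> = 1 -> `|f x| = 1.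
Proof. by move=> fK fsa x1; apply: norm_unit; rewrite fsa fK. Qed.

Let z_bound i : inv i -> `|z i| <= a0 + a1 + a2 + a3.
Proof.
move=> [e1 Te _]; rewrite -lecR.
have -> : `|z i|%:C = `|pair_sum (odd i) (e i)|.
  rewrite Te normrZ (norm_unit e1) mulr1 normc_def /= expr0n addr0 sqrtr_sqr.
  by rewrite normrN.
apply: le_trans (ler_normD _ _) _; rewrite !normrZ.
rewrite (norm_op (opK _) (op_sa _) e1) (norm_op (oqK _) (oq_sa _) e1) !mulr1.
have nE (r : R) : 0 < r -> `|r%:C : R[i]| = r%:C by move=> r0; rewrite ger0_norm ?ler0c ?ltW.
rewrite !nE // -(rmorphD (real_complex R)) lecR /wa /wb /sel.
have a01 : 0 <= a0 + a1 by rewrite addr_ge0 ?ltW.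
have a23 : 0 <= a2 + a3 by rewrite addr_ge0 ?ltW.
by case: (odd i); rewrite -addrA; [rewrite lerDr|rewrite lerDl].
Qed.

(** Otherwise every [z i] would be, up to sign, an eigenvalue of a pair sum and hence bounded by
    [a0 + a1 + a2 + a3], while the progression is unbounded. *)
Let chain_stops : exists n, (0 < n)%N && (chain_s c n == 0).
Proof.
apply: contrapT => /forallNP ns.
have invi i : inv i.
  elim: i => [|i IHi]; first exact: inv0.
  by have [] := inv_step IHi (introN eqP (fun s0 => ns i.+1 (introT eqP s0))).
pose p := a0 * eps0 + a1 * eps1; pose S := a0 + a1 + a2 + a3.
have [k kS] : exists k : nat, (S + `|p|) / `|lam| < k%:R.
  by exists (Num.truncn ((S + `|p|) / `|lam|)).+1; exact: truncnS_gt.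
move: kS; rewrite ltr_pdivrMr ?normr_gt0 // ltNge => /negP; apply.
have -> : k%:R * `|lam| = `|z k + p|.
  by rewrite /z /chain_z -/p subrK normrM ger0_norm.
apply: le_trans (ler_normD _ _) _; rewrite lerD2r; exact: z_bound.
Qed.

(** The chain is cut at the first [n] where the triangle is flat. Its vectors are orthogonal as
    eigenvectors of one self-adjoint operator with distinct eigenvalues, and its span is invariant,
    so irreducibility makes it a basis. *)
Lemma chain_analysis : exists n,
  [/\ (0 < n)%N, forall l, (0 < l < n)%N -> c l ^+ 2 < 1, c n ^+ 2 = 1,
      forall l, (0 < l <= n)%N -> z l != 0 &
  [/\ orthobasis n e,
      forall q i, (i < n)%N -> op q (e i) =
        (chain_d c q i)%:C *: e i + (chain_t c q i)%:C *: e (chain_sg n q i) &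
      forall i, (i < n)%N -> pair_sum false (e i) = (chain_d z false i)%:C *: e i]].
Proof.
case: (ex_minnP chain_stops) => n /andP[n0 /eqP sn0] nmin.
have s_int l : (0 < l < n)%N -> chain_s c l != 0.
  move=> /andP[l0 ln]; apply/negP => sl.
  by have := nmin l; rewrite l0 sl => /(_ isT); rewrite leqNgt ln.
have invi i : (i < n)%N -> inv i.
  elim: i => [|i IHi] ni; first exact: inv0.
  by have [] := inv_step (IHi (ltnW ni)) (s_int i.+1 ni).
have z_int l : (0 < l <= n)%N -> z l != 0.
  by case: l => // l ln; have [] := inv_next (invi l ln).
have c_int l : (0 < l < n)%N -> c l ^+ 2 < 1.
  case: l => // l ln; rewrite lt_neqAle c_le1 ?andbT; last exact/invi/ltnW.
  apply: contraNneq (s_int _ ln) => c1.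
  by rewrite /chain_s c1 subrr sqrtr0.
have cn1 : c n ^+ 2 = 1.
  case: (n) n0 sn0 invi => // m _ sm0 invi.
  by have [] := inv_end (invi m (ltnSn m)) sm0.
have opE q i : (i < n)%N -> op q (e i) =
    (chain_d c q i)%:C *: e i + (chain_t c q i)%:C *: e (chain_sg n q i).
  move=> ni; rewrite /chain_d /chain_t /chain_sg; case lo: (odd i (+) q).
    have qE : q = odd i.+1 by rewrite /= (addbP lo).
    rewrite qE; case: ltnP => ni1.
      by have [_ ->] := inv_step (invi i ni) (s_int i.+1 ni1).
    have nE : i.+1 = n by apply/eqP; rewrite eqn_leq ni ni1.
    have sN : chain_s c i.+1 = 0 by rewrite nE.
    have [_ ->] := inv_end (invi i ni) sN.
    by rewrite nE sn0 scale0r addr0.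
  have qE : q = odd i by apply/esym/eqP; rewrite -negb_add lo.
  by have [_ _ E] := invi i ni; rewrite qE E; lmod.
have mE i : (i < n)%N -> pair_sum false (e i) = (chain_d z false i)%:C *: e i.
  move=> ni; rewrite /chain_d addbF; case oi: (odd i).
    by have [] := inv_next (invi i ni); rewrite /= oi.
  by have [_ + _] := invi i ni; rewrite oi.
exists n; split=> //; split=> //.
have oe : orthonormal_upto n e.
  move=> i j ni nj; have [->|ij] := eqVneq i j; first by have [-> _ _] := invi j nj.
  have mneq : chain_d z false i != chain_d z false j.
    apply: contra_neq ij; apply: (chain_value_inj lam0 zS _ ni nj) => l /andP[l0 ln].
    by apply: z_int; rewrite l0 ltnW.
  have : <|pair_sum false (e i), e j|> = <|e i, pair_sum false (e j)|>.
    exact: (pair_selfadj a0 a1 (op_sa false) (oq_sa false)).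
  rewrite (mE i ni) (mE j nj) innerZl innerRr => /eqP.
  rewrite -subr_eq0 -mulrBl -rmorphB mulf_eq0 fmorph_eq0 subr_eq0 (negPf mneq) /=.
  by move/eqP.
apply: (irreducible_span irrX n0 oe).
have pD (x y : H) (s : R[i]) : span_proj n e x = x -> span_proj n e y = y ->
    span_proj n e (s *: x + y) = s *: x + y by move=> px py; rewrite span_projP px py.
have pe i : (i < n)%N -> span_proj n e (e i) = e i by exact: span_proj_id.
have pop q i : (i < n)%N -> span_proj n e (op q (e i)) = op q (e i).
  move=> ni; rewrite opE //; apply: (pD); first exact: pe.
  rewrite -[_ *: _]addr0; apply: (pD); last exact: span_proj0.
  by apply: pe; exact: chain_sg_lt.
have poq q i : (i < n)%N -> span_proj n e (oq q (e i)) = oq q (e i).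
  move=> ni.
  have [m Tm] : exists m : R, pair_sum q (e i) = m%:C *: e i.
    case: q; last by exists (chain_d z false i); exact: mE.
    exists (lam - chain_d z false i).
    by rewrite -[true]/(~~ false) pair_sumC mE //; lmod.
  have wb0 : ((wb q)%:C : R[i]) != 0 by rewrite fmorph_eq0 gt_eqF.
  have -> : oq q (e i) = ((wb q)^-1 * m)%:C *: e i + ((- ((wb q)^-1 * wa q))%:C *: op q (e i) + 0).
    apply: (scalerI wb0); rewrite addr0 scalerDr !scalerA -!rmorphM.
    rewrite mulrN !mulrA mulfV ?gt_eqF // !mul1r.
    have -> : (wb q)%:C *: oq q (e i) = pair_sum q (e i) - (wa q)%:C *: op q (e i).
      by rewrite /pair_sum; lmod.
    by rewrite Tm; lmod.
  apply: (pD); first exact: pe.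
  by apply: (pD); [exact: pop|exact: span_proj0].
apply: ord4P => i ni; rewrite /fam4 inordK //=;
  by [exact: (pop false)|exact: (poq false)|exact: (pop true)|exact: (poq true)].
Qed.

End ChainAnalysis.

(** * Norm estimates and the existence of a starting vector *)

Section RealNorm.
Variables (R : realType) (H : hilbert R).

(** The norm of [H] takes values in [R[i]]; its real version gives access to the total order of [R]
    and to [lra]. *)
Definition rnorm (x : H) : R := complex.Re `|x|.

Lemma rnormE x : `|x| = (rnorm x)%:C.
Proof. by have [r _ E] := normR x; rewrite /rnorm E. Qed.

Lemma rnorm_ge0 x : 0 <= rnorm x.
Proof. by rewrite -ler0c -rnormE. Qed.

Lemma rnormD x y : rnorm (x + y) <= rnorm x + rnorm y.
Proof. by have := ler_normD x y; rewrite !rnormE -(rmorphD (real_complex R)) lecR. Qed.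

Lemma rnormZ (r : R) x : rnorm (r%:C *: x) = `|r| * rnorm x.
Proof.
apply: complexI; rewrite rmorphM -!rnormE normrZ; congr (_ * _); last exact: rnormE.
by rewrite normc_def /= expr0n addr0 sqrtr_sqr.
Qed.

Lemma rnormN x : rnorm (- x) = rnorm x.
Proof. by rewrite /rnorm normrN. Qed.

Lemma rnorm0_eq0 x : rnorm x = 0 -> x = 0.
Proof. by move=> x0; apply/eqP; rewrite -normr_eq0 rnormE x0. Qed.

Lemma rnorm_isometry (f : H -> H) x : (forall x, f (f x) = x) ->
  (forall x y, inner H (f x) y = inner H x (f y)) -> rnorm (f x) = rnorm x.
Proof.
move=> fK fsa; apply: complexI; rewrite -!rnormE.
by apply/eqP; rewrite -(@eqrXn2 _ 2) // !inner_norm fsa fK.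
Qed.

End RealNorm.

Section JointEigenvector.
Variables (R : realType) (H : hilbert R) (X Y : {linear H -> H}).
Hypotheses (XX : forall x, X (X x) = x) (YY : forall x, Y (Y x) = x).

(** The vectors [y + Z y] and [y - Z y] add up to [2 y], so they are not both zero. *)
Lemma invol_eigen (Z : {linear H -> H}) (y : H) : (forall x, Z (Z x) = x) -> y != 0 ->
  exists2 s : R, s ^+ 2 = 1 & y + s%:C *: Z y != 0 /\
    Z (y + s%:C *: Z y) = s%:C *: (y + s%:C *: Z y).
Proof.
move=> ZZ y0.
have h (s : R) : s ^+ 2 = 1 -> Z (y + s%:C *: Z y) = s%:C *: (y + s%:C *: Z y).
  move=> s1; rewrite linearD linearZ /= ZZ scalerDr scalerA -rmorphM -expr2 s1 scale1r.
  exact: addrC.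
have [E|] := eqVneq (y + 1%:C *: Z y) 0; last by exists 1; rewrite ?expr1n //; split=> //; apply: h; rewrite expr1n.
exists (-1); first by rewrite sqrrN expr1n.
split; last by apply: h; rewrite sqrrN expr1n.
apply: contra_neq y0 => E2; have : 2 *: y = 0 :> H.
  by rewrite -(addr0 0) -{1}E -E2; lmod.
by move/eqP; rewrite scaler_eq0 pnatr_eq0 => /eqP.
Qed.

(** Commuting at the single vector [y] is enough, because [y + u X y] inherits it. Only this much is
    known on the kernel of a commutator. *)
Lemma joint_eigenvector y : y != 0 -> X (Y y) = Y (X y) ->
  exists u v e, [/\ u ^+ 2 = 1 :> R, v ^+ 2 = 1 :> R, inner H e e = 1,
    X e = u%:C *: e & Y e = v%:C *: e].
Proof.
move=> y0 XY; have [u u1 [y1n Xy1]] := invol_eigen XX y0.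
set y1 := y + u%:C *: X y in y1n Xy1.
have XY1 : X (Y y1) = Y (X y1).
  have E1 : Y y1 = Y y + u%:C *: X (Y y) by rewrite /y1 linearD linearZ XY.
  rewrite Xy1 linearZ /= E1 linearD linearZ /= XX.
  by rewrite scalerDr scalerA -rmorphM -expr2 u1 scale1r addrC.
have [v v1 [y2n Yy2]] := invol_eigen YY y1n.
set y2 := y1 + v%:C *: Y y1 in y2n Yy2.
have Xy2 : X y2 = u%:C *: y2.
  by rewrite /y2 linearD linearZ /= XY1 Xy1 linearZ /=; lmod.
have [c _ c1] := ex_unit y2n.
exists u, v, (c *: y2); split=> //.
  by rewrite linearZ /= Xy2; lmod.
by rewrite linearZ /= Yy2; lmod.
Qed.

End JointEigenvector.

Section Start.
Variables (R : realType) (H : hilbert R).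
Local Notation "<| x , y |>" := (inner H x y) (format "<| x ,  y |>").

Definition good_start (X0 X1 X2 X3 : {linear H -> H}) (a0 a1 a2 a3 lam : R) : Prop :=
  exists u v e, [/\ u ^+ 2 = 1, v ^+ 2 = 1, <|e, e|> = 1,
    X0 e = u%:C *: e /\ X1 e = v%:C *: e &
    forall l w, (0 < l)%N -> chain_z a0 a1 lam u v l = 0 ->
      pair_sum X0 X1 X2 X3 a0 a1 a2 a3 (odd l) w = 0 -> w = 0].

Section PairOfInvolutions.
Variables (X Y : {linear H -> H}) (a b : R).
Hypotheses (a_gt0 : 0 < a) (b_gt0 : 0 < b).
Hypotheses (XX : forall x, X (X x) = x) (YY : forall x, Y (Y x) = x).
Hypotheses (Xsa : forall x y, <|X x, y|> = <|x, X y|>).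
Hypotheses (Ysa : forall x y, <|Y x, y|> = <|x, Y y|>).

(** Since [X] and [Y] are isometries, [a X w = - b Y w] forces [a = b], hence [Y w = - X w]; then
    [w + s X w] is a joint eigenvector with opposite signs. *)
Lemma kernel_start w : w != 0 -> a%:C *: X w + b%:C *: Y w = 0 ->
  exists u v e, [/\ u ^+ 2 = 1 :> R, v ^+ 2 = 1 :> R, <|e, e|> = 1,
    X e = u%:C *: e /\ Y e = v%:C *: e & a * u + b * v = 0].
Proof.
move=> w0 Tw.
have aXw : a%:C *: X w = - (b%:C *: Y w) by apply/eqP; rewrite -addr_eq0 Tw.
have w0' : rnorm w != 0 by apply: contra_neq w0; exact: rnorm0_eq0.
have ab : a = b.
  have := congr1 (@rnorm R H) aXw; rewrite rnormN !rnormZ !rnorm_isometry //.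
  by rewrite !gtr0_norm //; exact: mulIf.
have aC : (a%:C : R[i]) != 0 by rewrite fmorph_eq0 gt_eqF.
have Yw : Y w = - X w.
  by apply: (scalerI aC); rewrite scalerN aXw ab opprK.
have [s s1 [y0 Xy]] := invol_eigen XX w0.
set y := w + s%:C *: X w in y0 Xy.
have YXw : Y (X w) = - w by rewrite -[X w]opprK -Yw linearN /= YY.
have Yy : Y y = (- s)%:C *: y.
  rewrite /y linearD linearZ /= Yw YXw.
  have -> : - X w = - (s ^+ 2)%:C *: X w by rewrite s1 scaleN1r.
  by lmod.
have [c _ c1] := ex_unit y0.
exists s, (- s), (c *: y); split=> //.
- by rewrite sqrrN.
- by split; rewrite linearZ /= ?Xy ?Yy; lmod.
- by rewrite ab; ring.
Qed.

Definition commutator_op (x : H) : H := X (Y x) - Y (X x).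

(** Each involution anticommutes with [K = X Y - Y X]: [X K = Y - X Y X = - K X], and similarly for
    [Y]. *)
Lemma commutator_anti x : commutator_op (a%:C *: X x + b%:C *: Y x) =
  - (a%:C *: X (commutator_op x) + b%:C *: Y (commutator_op x)).
Proof.
rewrite /commutator_op.
have linX (f : {linear H -> H}) u v : f (a%:C *: u + b%:C *: v) = a%:C *: f u + b%:C *: f v.
  by rewrite linearD !linearZ.
by rewrite !linX !linearB /= !XX !YY; lmod.
Qed.

Lemma commutatorZ (r : R[i]) x y :
  commutator_op (r *: x + y) = r *: commutator_op x + commutator_op y.
Proof. by rewrite /commutator_op !linearP; lmod. Qed.

Lemma commutator_bound x : rnorm (commutator_op x) <= 2 * rnorm x.
Proof.
rewrite mulr_natl mulr2n; apply: le_trans (rnormD _ _) _.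
by rewrite rnormN !rnorm_isometry.
Qed.

End PairOfInvolutions.

Variables (X0 X1 X2 X3 : {linear H -> H}) (a0 a1 a2 a3 lam : R).
Hypotheses (a0_gt0 : 0 < a0) (a1_gt0 : 0 < a1) (a2_gt0 : 0 < a2) (a3_gt0 : 0 < a3).
Hypothesis lam0 : lam != 0.
Hypothesis sysX : involution_system (fam4 a0 a1 a2 a3) lam (fam4 X0 X1 X2 X3).
Hypothesis exx : exists x : H, x != 0.

Let K := commutator_op X0 X1.
Let L := commutator_op X2 X3.
Let T x := a0%:C *: X0 x + a1%:C *: X1 x.
Let T' x := a2%:C *: X2 x + a3%:C *: X3 x.

Let invX : [/\ forall x, X0 (X0 x) = x, forall x, X1 (X1 x) = x,
  forall x, X2 (X2 x) = x & forall x, X3 (X3 x) = x].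
Proof.
have [h _ _] := sysX; split=> x.
- by have := h (inord 0) x; rewrite /fam4 inordK.
- by have := h (inord 1) x; rewrite /fam4 inordK.
- by have := h (inord 2) x; rewrite /fam4 inordK.
- by have := h (inord 3) x; rewrite /fam4 inordK.
Qed.

Let saX : [/\ forall x y, <|X0 x, y|> = <|x, X0 y|>, forall x y, <|X1 x, y|> = <|x, X1 y|>,
  forall x y, <|X2 x, y|> = <|x, X2 y|> & forall x y, <|X3 x, y|> = <|x, X3 y|>].
Proof.
have [_ h _] := sysX; split=> x y.
- by have := h (inord 0) x y; rewrite /fam4 inordK.
- by have := h (inord 1) x y; rewrite /fam4 inordK.
- by have := h (inord 2) x y; rewrite /fam4 inordK.
- by have := h (inord 3) x y; rewrite /fam4 inordK.
Qed.

Let TT' x : T x + T' x = lam%:C *: x.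
Proof. by have [_ _ h] := sysX; rewrite -h sum4 /fam4 !inordK //= addrA. Qed.

(* [L K] shifts the spectrum of [T] by [2 lam], so a large power of it vanishes. *)
Lemma commutator_kernel : exists2 y, y != 0 & K y = 0 \/ L y = 0.
Proof.
have [I0 I1 I2 I3] := invX; have [S0 S1 S2 S3] := saX.
apply: contrapT => h.
have inj (y : H) : y != 0 -> L (K y) != 0.
  move=> y0; apply/negP => /eqP LKy.
  have [Ky|Ky] := eqVneq (K y) 0; first by apply: h; exists y; [|left].
  by apply: h; exists (K y); [|right].
have T'E x : T' x = lam%:C *: x - T x by rewrite -(TT' x); lmod.
have TE x : T x = lam%:C *: x - T' x by rewrite -(TT' x); lmod.
have KT x : K (T x) = - T (K x) by apply: commutator_anti.
have LT' x : L (T' x) = - T' (L x) by apply: commutator_anti.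
have KP (r : R[i]) x y : K (r *: x + y) = r *: K x + K y by apply: commutatorZ.
have LP (r : R[i]) x y : L (r *: x + y) = r *: L x + L y by apply: commutatorZ.
have shift x : T (L (K x)) = L (K (T x)) + (2 * lam)%:C *: L (K x).
  have -> : K (T x) = (- lam)%:C *: K x + T' (K x) by rewrite KT T'E; lmod.
  by rewrite LP LT' TE; lmod.
pose W n x := iter n (fun x => L (K x)) x.
have WZ n r x y : W n (r *: x + y) = r *: W n x + W n y.
  by elim: n => //= n ->; rewrite KP LP.
have shiftW n x : T (W n x) = W n (T x) + (2 * n%:R * lam)%:C *: W n x.
  elim: n => [|n IHn]; first by rewrite mulr0 mul0r scale0r addr0.
  rewrite [W n.+1 x]/= shift IHn [W n (T x) + _]addrC KP LP -natr1 [W n.+1 _]/=.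
  by lmod.
have Wb n x : rnorm (W n x) <= 4 ^+ n * rnorm x.
  elim: n => [|n IHn] /=; first by rewrite mul1r.
  apply: le_trans (commutator_bound I2 I3 S2 S3 _) _.
  have h2 := commutator_bound I0 I1 S0 S1 (W n x).
  rewrite exprS -mulrA; have := ler_wpM2l (ltW (ltr0Sn R 3)) IHn.
  by rewrite -/(K _) in h2; lra.
pose M := a0 + a1.
have M0 : 0 < M by rewrite addr_gt0.
have Tb x : rnorm (T x) <= M * rnorm x.
  apply: le_trans (rnormD _ _) _; rewrite !rnormZ !rnorm_isometry //.
  by rewrite !gtr0_norm // mulrDl.
(* With a shift of at least [3 M] and [T] bounded by [M], the norm of [W n (T x)] is at least [2 M]
   times that of [W n x]. Iterating, [(2 M)^k |W n x| <= |W n (T^k x)| <= 4^n M^k |x|] for all [k],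
   which is impossible when [W n x] is nonzero. *)
have [n nb] : exists n : nat, 3 * M <= 2 * n%:R * `|lam|.
  exists (Num.truncn ((3 * M) / (2 * `|lam|))).+1.
  have := ltW (truncnS_gt ((3 * M) / (2 * `|lam|))).
  by rewrite ler_pdivrMr ?mulr_gt0 ?normr_gt0 // mulrCA mulrA.
have step x : 2 * M * rnorm (W n x) <= rnorm (W n (T x)).
  have : rnorm ((2 * n%:R * lam)%:C *: W n x) <= rnorm (T (W n x)) + rnorm (W n (T x)).
    have -> : (2 * n%:R * lam)%:C *: W n x = T (W n x) - W n (T x) by rewrite shiftW; lmod.
    by apply: le_trans (rnormD _ _) _; rewrite rnormN.
  rewrite rnormZ normrM (ger0_norm (_ : 0 <= 2 * n%:R)) ?mulr_ge0 //.
  have := Tb (W n x); have := ler_wpM2r (rnorm_ge0 (W n x)) nb.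
  by lra.
have iterT k x : (2 * M) ^+ k * rnorm (W n x) <= 4 ^+ n * (M ^+ k * rnorm x).
  elim: k x => [|k IHk] x; first by rewrite !mul1r.
  rewrite exprSr -mulrA; have := step x; have M2 : 0 <= (2 * M) ^+ k by rewrite exprn_ge0 // mulr_ge0 // ltW.
  move=> /(ler_wpM2l M2) /le_trans; apply; apply: le_trans (IHk _) _.
  rewrite ler_wpM2l ?exprn_ge0 // exprSr -mulrA ler_wpM2l // exprn_ge0 //.
  exact: ltW.
have [x x0] := exx.
have W0 m : W m x != 0 by elim: m => //= m; exact: inj.
have wpos : 0 < rnorm (W n x).
  by rewrite lt_neqAle rnorm_ge0 andbT eq_sym; apply: contra_neq (W0 n); exact: rnorm0_eq0.
have [k kb] : exists k : nat, 4 ^+ n * rnorm x < k%:R * rnorm (W n x).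
  exists (Num.truncn (4 ^+ n * rnorm x / rnorm (W n x))).+1.
  by rewrite -ltr_pdivrMr // truncnS_gt.
have := iterT k x; rewrite exprMn -mulrA mulrCA [4 ^+ n * _]mulrCA.
rewrite ler_pM2l ?exprn_gt0 // => /le_lt_trans /(_ kb).
rewrite ltr_pM2r // -natrX ltr_nat; apply/negP; rewrite -leqNgt.
exact/ltnW/ltn_expl.
Qed.

Lemma start_exists :
  good_start X0 X1 X2 X3 a0 a1 a2 a3 lam \/ good_start X2 X3 X0 X1 a2 a3 a0 a1 lam.
Proof.
have [I0 I1 I2 I3] := invX; have [S0 S1 S2 S3] := saX.
have zn0 a b u v l : a * u + b * v = 0 -> (0 < l)%N -> chain_z a b lam u v l <> 0.
  move=> p0 l0 /eqP; rewrite /chain_z p0 subr0 mulf_eq0 (negPf lam0) pnatr_eq0 orbF.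
  by rewrite -leqn0 leqNgt l0.
have [[w w0 Tw]|nT] := pselect (exists2 w, w != 0 & T w = 0).
  have [u [v [e [u1 v1 e1 Xe p0]]]] := kernel_start a0_gt0 a1_gt0 I0 I1 S0 S1 w0 Tw.
  by left; exists u, v, e; split=> // l x l0 /(zn0 _ _ _ _ _ p0 l0).
have [[w w0 Tw]|nT'] := pselect (exists2 w, w != 0 & T' w = 0).
  have [u [v [e [u1 v1 e1 Xe p0]]]] := kernel_start a2_gt0 a3_gt0 I2 I3 S2 S3 w0 Tw.
  by right; exists u, v, e; split=> // l x l0 /(zn0 _ _ _ _ _ p0 l0).
have kT w : T w = 0 -> w = 0.
  by move=> Tw; have [//|w0] := eqVneq w 0; exfalso; apply: nT; exists w.
have kT' w : T' w = 0 -> w = 0.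
  by move=> Tw; have [//|w0] := eqVneq w 0; exfalso; apply: nT'; exists w.
have [y y0 [/eqP|/eqP]] := commutator_kernel; rewrite subr_eq0 => /eqP XY.
  have [u [v [e [u1 v1 e1 Xe Ye]]]] := joint_eigenvector I0 I1 y0 XY.
  by left; exists u, v, e; split=> // l x _ _; case: (odd l) => [/kT'|/kT].
have [u [v [e [u1 v1 e1 Xe Ye]]]] := joint_eigenvector I2 I3 y0 XY.
by right; exists u, v, e; split=> // l x _ _; case: (odd l) => [/kT|/kT'].
Qed.

End Start.

(** * Parameters of the chains *)

Section Classification.
Variable R : realType.
Implicit Types (x y d lam u v w : R).

Lemma sqr_lt_bounds x y : 0 <= y -> x ^+ 2 < y ^+ 2 -> - y < x /\ x < y.
Proof. by move=> y0 xy; split; rewrite ltNge; apply/negP => h; nra. Qed.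

Lemma sqr_gt_neg d x : d ^+ 2 < x ^+ 2 -> x < 0 -> x < d /\ x < - d.
Proof. by move=> dx x0; split; rewrite ltNge; apply/negP => h; nra. Qed.

Lemma sqr_gt_pos d x : d ^+ 2 < x ^+ 2 -> 0 < x -> d < x /\ - d < x.
Proof. by move=> dx x0; split; rewrite ltNge; apply/negP => h; nra. Qed.

Lemma sqr_gt_bounds d x : d < x -> - d < x -> d ^+ 2 < x ^+ 2.
Proof. by move=> h1 h2; nra. Qed.

Lemma sqr_lt_of_bounds x y : - y < x -> x < y -> x ^+ 2 < y ^+ 2.
Proof. by move=> h1 h2; nra. Qed.

Lemma sqr1P u : u ^+ 2 = 1 -> u = 1 \/ u = -1.
Proof. by move/eqP; rewrite sqrf_eq1 => /orP[] /eqP; [left|right]. Qed.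

(** The strict triangle inequalities for the two weights of the link and [|x|]; they are equivalent
    to [c l ^+ 2 < 1]. Squares make the sign of [x] irrelevant. *)
Definition link_open (a0 a1 a2 a3 : R) (l : nat) (x : R) : Prop :=
  if odd l then (a2 - a3) ^+ 2 < x ^+ 2 /\ x ^+ 2 < (a2 + a3) ^+ 2
  else (a0 - a1) ^+ 2 < x ^+ 2 /\ x ^+ 2 < (a0 + a1) ^+ 2.

(** [w] and [w'] are the signs at the last vertex of the pair to which link [n] belongs, just as [u]
    and [v] are the signs at the first vertex. *)
Definition chain_cond n (a0 a1 a2 a3 lam u v w w' : R) : Prop :=
  (forall l, (0 < l < n)%N ->
     link_open a0 a1 a2 a3 l (chain_z a0 a1 lam u v l)) /\
  chain_z a0 a1 lam u v n =
    if odd n then a2 * w + a3 * w' else a0 * w + a1 * w'.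

(** The inequalities are the lower triangle bounds [|a - b| < |z|] of the two middle links [n./2]
    and [n./2.+1], between which [z] changes sign. The parity of [n./2] decides which pair sits on
    which side. *)
Definition type0 n (lam b0 b1 b2 b3 : R) : Prop :=
  [/\ (3 <= n)%N, odd n & n%:R * lam = b0 + b1 + b2 + b3] /\
  forall b, b \in [:: b0; b1; b2; b3] ->
    if odd n./2 then 4 * b < (n%:R + 1) * lam else (n%:R - 1) * lam < 4 * b.

(** [b0] is the weight of the exceptional index. The equation is [n lam = p + q] for a progression
    running from [- p] to [q]; the inequalities come from the links near the two ends. They are
    symmetric in [b1], [b2], [b3], so only the exceptional index matters. *)
Definition type1 n (lam b0 b1 b2 b3 : R) : Prop :=
  (3 <= n)%N /\
  if odd n then n%:R * lam = b1 + b2 + b3 - b0 /\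
    forall b, b \in [:: b1; b2; b3] -> (n%:R - 1) * lam < 2 * b
  else n%:R * lam = 2 * b0 /\
    forall b, b \in [:: b1; b2; b3] -> 2 * b < b0 + b1 + b2 + b3 - (n%:R - 1) * lam.

Variables (a0 a1 a2 a3 lam : R).
Hypotheses (a0_gt0 : 0 < a0) (a1_gt0 : 0 < a1) (a2_gt0 : 0 < a2) (a3_gt0 : 0 < a3).
Hypothesis lam_gt0 : 0 < lam.

Lemma chain_z_le u v k l : (k <= l)%N ->
  chain_z a0 a1 lam u v k <= chain_z a0 a1 lam u v l.
Proof. by move=> kl; rewrite lerD2r ler_pM2r // ler_nat. Qed.

(** As [z] increases, an interior link is controlled from outside by the first and last interior
    links and, towards zero, by the middle link on its side, with one more step of [lam] when the
    parities differ. *)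
Lemma type0_chain n : type0 n lam a0 a1 a2 a3 ->
  chain_cond n a0 a1 a2 a3 lam 1 1 1 1.
Proof.
move=> [[n3 on nlam] cond]; set z := chain_z a0 a1 lam 1 1.
have [c0 c1 c2 c3] : [/\ (if odd n./2 then 4 * a0 < (n%:R + 1) * lam else (n%:R - 1) * lam < 4 * a0),
  (if odd n./2 then 4 * a1 < (n%:R + 1) * lam else (n%:R - 1) * lam < 4 * a1),
  (if odd n./2 then 4 * a2 < (n%:R + 1) * lam else (n%:R - 1) * lam < 4 * a2) &
  (if odd n./2 then 4 * a3 < (n%:R + 1) * lam else (n%:R - 1) * lam < 4 * a3)].
  by split; apply: cond; rewrite !inE eqxx ?orbT.
have zE l : z l = l%:R * lam - (a0 + a1) by rewrite /z /chain_z !mulr1.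
split; last by rewrite on -/z zE nlam; ring.
move=> l /andP[l0 ln]; rewrite /link_open -/z.
pose m := n./2; have nm : n = m.*2.+1 by rewrite -[LHS]odd_double_half on.
have nR : n%:R = 2 * m%:R + 1 :> R by rewrite nm -natr1 -mul2n natrM.
have z1 : z 1%N <= z l by exact: chain_z_le.
have zn1 : z l <= z n.-1 by apply: chain_z_le; rewrite -ltnS prednK // (leq_trans _ n3).
have n1E : (n.-1)%:R = n%:R - 1 :> R by rewrite nR nm /= -mul2n natrM; ring.
rewrite !zE ?n1E in z1 zn1.
have side : (l <= m)%N \/ (m < l)%N by case: leqP; [left|right].
have zm : (l <= m)%N -> z l <= m%:R * lam - (a0 + a1).
  by move=> lm; rewrite -zE; exact: chain_z_le.
have zm1 : (m < l)%N -> (m%:R + 1) * lam - (a0 + a1) <= z l.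
  by move=> lm; rewrite natr1 -zE; exact: chain_z_le.
have zm' : (l <= m)%N -> odd l != odd m -> z l <= (m%:R - 1) * lam - (a0 + a1).
  move=> lm par; have lm1 : (l <= m.-1)%N.
    by move: lm par; rewrite leq_eqVlt => /orP[/eqP->|]; [rewrite eqxx|move=> lm' _; rewrite -ltnS (ltn_predK lm')].
  have -> : m%:R - 1 = (m.-1)%:R :> R.
    by rewrite -subn1 natrB // (leq_trans l0).
  by rewrite -zE; exact: chain_z_le.
have zm1' : (m < l)%N -> odd l = odd m -> (m%:R + 2) * lam - (a0 + a1) <= z l.
  move=> lm par; have lm1 : (m.+2 <= l)%N.
    rewrite ltn_neqAle lm andbT; apply: contraPneq par => <- /=.
    by case: (odd m).
  by rewrite -natrD addn2 -zE; exact: chain_z_le.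
rewrite nR in nlam c0 c1 c2 c3 zn1; rewrite zE in zm zm1 zm' zm1'; rewrite zE.
set M := m%:R in nlam c0 c1 c2 c3 zn1 zm zm1 zm' zm1' *; set LL := l%:R in z1 zn1 zm zm1 zm' zm1' *.
have l2 : ~~ odd l -> 2 * lam <= LL * lam.
  move=> ev; rewrite ler_pM2r // ler_nat; move: ev l0; clear; case: l => [|[|]] //.
have ln2 : odd l -> LL * lam <= (2 * M - 1) * lam.
  move=> ol; rewrite ler_pM2r //; have : (l.+2 <= n)%N.
    move: ol ln; rewrite nm; clear; lia.
  by rewrite -(ler_nat R) nR -natr1 -natr1 -/LL -/M; lra.
rewrite -/m in c0 c1 c2 c3.
have gap d X : X < d -> X < - d -> d ^+ 2 < X ^+ 2.
  by move=> h1 h2; rewrite -[ltRHS]sqrrN; apply: sqr_gt_bounds; lra.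
clear -c0 c1 c2 c3 a0_gt0 a1_gt0 a2_gt0 a3_gt0 lam_gt0 side zm zm1 zm' zm1' l2 ln2 z1 zn1 nlam gap.
case om: (odd m) c0 c1 c2 c3 => c0 c1 c2 c3; case ol: (odd l);
  rewrite ol om /= in zm' zm1' l2 ln2; case: side => lm;
  rewrite ?lm in zm zm1 zm' zm1';
  try (have {}zm := zm isT); try (have {}zm1 := zm1 isT);
  try (have {}zm' := zm' isT isT); try (have {}zm1' := zm1' isT erefl);
  try (have {}l2 := l2 isT); try (have {}ln2 := ln2 isT);
  (split; last by apply: sqr_lt_of_bounds; lra).
- by apply: gap; lra.
- by apply: sqr_gt_bounds; lra.
- by apply: gap; lra.
- by apply: sqr_gt_bounds; lra.
- by apply: gap; lra.
- by apply: sqr_gt_bounds; lra.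
- by apply: gap; lra.
- by apply: sqr_gt_bounds; lra.
Qed.

Lemma chain_z_last u v n : (0 < n)%N ->
  chain_z a0 a1 lam u v n.-1 = chain_z a0 a1 lam u v n - lam.
Proof. by case: n => // n _; rewrite /chain_z /= -natr1; ring. Qed.

Lemma chain_z_last2 u v n : (1 < n)%N ->
  chain_z a0 a1 lam u v n.-2 = chain_z a0 a1 lam u v n - 2 * lam.
Proof. by case: n => [|[|n]] // _; rewrite /chain_z /= -natr1 -natr1; ring. Qed.

Let le_pred n l : (l < n)%N -> (l <= n.-1)%N.
Proof. by move=> ln; rewrite -ltnS (ltn_predK ln). Qed.

Let le_pred2 n l : (l < n)%N -> odd l = odd n -> (l <= n.-2)%N.
Proof. by clear; lia. Qed.

Let ge2 l : (0 < l)%N -> odd l = false -> (2 <= l)%N.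
Proof. by case: l => [|[|]]. Qed.

Let type1_odd_arith (N Z : R) : N * lam = a1 + a2 + a3 - a0 ->
  (N - 1) * lam < 2 * a1 -> (N - 1) * lam < 2 * a2 -> (N - 1) * lam < 2 * a3 ->
  lam + a0 - a1 <= Z -> Z <= a2 + a3 - lam ->
  (Z <= a2 + a3 - 2 * lam -> (a2 - a3) ^+ 2 < Z ^+ 2 /\ Z ^+ 2 < (a2 + a3) ^+ 2) /\
  (2 * lam + a0 - a1 <= Z -> (a0 - a1) ^+ 2 < Z ^+ 2 /\ Z ^+ 2 < (a0 + a1) ^+ 2).
Proof.
have := (a0_gt0, a1_gt0, a2_gt0, a3_gt0, lam_gt0) => -[[[[p0 p1] p2] p3] pl].
move=> nlam c1 c2 c3 h1 hn1; split=> h2.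
  by split; [apply: sqr_gt_bounds; lra|apply: sqr_lt_of_bounds; lra].
by split; [apply: sqr_gt_bounds; lra|apply: sqr_lt_of_bounds; lra].
Qed.

Let type1_even_arith (N Z : R) : N * lam = 2 * a0 ->
  2 * a1 < a0 + a1 + a2 + a3 - (N - 1) * lam ->
  2 * a2 < a0 + a1 + a2 + a3 - (N - 1) * lam ->
  2 * a3 < a0 + a1 + a2 + a3 - (N - 1) * lam ->
  lam - a0 + a1 <= Z -> Z <= a0 + a1 - lam ->
  ((a2 - a3) ^+ 2 < Z ^+ 2 /\ Z ^+ 2 < (a2 + a3) ^+ 2) /\
  (2 * lam - a0 + a1 <= Z -> Z <= a0 + a1 - 2 * lam ->
     (a0 - a1) ^+ 2 < Z ^+ 2 /\ Z ^+ 2 < (a0 + a1) ^+ 2).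
Proof.
have := (a0_gt0, a1_gt0, a2_gt0, a3_gt0, lam_gt0) => -[[[[p0 p1] p2] p3] pl].
move=> nlam c1 c2 c3 h1 hn1; split=> [|h2 hn2].
  by split; [apply: sqr_gt_bounds; lra|apply: sqr_lt_of_bounds; lra].
by split; [apply: sqr_gt_bounds; lra|apply: sqr_lt_of_bounds; lra].
Qed.

(** As [z] increases, only its extreme values matter: those at the links 1 and [n.-1], moved to 2
    and [n.-2] when the parity of [l] excludes the former. *)
Lemma type1_chain n : type1 n lam a0 a1 a2 a3 ->
  let u := if odd n then -1 else 1 in
  chain_cond n a0 a1 a2 a3 lam u (- u) 1 1.
Proof.
move=> [n3 cond] u; set z := chain_z a0 a1 lam u (- u).
have n0 : (0 < n)%N by exact: ltn_trans n3.
have n1 : (1 < n)%N by exact: ltn_trans n3.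
have zE l : z l = l%:R * lam - (a0 - a1) * u by rewrite /z /chain_z; ring.
have znE : z n = if odd n then a2 * 1 + a3 * 1 else a0 * 1 + a1 * 1.
  by rewrite zE /u; case: (odd n) cond => -[-> _]; ring.
split=> // l /andP[l0 ln]; rewrite /link_open -/z.
have h1 : z 1%N <= z l by exact: chain_z_le.
have hn1 : z l <= z n - lam.
  by rewrite /z -chain_z_last //; apply: chain_z_le; exact: le_pred.
have h2 : odd l = false -> z 2%N <= z l by move=> ol; apply: chain_z_le; exact: ge2.
have hn2 : odd l = odd n -> z l <= z n - 2 * lam.
  by move=> ol; rewrite /z -chain_z_last2 //; apply: chain_z_le; exact: le_pred2.
have mem1 (P : R -> Prop) : (forall b, b \in [:: a1; a2; a3] -> P b) -> [/\ P a1, P a2 & P a3].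
  by move=> h; split; apply: h; rewrite !inE eqxx ?orbT.
move: h1 h2; rewrite (zE 1%N) (zE 2%N) /u.
case on: (odd n) cond znE hn2 => -[nlam /mem1[c1 c2 c3]] znE hn2;
  rewrite znE !mulr1 in hn1 hn2 => h1 h2.
  have [||ho he] := type1_odd_arith (Z := z l) nlam c1 c2 c3.
  - by move: h1; rewrite mul1r mulrN1 opprK addrA.
  - exact: hn1.
  case ol: (odd l) h2 hn2 => h2 hn2; first by apply: ho; exact: hn2.
  by apply: he; move: (h2 erefl); rewrite mulrN1 opprK addrA.
have [||ho he] := type1_even_arith (Z := z l) nlam c1 c2 c3.
- by move: h1; rewrite mul1r mulr1 opprB addrA addrAC.
- exact: hn1.
case ol: (odd l) h2 hn2 => h2 hn2; first exact: ho.
apply: he; last exact: hn2.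
by move: (h2 erefl); rewrite mulr1 opprB addrA addrAC.
Qed.

End Classification.

Section ChainClassification.
Variable R : realType.
Variables (a0 a1 a2 a3 lam : R) (n : nat) (u v w w' : R).
Hypotheses (a0_gt0 : 0 < a0) (a1_gt0 : 0 < a1) (a2_gt0 : 0 < a2) (a3_gt0 : 0 < a3).
Hypothesis lam_gt0 : 0 < lam.
Hypothesis n_ge3 : (3 <= n)%N.
Hypotheses (u1 : u ^+ 2 = 1) (v1 : v ^+ 2 = 1) (w1 : w ^+ 2 = 1) (w1' : w' ^+ 2 = 1).
Hypothesis cond : chain_cond n a0 a1 a2 a3 lam u v w w'.

Let z l : R := chain_z a0 a1 lam u v l.
Let open_even (x : R) := (a0 - a1) ^+ 2 < x ^+ 2 /\ x ^+ 2 < (a0 + a1) ^+ 2.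
Let open_odd (x : R) := (a2 - a3) ^+ 2 < x ^+ 2 /\ x ^+ 2 < (a2 + a3) ^+ 2.
Let p := a0 * u + a1 * v.

Let zE l : z l = l%:R * lam - p. Proof. by []. Qed.

Let n_gt1 : (1 < n)%N. Proof. exact: ltn_trans n_ge3. Qed.
Let n_gt0 : (0 < n)%N. Proof. exact: ltn_trans n_ge3. Qed.

Let link l : (0 < l < n)%N -> if odd l then open_odd (z l) else open_even (z l).
Proof. by move/(cond.1 l). Qed.

Let link1 : open_odd (lam - p).
Proof. by have := link (l := 1%N) n_gt1; rewrite zE mul1r. Qed.

Let link2 : open_even (2 * lam - p).
Proof. exact: (link (l := 2%N) n_ge3). Qed.

Let q : R := if odd n then a2 * w + a3 * w' else a0 * w + a1 * w'.

Let zn : n%:R * lam - p = q. Proof. exact: cond.2. Qed.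

Let last1 : if odd n then open_even (q - lam) else open_odd (q - lam).
Proof.
have := link (l := n.-1); rewrite /z chain_z_last // -/(z n) zE zn.
have -> : odd n.-1 = ~~ odd n by rewrite -[in RHS](prednK n_gt0) /= negbK.
by rewrite -ltnS prednK // n_gt1 leqnn => /(_ isT); case: (odd n).
Qed.

Let last2 : if odd n then open_odd (q - 2 * lam) else open_even (q - 2 * lam).
Proof.
have := link (l := n.-2); rewrite /z chain_z_last2 // -/(z n) zE zn.
have nE : n = n.-2.+2 by case: (n) n_gt1 => [|[]].
have -> : odd n.-2 = odd n by rewrite [in RHS]nE /= negbK.
have -> : (0 < n.-2 < n)%N by rewrite {2 3}nE; move: n_ge3; case: (n) => [|[|[]]] //= m _; rewrite ltnW.
by move=> /(_ isT).
Qed.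

Let pos := (a0_gt0, a1_gt0, a2_gt0, a3_gt0, lam_gt0).

(** Here [z 2 = 2 lam + a0 + a1] would be too long for the triangle of link 2. *)
Let not_mm : ~ (u = -1 /\ v = -1).
Proof.
move=> [uE vE]; have := pos => -[[[[p0 p1] p2] p3] pl].
have [_ /sqr_lt_bounds h] := link2; have [|_ h2] := h _; first by lra.
by move: h2; rewrite /p uE vE => h2; lra.
Qed.

Let not_mm' : ~ (w = -1 /\ w' = -1).
Proof.
move=> [wE wE']; have := pos => -[[[[p0 p1] p2] p3] pl].
have := last2; rewrite /q wE wE'.
by case: (odd n) => -[_ /sqr_lt_bounds h]; have [|h2 _] := h _; lra.
Qed.

Let abs_cases (x d : R) : d ^+ 2 < x ^+ 2 -> (d < x /\ - d < x) \/ (x < d /\ x < - d).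
Proof.
move=> dx; have [x0|x0|x0] := ltgtP x 0.
- by right; exact: sqr_gt_neg.
- by left; exact: sqr_gt_pos.
- by move: dx; rewrite x0 expr0n /= => dx; have := sqr_ge0 d; lra.
Qed.

(** For opposite signs [p ^+ 2 = (a0 - a1) ^+ 2], so link 2, which belongs to the starting pair,
    gives [p ^+ 2 < (2 lam - p) ^+ 2], that is [p < lam]. *)
Let mixed_start : u = - v -> p < lam /\ n%:R * lam = p + q.
Proof.
move=> uv; have := pos => -[[[[p0 p1] p2] p3] pl].
have pp : p ^+ 2 = (a0 - a1) ^+ 2.
  have -> : (a0 - a1) ^+ 2 = (a0 - a1) ^+ 2 * v ^+ 2 by rewrite v1 mulr1.
  by rewrite /p uv; ring.
have [] := link2; rewrite -pp => /abs_cases [] [h1 h2] _.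
  by split; [lra|rewrite -zn; ring].
lra.
Qed.

Let mixed_end : w = - w' -> q < lam /\ n%:R * lam = p + q.
Proof.
move=> ww; have := pos => -[[[[p0 p1] p2] p3] pl].
have h : exists2 d : R, d ^+ 2 = q ^+ 2 & d ^+ 2 < (q - 2 * lam) ^+ 2.
  have := last2; rewrite /q; case: (odd n) => -[h _].
    exists (a2 - a3) => //; have -> : (a2 - a3) ^+ 2 = (a2 - a3) ^+ 2 * w' ^+ 2 by rewrite w1' mulr1.
    by rewrite ww; ring.
  exists (a0 - a1) => //; have -> : (a0 - a1) ^+ 2 = (a0 - a1) ^+ 2 * w' ^+ 2 by rewrite w1' mulr1.
  by rewrite ww; ring.
have [d -> /abs_cases [] [h1 h2]] := h.
  lra.
by split; [lra|rewrite -zn; ring].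
Qed.

(** Both ends together would give [n lam = p + q < 2 lam], against [3 <= n]. *)
Let not_mixed : u = - v -> w = - w' -> False.
Proof.
move=> uv ww; have := pos => -[[[[p0 p1] p2] p3] pl].
have [h2 h3] := mixed_start uv; have [k1 _] := mixed_end ww.
have : (3%:R : R) * lam <= n%:R * lam by rewrite ler_pM2r // ler_nat.
by rewrite h3; lra.
Qed.

Lemma mixed_start_type1 : u = - v -> w = 1 -> w' = 1 ->
  (if odd n then v = 1 else u = 1) -> type1 n lam a0 a1 a2 a3.
Proof.
move=> uv wE wE' sg; have [h2 h3] := mixed_start uv.
have := pos => -[[[[p0 p1] p2] p3] pl].
have [/abs_cases k _] := link1; have l1 := last1.
split=> //; case on: (odd n) sg l1 h3; rewrite /q ?on wE wE' !mulr1 => sg l1 h3.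
  have pE : p = a1 - a0 by rewrite /p uv sg; ring.
  have [_ /sqr_lt_bounds [|l2 l3]] := l1; first by lra.
  rewrite pE in h2 h3 k; move: (n%:R : R) h3 => N h3.
  split; first by rewrite h3; ring.
  have {}h3 : N * lam = a1 - a0 + (a2 + a3) by [].
  by move=> b; rewrite !inE => /or3P[]/eqP->; case: k => -[k1 k2]; lra.
have vE : v = -1 by rewrite -[v]opprK -uv sg.
have pE : p = a0 - a1 by rewrite /p vE sg; ring.
have [_ /sqr_lt_bounds [|l2 l3]] := l1; first by lra.
rewrite pE in h2 h3 k; move: (n%:R : R) h3 => N h3.
split; first by rewrite h3; ring.
have {}h3 : N * lam = a0 - a1 + (a0 + a1) by [].
by move=> b; rewrite !inE => /or3P[]/eqP->; case: k => -[k1 k2]; lra.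
Qed.

Lemma mixed_end_even_type1 : ~~ odd n -> u = 1 -> v = 1 -> w = 1 -> w' = -1 ->
  type1 n lam a0 a1 a2 a3.
Proof.
move=> /negbTE en uE vE wE wE'.
have ww : w = - w' by rewrite wE wE' opprK.
have [h2 h3] := mixed_end ww.
have := pos => -[[[[p0 p1] p2] p3] pl].
have [_ /sqr_lt_bounds [|l2 l3]] := link1; first by lra.
have pE : p = a0 + a1 by rewrite /p uE vE; ring.
have qE : q = a0 - a1 by rewrite /q en wE wE'; ring.
have := last1; rewrite en => -[/abs_cases k _].
rewrite pE in l2 l3 h3; rewrite qE in h2 h3 k.
split=> //; rewrite en; move: (n%:R : R) h3 => N h3.
split; first by rewrite h3; ring.
have {}h3 : N * lam = a0 + a1 + (a0 - a1) by [].
by move=> b; rewrite !inE => /or3P[]/eqP->; case: k => -[k1 k2]; lra.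
Qed.

Lemma mixed_end_odd_type1 : odd n -> u = 1 -> v = 1 -> w = -1 -> w' = 1 ->
  type1 n lam a2 a3 a0 a1.
Proof.
move=> on uE vE wE wE'.
have ww : w = - w' by rewrite wE wE'.
have [h2 h3] := mixed_end ww.
have := pos => -[[[[p0 p1] p2] p3] pl].
have [_ /sqr_lt_bounds [|l2 l3]] := link1; first by lra.
have pE : p = a0 + a1 by rewrite /p uE vE; ring.
have qE : q = a3 - a2 by rewrite /q on wE wE'; ring.
have := last1; rewrite on => -[/abs_cases k _].
rewrite pE in l2 l3 h3; rewrite qE in h2 h3 k.
split=> //; rewrite on; move: (n%:R : R) h3 => N h3.
split; first by rewrite h3; ring.
have {}h3 : N * lam = a0 + a1 + (a3 - a2) by [].
by move=> b; rewrite !inE => /or3P[]/eqP->; case: k => -[k1 k2]; lra.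
Qed.

(** For even [n] the progression would be symmetric about zero and vanish at link [n./2], against
    the lower triangle bound there. For odd [n] links 1 and [n.-1] place the sign change between the
    two middle links, whose lower bounds are then the claim. *)
Lemma all_plus_type0 : u = 1 -> v = 1 -> w = 1 -> w' = 1 -> type0 n lam a0 a1 a2 a3.
Proof.
move=> uE vE wE wE'; have := pos => -[[[[p0 p1] p2] p3] pl].
have pE : p = a0 + a1 by rewrite /p uE vE !mulr1.
pose m := n./2; have nm := odd_double_half n.
have m0 : (0 < m)%N by rewrite half_gt0.
have mn : (m < n)%N by rewrite /m; move: n_gt0; clear; lia.
have lm := link (l := m); rewrite m0 mn in lm; have {}lm := lm isT.
have zn' := zn.
case on : (odd n) nm zn'; rewrite /q ?on wE wE' !mulr1 => nm zn'; last first.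
  have zm0 : z m = 0.
    have : 2 * z m = 0.
      have nR : n%:R = 2 * m%:R :> R by rewrite -nm add0n -mul2n natrM.
      by rewrite zE; move: zn'; rewrite nR pE; lra.
    by move/eqP; rewrite mulf_eq0 pnatr_eq0 => /eqP.
  move: lm; rewrite zm0 /open_odd /open_even expr0n /=.
  by case: (odd m) => -[h _]; [have := sqr_ge0 (a2 - a3)|have := sqr_ge0 (a0 - a1)]; lra.
have nR : n%:R = 2 * m%:R + 1 :> R by rewrite -nm add1n -mul2n -natr1 natrM.
have mn1 : (m.+1 < n)%N by move: n_ge3 nm; rewrite /m; clear; lia.
have lm1 := link (l := m.+1); rewrite mn1 in lm1; have {}lm1 := lm1 isT.
have [_ /sqr_lt_bounds [|e1 e2]] := link1; first by lra.
have l1 := last1; rewrite on /q on wE wE' !mulr1 in l1.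
have [_ /sqr_lt_bounds [|e3 e4]] := l1; first by lra.
split; first by split=> //; rewrite -[LHS](subrK p) zn pE /q on wE wE'; ring.
rewrite !zE -natr1 /= pE in lm lm1; rewrite pE nR in zn'; rewrite pE in e1 e2.
rewrite -/m nR; move: (m%:R : R) zn' lm lm1 => M zn' lm lm1.
have zM : (2 * M + 1) * lam - (a0 + a1) = a2 + a3 by [].
case: (odd m) lm lm1 => -[/abs_cases k _] [/abs_cases k' _] b; rewrite !inE => /or4P[]/eqP->;
  by case: k => -[k1 k2]; case: k' => -[k3 k4]; lra.
Qed.

Lemma signs_cases : [\/ [/\ u = 1, v = 1, w = 1 & w' = 1],
   [/\ u = 1, v = -1, w = 1 & w' = 1], [/\ u = -1, v = 1, w = 1 & w' = 1] |
   u = 1 /\ v = 1 /\ (w = 1 /\ w' = -1 \/ w = -1 /\ w' = 1)].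
Proof.
have [uE|uE] := sqr1P u1; have [vE|vE] := sqr1P v1;
  have [wE|wE] := sqr1P w1; have [wE'|wE'] := sqr1P w1';
  try (by case: not_mm); try (by case: not_mm');
  try (by case: not_mixed; rewrite ?uE ?vE ?wE ?wE' ?opprK);
  [exact: Or41|by apply: Or44; do 2?split=> //; left|by apply: Or44; do 2?split=> //; right
  |exact: Or42|exact: Or43].
Qed.

End ChainClassification.

Lemma chain_cond_swap (R : realType) n (a0 a1 a2 a3 lam u v w w' : R) :
  chain_cond n a0 a1 a2 a3 lam u v w w' -> chain_cond n a1 a0 a3 a2 lam v u w' w.
Proof.
have zE l : chain_z a1 a0 lam v u l = chain_z a0 a1 lam u v l.
  by rewrite /chain_z [_ * v + _]addrC.
move=> [h e]; split=> [l ln|]; last by rewrite zE e; case: (odd n); rewrite addrC.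
have := h l ln; rewrite zE /link_open.
have sqC (x y : R) : (x - y) ^+ 2 = (y - x) ^+ 2 by ring.
by rewrite (sqC a3 a2) (sqC a1 a0) [a3 + a2]addrC [a1 + a0]addrC.
Qed.

(* The four alternatives of the second kind are distinguished by the
   exceptional index 0, 1, 2, 3. *)
Theorem chain_classify (R : realType) n (a0 a1 a2 a3 lam u v w w' : R) :
  0 < a0 -> 0 < a1 -> 0 < a2 -> 0 < a3 -> 0 < lam -> (3 <= n)%N ->
  u ^+ 2 = 1 -> v ^+ 2 = 1 -> w ^+ 2 = 1 -> w' ^+ 2 = 1 ->
  chain_cond n a0 a1 a2 a3 lam u v w w' ->
  (type0 n lam a0 a1 a2 a3 /\ [/\ u = 1, v = 1, w = 1 & w' = 1]) \/
  [\/ type1 n lam a0 a1 a2 a3 /\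
       (if odd n then [/\ u = -1, v = 1, w = 1 & w' = 1]
        else [/\ u = 1, v = -1, w = 1 & w' = 1] \/ [/\ u = 1, v = 1, w = 1 & w' = -1]),
      type1 n lam a1 a0 a3 a2 /\
       (if odd n then [/\ u = 1, v = -1, w = 1 & w' = 1]
        else [/\ u = -1, v = 1, w = 1 & w' = 1] \/ [/\ u = 1, v = 1, w = -1 & w' = 1]),
      type1 n lam a2 a3 a0 a1 /\ odd n /\ [/\ u = 1, v = 1, w = -1 & w' = 1] |
      type1 n lam a3 a2 a1 a0 /\ odd n /\ [/\ u = 1, v = 1, w = 1 & w' = -1]].
Proof.
move=> a0p a1p a2p a3p lp n3 u1 v1 w1 w1' cond; have cond' := chain_cond_swap cond.
have [[uE vE wE wE']|[uE vE wE wE']|[uE vE wE wE']|[uE [vE ww]]] :=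
  signs_cases a0p a1p a2p a3p lp n3 u1 v1 w1 w1' cond.
- by left; split=> //; apply: (all_plus_type0 a0p a1p a2p a3p lp n3 cond).
- right; case on: (odd n).
    apply: Or42; split=> //.
    by apply: (mixed_start_type1 a1p a0p a3p a2p lp n3 u1 cond') => //;
      rewrite ?on // ?uE ?vE.
  apply: Or41; split; last by left.
  by apply: (mixed_start_type1 a0p a1p a2p a3p lp n3 v1 cond) => //;
    rewrite ?on // ?uE ?vE ?opprK.
- right; case on: (odd n).
    apply: Or41; split=> //.
    by apply: (mixed_start_type1 a0p a1p a2p a3p lp n3 v1 cond) => //;
      rewrite ?on // ?uE ?vE.
  apply: Or42; split; last by left.
  by apply: (mixed_start_type1 a1p a0p a3p a2p lp n3 u1 cond') => //;
    rewrite ?on // ?uE ?vE ?opprK.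
- right; case on: (odd n); case: ww => -[wE wE'].
  + apply: Or44; split=> //.
    by apply: (mixed_end_odd_type1 a1p a0p a3p a2p lp n3 w1 cond').
  + apply: Or43; split=> //.
    by apply: (mixed_end_odd_type1 a0p a1p a2p a3p lp n3 w1' cond).
  + apply: Or41; split; last by right.
    by apply: (mixed_end_even_type1 a0p a1p a2p a3p lp n3 w1' cond) => //; rewrite on.
  + apply: Or42; split; last by right.
    by apply: (mixed_end_even_type1 a1p a0p a3p a2p lp n3 w1 cond') => //; rewrite on.
Qed.

(** * Normal forms for a nonzero sum *)

Section Reindexing.
Variables (R : realType) (H : hilbert R).

Lemma fam4_eta (T : Type) (X : 'I_4 -> T) :
  fam4 (X (inord 0)) (X (inord 1)) (X (inord 2)) (X (inord 3)) = X.
Proof. by apply/funext; apply: ord4P; rewrite /fam4 inordK. Qed.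

Variables (s : 'I_4 -> 'I_4).
Hypothesis sK : bijective s.

Lemma involution_system_perm a lam (X : 'I_4 -> {linear H -> H}) :
  involution_system a lam X ->
  involution_system (fun j => a (s j)) lam (fun j => X (s j)).
Proof.
move=> [XX Xsa Xsum]; split=> // x.
by rewrite -Xsum [RHS](reindex s) //; exact: onW_bij.
Qed.

Lemma irreducible_perm (X : 'I_4 -> {linear H -> H}) :
  irreducible_family X -> irreducible_family (fun j => X (s j)).
Proof.
move=> [x0 irr]; split=> // S linS clS Sinv; apply: irr => // j x Sx.
by have [s' _ ss'] := sK; rewrite -(ss' j); exact: Sinv.
Qed.

Lemma nonscalar_perm (X : 'I_4 -> {linear H -> H}) :
  nonscalar_family X -> nonscalar_family (fun j => X (s j)).
Proof. by move=> ns j b; exact: ns. Qed.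

End Reindexing.

(* Bitwise exclusive or: the regular action of the Klein four-group, which
   preserves the pairing {0, 1}, {2, 3}. *)
Definition klein (d j : 'I_4) : 'I_4 :=
  inord (nth 0 (nth [::] [:: [:: 0; 1; 2; 3]; [:: 1; 0; 3; 2];
                             [:: 2; 3; 0; 1]; [:: 3; 2; 1; 0]] d) j)%N.

Lemma kleinK d : involutive (klein d).
Proof.
by move: d; apply: ord4P; apply: ord4P; rewrite /klein !inordK //= ?inordK.
Qed.

Lemma klein_bij d : bijective (klein d).
Proof. exact: inv_bij (kleinK d). Qed.

Section ChainMatrix.
Variable R : realType.
Variables (a0 a1 a2 a3 lam u v : R).

Let c := chain_c a0 a1 a2 a3 lam u v.
Let c' := partner_coef a0 a1 a2 a3 c (chain_z a0 a1 lam u v).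

Definition chain_q : 'I_4 -> bool := fam4 false false true true.

Definition chain_D : 'I_4 -> nat -> R :=
  fam4 (chain_d c false) (chain_d c' false) (chain_d c true) (chain_d c' true).

Definition chain_T : 'I_4 -> nat -> R :=
  fam4 (chain_t c false) (fun i => - (a0 * chain_t c false i) / a1)
       (chain_t c true) (fun i => - (a2 * chain_t c true i) / a3).

End ChainMatrix.

Section ChainForm.
Variables (R : realType) (H : hilbert R).
Local Notation "<| x , y |>" := (inner H x y) (format "<| x ,  y |>").

Definition family_trace n (e : nat -> H) (X : {linear H -> H}) : R[i] :=
  \sum_(i < n) <|X (e i), e i|>.

Definition joint_vector (X Y : {linear H -> H}) (u v : R) : Prop :=
  exists x, [/\ <|x, x|> = 1, X x = u%:C *: x & Y x = v%:C *: x].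

(** A chain with an exceptional index can be found from either end. The end with opposite signs is
    the canonical start; recording it lets the matrix entries depend on the form alone. *)
Definition small_vector n (X Y : {linear H -> H}) : Prop :=
  if odd n then joint_vector X Y (-1) 1 else joint_vector X Y 1 (-1).

Definition form0 n lam (a : 'I_4 -> R) (X : 'I_4 -> {linear H -> H}) (e : nat -> H) : Prop :=
  [/\ type0 n lam (a (inord 0)) (a (inord 1)) (a (inord 2)) (a (inord 3)),
      forall j, family_trace n e (X j) = 1,
      joint_vector (X (inord 0)) (X (inord 1)) 1 1 &
      joint_vector (X (inord 2)) (X (inord 3)) 1 1].

Definition trace1 n (d j : 'I_4) : R :=
  if odd n then (if j == d then -1 else 1) else (if j == d then 2 else 0).

Definition form1 n lam (a : 'I_4 -> R) (X : 'I_4 -> {linear H -> H}) (e : nat -> H) (d : 'I_4) : Prop :=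
  let k := klein d in
  [/\ type1 n lam (a (k (inord 0))) (a (k (inord 1))) (a (k (inord 2))) (a (k (inord 3))),
      forall j, family_trace n e (X j) = (trace1 n d j)%:C &
      small_vector n (X d) (X (k (inord 1)))].

Variables (X0 X1 X2 X3 : {linear H -> H}) (a0 a1 a2 a3 lam : R).
Hypotheses (a0_gt0 : 0 < a0) (a1_gt0 : 0 < a1) (a2_gt0 : 0 < a2) (a3_gt0 : 0 < a3).
Hypothesis lam_gt0 : 0 < lam.
Hypothesis sysX : involution_system (fam4 a0 a1 a2 a3) lam (fam4 X0 X1 X2 X3).
Hypothesis irrX : irreducible_family (fam4 X0 X1 X2 X3).
Hypothesis nsX : nonscalar_family (fam4 X0 X1 X2 X3).

Lemma scalar_contra n e (X : {linear H -> H}) (s : R) : orthobasis n e ->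
  (forall (b : bool), exists2 x, x != 0 & X x = (-1) ^+ b *: x) ->
  s ^+ 2 = 1 -> ~ forall i, (i < n)%N -> X (e i) = s%:C *: e i.
Proof.
move=> be ns s1 Xe; have Xx x : X x = s%:C *: x.
  rewrite [in LHS](be.2 x) linear_sum [in RHS](be.2 x) scaler_sumr; apply: eq_bigr => i _.
  by rewrite linearZ /= Xe // !scalerA mulrC.
have bad (b : bool) : s = - (-1) ^+ b -> False.
  move=> sE; have [x x0] := ns b; rewrite Xx sE => /eqP.
  rewrite -subr_eq0 -scalerBl scaler_eq0 (negPf x0) orbF rmorphN rmorph_sign.
  rewrite -opprD oppr_eq0 -mulr2n mulrn_eq0 /=; apply/negP.
  by rewrite signr_eq0.
have [sE|sE] := sqr1P s1; first by apply: (bad true); rewrite sE expr1 opprK.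
by apply: (bad false); rewrite sE expr0.
Qed.

Lemma chain_of_start u v e0 : u ^+ 2 = 1 -> v ^+ 2 = 1 -> <|e0, e0|> = 1 ->
  X0 e0 = u%:C *: e0 -> X1 e0 = v%:C *: e0 ->
  (forall l x, (0 < l)%N -> chain_z a0 a1 lam u v l = 0 ->
     pair_sum X0 X1 X2 X3 a0 a1 a2 a3 (odd l) x = 0 -> x = 0) ->
  exists n w w', [/\ (3 <= n)%N, w ^+ 2 = 1, w' ^+ 2 = 1,
    chain_cond n a0 a1 a2 a3 lam u v w w' &
    let e := chain_vec X0 X2 a0 a1 a2 a3 lam u v e0 in
    [/\ orthobasis n e,
      forall j i, (i < n)%N -> fam4 X0 X1 X2 X3 j (e i) =
        (chain_D a0 a1 a2 a3 lam u v j i)%:C *: e i +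
        (chain_T a0 a1 a2 a3 lam u v j i)%:C *: e (chain_sg n (chain_q j) i),
      forall j, family_trace n e (fam4 X0 X1 X2 X3 j) =
         (fam4 (u + if odd n then 0 else w) (v + if odd n then 0 else w')
               (if odd n then w else 0) (if odd n then w' else 0) j)%:C &
      if odd n then joint_vector X2 X3 w w' else joint_vector X0 X1 w w']].
Proof.
move=> u1 v1 e1 Xe Ye zker.
have lam0 : lam != 0 by rewrite gt_eqF.
have [n [n0 c_int cn z_nz [be opE mE]]] :=
  chain_analysis a0_gt0 a1_gt0 a2_gt0 a3_gt0 lam0 sysX irrX u1 v1 e1 Xe Ye zker.
set e := chain_vec _ _ _ _ _ _ _ _ _ _ in be opE mE.
set c := chain_c a0 a1 a2 a3 lam u v in c_int cn opE.
set z := chain_z a0 a1 lam u v in z_nz mE.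
have XE i : (i < n)%N -> X0 (e i) = (chain_d c false i)%:C *: e i +
   (chain_t c false i)%:C *: e (chain_sg n false i) by exact: (opE false).
have X2E i : (i < n)%N -> X2 (e i) = (chain_d c true i)%:C *: e i +
   (chain_t c true i)%:C *: e (chain_sg n true i) by exact: (opE true).
have TE i : (i < n)%N -> a0%:C *: X0 (e i) + a1%:C *: X1 (e i) =
   (chain_d z false i)%:C *: e i by exact: mE.
have [_ _ Xsum] := sysX.
have T'E i : (i < n)%N -> a2%:C *: X2 (e i) + a3%:C *: X3 (e i) =
   (chain_d z true i)%:C *: e i.
  move=> ni; have := Xsum (e i); rewrite sum4 /fam4 !inordK //= -addrA TE // => E.
  have -> : a2%:C *: X2 (e i) + a3%:C *: X3 (e i) = lam%:C *: e i - (chain_d z false i)%:C *: e i.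
    by rewrite -E; lmod.
  rewrite -scalerBl -rmorphB; congr (_%:C *: _).
  by rewrite /chain_d addbF addbT; case: (odd i) => /=; rewrite /z /chain_z -natr1; ring.
pose c' := partner_coef a0 a1 a2 a3 c z.
have a1C : (a1%:C : R[i]) != 0 by rewrite fmorph_eq0 gt_eqF.
have a3C : (a3%:C : R[i]) != 0 by rewrite fmorph_eq0 gt_eqF.
have partner (q : bool) i : chain_d c' q i =
    (chain_d z q i - (if q then a2 else a0) * chain_d c q i) / (if q then a3 else a1).
  rewrite /chain_d /c' /partner_coef /=; case: q; rewrite ?addbT ?addbF; case: (odd i) => //=;
    by field; rewrite gt_eqF.
have comb (A B zz d d' t : R) (x y : H) : d' = (zz - A * d) / B -> B != 0 ->
    zz%:C *: x - A%:C *: (d%:C *: x + t%:C *: y) =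
    B%:C *: (d'%:C *: x + (- (A * t) / B)%:C *: y).
  move=> d'E B0; have E1 : B * d' = zz - A * d by rewrite d'E mulrC divfK.
  have E2 : B * (- (A * t) / B) = - (A * t) by rewrite mulrC divfK.
  move: (- (A * t) / B) E2 => r E2.
  transitivity ((zz - A * d)%:C *: x + (- (A * t))%:C *: y); first by lmod.
  by rewrite -E1 -E2; lmod.
have X1E i : (i < n)%N -> X1 (e i) = (chain_d c' false i)%:C *: e i +
   (- (a0 * chain_t c false i) / a1)%:C *: e (chain_sg n false i).
  move=> ni; apply: (scalerI a1C).
  have -> : a1%:C *: X1 (e i) = (chain_d z false i)%:C *: e i - a0%:C *: X0 (e i).
    by rewrite -TE //; lmod.
  by rewrite XE // (comb _ _ _ _ _ _ _ _ (partner false i)) // gt_eqF.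
have X3E i : (i < n)%N -> X3 (e i) = (chain_d c' true i)%:C *: e i +
   (- (a2 * chain_t c true i) / a3)%:C *: e (chain_sg n true i).
  move=> ni; apply: (scalerI a3C).
  have -> : a3%:C *: X3 (e i) = (chain_d z true i)%:C *: e i - a2%:C *: X2 (e i).
    by rewrite -T'E //; lmod.
  by rewrite X2E // (comb _ _ _ _ _ _ _ _ (partner true i)) // gt_eqF.
have s0 : chain_s c 0 = 0 by rewrite /chain_s /c /chain_c /= sqrrN u1 subrr sqrtr0.
have sn : chain_s c n = 0 by rewrite /chain_s cn subrr sqrtr0.
have tfix q i : (i < n)%N -> chain_sg n q i = i -> chain_t c q i = 0.
  rewrite /chain_sg /chain_t => ni; case: ifP => lo.
    case: ltnP => [_ /eqP|ni' _]; first by rewrite eqn_leq ltnn.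
    by rewrite (_ : i.+1 = n) //; apply/eqP; rewrite eqn_leq ni ni'.
  by case: i ni lo => [//|k] _ _ /eqP; rewrite eqn_leq ltnn andbF.
have tr (X : {linear H -> H}) q (d : nat -> R) (f : R -> R) :
    f 0 = 0 -> (forall i, (i < n)%N -> X (e i) = (d i)%:C *: e i +
      (f (chain_t c q i))%:C *: e (chain_sg n q i)) ->
    family_trace n e X = (\sum_(i < n) d i)%:C.
  move=> f0 XEq; rewrite /family_trace rmorph_sum; apply: eq_bigr => i _.
  rewrite XEq // innerDl !innerZl !be.1 ?chain_sg_lt // eqxx mulr1.
  have [E|_] := eqVneq (chain_sg n q i) i; last by rewrite mulr0 addr0.
  by rewrite tfix // f0 mul0r addr0.
have z_rel l : (l == 0)%N || (z l != 0) -> z l ^+ 2 + sel (odd l) a0 a2 ^+ 2 -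
    sel (odd l) a1 a3 ^+ 2 = 2 * sel (odd l) a0 a2 * z l * c l.
  exact: chain_c_rel.
have c'E l : sel (odd l) a0 a2 * c l + sel (odd l) a1 a3 * c' l = z l.
  rewrite /c' /partner_coef /sel; case: (odd l).
    by rewrite [a3 * _]mulrC divfK ?gt_eqF // addrC subrK.
  by rewrite [a1 * _]mulrC divfK ?gt_eqF // addrC subrK.
(* Inserting [z = A c + B c'] into the relation turns it into [B^2 (c'^2 - 1) = A^2 (c^2 - 1)],
   symmetric in the two symmetries of the pair. *)
have c'n : c' n ^+ 2 = 1.
  have zn : z n != 0 by apply: z_nz; rewrite n0 leqnn.
  have := z_rel n; rewrite zn orbT => /(_ isT); rewrite -(c'E n).
  set A := sel _ a0 a2; set B := sel _ a1 a3 => E.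
  have B0 : B != 0 by rewrite /B /sel; case: (odd n); rewrite gt_eqF.
  have B2 : B ^+ 2 != 0 by rewrite expf_neq0.
  apply: (mulfI B2); rewrite mulr1.
  have : B ^+ 2 * c' n ^+ 2 - B ^+ 2 - A ^+ 2 * (c n ^+ 2 - 1) = 0.
    by move/eqP: E; rewrite -subr_eq0 => /eqP <-; ring.
  by rewrite cn subrr mulr0 subr0 => /eqP; rewrite subr_eq0 => /eqP.
have c'0 : - c' 0%N = v.
  have := c'E 0%N; rewrite /sel /= /c /chain_c /= /z /chain_z mul0r sub0r => E.
  have a1n : a1 != 0 by rewrite gt_eqF.
  apply: (mulfI a1n); rewrite mulrN; move/eqP: E; rewrite -subr_eq0 => /eqP E.
  by apply/eqP; rewrite -subr_eq0 -oppr_eq0; apply/eqP; rewrite -E; ring.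
have c00 : - c 0%N = u by rewrite /c /chain_c /= opprK.
have trj j : family_trace n e (fam4 X0 X1 X2 X3 j) =
    (fam4 (u + if odd n then 0 else c n) (v + if odd n then 0 else c' n)
          (if odd n then c n else 0) (if odd n then c' n else 0) j)%:C.
  have [F0 F1 F2 F3] := fam4E X0 X1 X2 X3.
  have [G0 G1 G2 G3] := fam4E (u + if odd n then 0 else c n)
    (v + if odd n then 0 else c' n) (if odd n then c n else 0) (if odd n then c' n else 0).
  have f0 (a b : R) : - (a * 0) / b = 0 by rewrite mulr0 oppr0 mul0r.
  move: j; apply: ord4P; rewrite ?F0 ?F1 ?F2 ?F3 ?G0 ?G1 ?G2 ?G3.
  - rewrite (tr _ false (chain_d c false) id) // chain_d_sum c00.
    by congr (_ + _)%:C; case: (odd n).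
  - rewrite (tr _ false (chain_d c' false) (fun t => - (a0 * t) / a1)) // chain_d_sum c'0.
    by congr (_ + _)%:C; case: (odd n).
  - rewrite (tr _ true (chain_d c true) id) // chain_d_sum add0r.
    by congr (_ %:C); case: (odd n).
  - rewrite (tr _ true (chain_d c' true) (fun t => - (a2 * t) / a3)) // chain_d_sum add0r.
    by congr (_ %:C); case: (odd n).
have last_lt : (n.-1 < n)%N by rewrite prednK.
have podd : odd n = ~~ odd n.-1 by rewrite -[in LHS](prednK n0).
have lastd (d : nat -> R) : chain_d d (odd n) n.-1 = d n.
  by rewrite podd /chain_d addbN addbb /= prednK.
have lastt : chain_t c (odd n) n.-1 = 0.
  by rewrite podd /chain_t addbN addbb /= prednK.
have endv : if odd n then joint_vector X2 X3 (c n) (c' n) else joint_vector X0 X1 (c n) (c' n).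
  have en1 : <|e n.-1, e n.-1|> = 1 by rewrite be.1 // eqxx.
  move: lastt (lastd c) (lastd c'); case: (odd n) => lt lc lc'; exists (e n.-1); split=> //.
  - by rewrite X2E // lt lc scale0r addr0.
  - by rewrite X3E // lt lc' mulr0 oppr0 mul0r scale0r addr0.
  - by rewrite XE // lt lc scale0r addr0.
  - by rewrite X1E // lt lc' mulr0 oppr0 mul0r scale0r addr0.
(* For [n = 1] the operator [X0] would be a scalar. For [n = 2] both [X0] and [X1] are diagonal with
   opposite signs at the two vertices, so [z 2 = - (a0 u + a1 v) = z 0], against [lam <> 0]. *)
have n3 : (3 <= n)%N.
  have ns0 b := nsX (inord 0) b; have ns1 b := nsX (inord 1) b.
  rewrite /fam4 inordK //= in ns0; rewrite /fam4 inordK //= in ns1.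
  have d0 d : chain_d d false 0 = - d 0%N by [].
  have t0 : chain_t c false 0 = 0 by [].
  have X0e0 : X0 (e 0%N) = u%:C *: e 0%N by rewrite XE // t0 d0 c00 scale0r addr0.
  have X1e0 : X1 (e 0%N) = v%:C *: e 0%N by [].
  rewrite ltnNge; apply/negP => n2.
  have [nE|nE] : n = 1%N \/ n = 2%N.
    by case: (n) n0 n2 => [|[|[|m]]] //; [left|right].
    by apply: (scalar_contra be ns0 u1) => i; rewrite nE ltnS leqn0 => /eqP->.
  have X0e1 : X0 (e 1%N) = (c n)%:C *: e 1%N.
    by have := XE n.-1 last_lt; have := lastd c; have := lastt; rewrite nE /= => -> ->;
      rewrite scale0r addr0.
  have X1e1 : X1 (e 1%N) = (c' n)%:C *: e 1%N.
    have := X1E n.-1 last_lt; have := lastd c'; have := lastt; rewrite nE /= => -> ->.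
    by rewrite mulr0 oppr0 mul0r scale0r addr0.
  have neq (X : {linear H -> H}) (s t : R) :
      (forall (b : bool), exists2 x, x != 0 & X x = (-1) ^+ b *: x) ->
      s ^+ 2 = 1 -> t ^+ 2 = 1 -> X (e 0%N) = s%:C *: e 0%N -> X (e 1%N) = t%:C *: e 1%N -> t = - s.
    move=> ns s1 t1 E0 E1; have := s1; rewrite -t1 => /eqP; rewrite eqf_sqr => /orP[/eqP st|/eqP ->]; last by rewrite opprK.
    case: (scalar_contra be ns s1) => i; rewrite nE; case: i => [|[|]] // _.
    by rewrite E1 st.
  have cnu := neq _ _ _ ns0 u1 cn X0e0 X0e1.
  have cnv := neq _ _ _ ns1 v1 c'n X1e0 X1e1.
  have := c'E n; rewrite cnu cnv nE /sel /= /z /chain_z => /eqP.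
  rewrite -subr_eq0 (_ : _ - _ = - (2 * lam)); last by ring.
  by rewrite oppr_eq0 mulf_eq0 pnatr_eq0 (negPf lam0).
have famE j i : (i < n)%N -> fam4 X0 X1 X2 X3 j (e i) =
    (chain_D a0 a1 a2 a3 lam u v j i)%:C *: e i +
    (chain_T a0 a1 a2 a3 lam u v j i)%:C *: e (chain_sg n (chain_q j) i).
  move=> ni; rewrite /chain_D /chain_T /chain_q.
  by move: j; apply: ord4P; rewrite /fam4 !inordK //=; [exact: XE|exact: X1E|exact: X2E|exact: X3E].
exists n, (c n), (c' n); split=> //.
split=> [l /andP[l0 ln]|]; last first.
  by rewrite -/z -c'E /sel; case: (odd n).
have zl : z l != 0 by apply: z_nz; rewrite l0 ltnW.
have rel := z_rel l; rewrite zl orbT in rel; have {}rel := rel isT.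
have cl := c_int l; rewrite l0 ln in cl; have {}cl := cl isT.
rewrite /link_open -/z.
(* Heron's formula: [(2 A z)^2 (1 - c^2)] is sixteen times the squared area of the triangle with
   sides [A], [B], [|z|]. As [A B > 0], the two factors of the product cannot both be negative. *)
have open A B : 0 < A -> 0 < B -> z l ^+ 2 + A ^+ 2 - B ^+ 2 = 2 * A * z l * c l ->
    (A - B) ^+ 2 < z l ^+ 2 /\ z l ^+ 2 < (A + B) ^+ 2.
  move=> A0 B0 E; have zl2 : 0 < z l ^+ 2 by rewrite exprn_even_gt0.
  have : 0 < (2 * A * z l) ^+ 2 * (1 - c l ^+ 2).
    by rewrite mulr_gt0 ?subr_gt0 // exprn_even_gt0 //= !mulf_neq0 ?pnatr_eq0 // gt_eqF.
  have -> : (2 * A * z l) ^+ 2 * (1 - c l ^+ 2) =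
     ((A + B) ^+ 2 - z l ^+ 2) * (z l ^+ 2 - (A - B) ^+ 2).
    by rewrite mulrBr mulr1 -exprMn -E; ring.
  have AB : 0 < (A + B) ^+ 2 - (A - B) ^+ 2.
    by rewrite (_ : _ - _ = 4 * A * B); [rewrite !mulr_gt0|ring].
  move: (z l ^+ 2) ((A + B) ^+ 2) ((A - B) ^+ 2) AB => Z P Q PQ.
  by move=> PQZ; split; rewrite ltNge; apply/negP => h; nra.
by case: (odd l) rel => rel; exact: open.
Qed.

End ChainForm.

Arguments trace1 {R} n d j.

Lemma klein0 d : klein d (inord 0) = d.
Proof. by move: d; apply: ord4P; rewrite /klein !inordK. Qed.

Lemma klein2_comm d j :
  klein (inord 2) (klein d j) = klein (klein (inord 2) d) j.
Proof. by move: d j; apply: ord4P; apply: ord4P; rewrite /klein !inordK. Qed.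

Section Classify.
Variables (R : realType) (H : hilbert R).
Local Notation "<| x , y |>" := (inner H x y) (format "<| x ,  y |>").
Implicit Types (X : 'I_4 -> {linear H -> H}) (a : 'I_4 -> R) (lam : R).

Definition start_family X a lam : Prop :=
  good_start (X (inord 0)) (X (inord 1)) (X (inord 2)) (X (inord 3))
    (a (inord 0)) (a (inord 1)) (a (inord 2)) (a (inord 3)) lam.

Lemma form_of_start X a lam :
  (forall j, 0 < a j) -> 0 < lam -> involution_system a lam X ->
  irreducible_family X -> nonscalar_family X -> start_family X a lam ->
  exists n e, orthobasis n e /\ (form0 n lam a X e \/ exists d, form1 n lam a X e d).
Proof.
move=> a_gt0 lam_gt0 sysX irrX nsX [u [v [e0 [u1 v1 e1 [Xe Ye] zker]]]].
rewrite -(fam4_eta X) in irrX nsX *; rewrite -(fam4_eta a) in sysX *.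
rewrite -(fam4_eta X) in sysX.
have A0 := a_gt0 (inord 0); have A1 := a_gt0 (inord 1).
have A2 := a_gt0 (inord 2); have A3 := a_gt0 (inord 3).
move: (X (inord 0)) (X (inord 1)) (X (inord 2)) (X (inord 3)) Xe Ye zker irrX nsX sysX
  => X0 X1 X2 X3 Xe Ye zker irrX nsX sysX.
move: (a (inord 0)) (a (inord 1)) (a (inord 2)) (a (inord 3)) A0 A1 A2 A3 zker sysX
  => a0 a1 a2 a3 A0 A1 A2 A3 zker sysX.
have [n [w [w' [n3 w1 w1' cond [be _ tr endv]]]]] :=
  chain_of_start A0 A1 A2 A3 lam_gt0 sysX irrX nsX u1 v1 e1 Xe Ye zker.
set e := chain_vec _ _ _ _ _ _ _ _ _ _ in be tr.
have startv : joint_vector X0 X1 u v by exists e0.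
have [F0 F1 F2 F3] := fam4E X0 X1 X2 X3.
have [G0 G1 G2 G3] := fam4E a0 a1 a2 a3.
exists n, e; split=> //.
have [[t0 [uE vE wE wE']]|] :=
  chain_classify A0 A1 A2 A3 lam_gt0 n3 u1 v1 w1 w1' cond.
  left; have on : odd n by case: t0 => -[].
  split; rewrite ?F0 ?F1 ?F2 ?F3 ?G0 ?G1 ?G2 ?G3 //.
  - move=> j; rewrite tr on uE vE wE wE' !addr0.
    by move: j; apply: ord4P; rewrite /fam4 inordK.
  - by rewrite uE vE in startv.
  - by rewrite on wE wE' in endv.
have klE (d j : nat) : (d < 4)%N -> (j < 4)%N -> klein (inord d) (inord j) =
    inord (nth 0%N (nth [::] [:: [:: 0; 1; 2; 3]; [:: 1; 0; 3; 2];
                             [:: 2; 3; 0; 1]; [:: 3; 2; 1; 0]] d) j)%N.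
  by move=> d4 j4; rewrite /klein !inordK.
have inordE (d j : nat) : (d < 4)%N -> (j < 4)%N -> ((inord d : 'I_4) == inord j) = (d == j).
  by move=> d4 j4; rewrite -(inj_eq val_inj) /= !inordK.
have trd d : (d < 4)%N ->
    u + (if odd n then 0 else w) = (if odd n then if d == 0%N then -1 else 1 else if d == 0%N then 2 else 0) ->
    v + (if odd n then 0 else w') = (if odd n then if d == 1%N then -1 else 1 else if d == 1%N then 2 else 0) ->
    (if odd n then w else 0) = (if odd n then if d == 2%N then -1 else 1 else if d == 2%N then 2 else 0) ->
    (if odd n then w' else 0) = (if odd n then if d == 3%N then -1 else 1 else if d == 3%N then 2 else 0) ->
    forall j, family_trace n e (fam4 X0 X1 X2 X3 j) = (trace1 n (inord d) j)%:C.
  move=> d4 E0 E1 E2 E3 j; rewrite tr; congr (_%:C); rewrite /trace1.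
  by move: j; apply: ord4P; rewrite inordE // eq_sym {1}/fam4 inordK.
case=> -[t1 sg]; right; [exists (inord 0)|exists (inord 1)|exists (inord 2)|exists (inord 3)];
  rewrite /form1 !klE //= ?F0 ?F1 ?F2 ?F3 ?G0 ?G1 ?G2 ?G3; split=> //.
- by apply: trd => //; case: (odd n) sg => [[uE vE wE wE']|[[uE vE wE wE']|[uE vE wE wE']]];
    rewrite ?uE ?vE ?wE ?wE' /=; ring.
- rewrite /small_vector; case: (odd n) sg endv => [[uE vE _ _] _|[[uE vE _ _] _|[_ _ -> ->]]] //.
  + by rewrite uE vE in startv.
  + by rewrite uE vE in startv.
- by apply: trd => //; case: (odd n) sg => [[uE vE wE wE']|[[uE vE wE wE']|[uE vE wE wE']]];
    rewrite ?uE ?vE ?wE ?wE' /=; ring.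
- rewrite /small_vector; case: (odd n) sg endv => [[uE vE _ _] _|[[uE vE _ _] _|[_ _ -> ->]]].
  + by move: startv; rewrite uE vE => -[x [x1 h1 h2]]; exists x.
  + by move: startv; rewrite uE vE => -[x [x1 h1 h2]]; exists x.
  + by move=> -[x [x1 h1 h2]]; exists x.
- by case: sg => on [uE vE wE wE']; apply: trd => //; rewrite on ?uE ?vE ?wE ?wE' /=; ring.
- by rewrite /small_vector; case: sg endv => -> [_ _ -> ->].
- by case: sg => on [uE vE wE wE']; apply: trd => //; rewrite on ?uE ?vE ?wE ?wE' /=; ring.
- by rewrite /small_vector; case: sg endv => -> [_ _ -> ->] -[x [x1 h1 h2]]; exists x.
Qed.

(** The start may be found in the second pair; relabelling by [klein (inord 2)] exchanges the pairs,
    and the resulting form is transported back. *)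
Theorem classify_family X a lam :
  (forall j, 0 < a j) -> 0 < lam -> involution_system a lam X ->
  irreducible_family X -> nonscalar_family X ->
  exists n e, orthobasis n e /\ (form0 n lam a X e \/ exists d, form1 n lam a X e d).
Proof.
move=> a_gt0 lam_gt0 sysX irrX nsX.
have lam0 : lam != 0 by rewrite gt_eqF.
have [st|st] : start_family X a lam \/
    start_family (fun j => X (klein (inord 2) j)) (fun j => a (klein (inord 2) j)) lam.
  have sysX' := sysX; rewrite -(fam4_eta X) -(fam4_eta a) in sysX'.
  have := start_exists (a_gt0 _) (a_gt0 _) (a_gt0 _) (a_gt0 _) lam0 sysX' irrX.1.
  by rewrite /start_family /klein !inordK.
  exact: form_of_start.
set k := klein (inord 2) in st *.
have kb : bijective k by exact: klein_bij.
have kK : involutive k by exact: kleinK.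
have [n [e [be fe]]] := form_of_start (fun j => a_gt0 (k j)) lam_gt0
  (involution_system_perm kb sysX) (irreducible_perm kb irrX) (nonscalar_perm k nsX) st.
have k0 : k (inord 0) = inord 2 by rewrite /k klein0.
have k1 : k (inord 1) = inord 3 by rewrite /k /klein !inordK.
have k2 : k (inord 2) = inord 0 by rewrite /k /klein !inordK.
have k3 : k (inord 3) = inord 1 by rewrite /k /klein !inordK.
exists n, e; split=> //; case: fe => [[t0 tr j1 j2]|[d [t1 tr sv]]].
  left; rewrite k0 k1 k2 k3 in t0 j1 j2; split=> //; last first.
    by move=> j; rewrite -(kK j) tr.
  case: t0 => h1 h2; split.
    case: h1 => n3 on ->; split=> //; ring.
  by move=> b; rewrite !inE => hb; apply: h2; rewrite !inE; move: hb => /or4P[]->; rewrite ?orbT.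
right; exists (k d); split.
- by rewrite /k -!klein2_comm.
- by move=> j; rewrite -[in LHS](kK j) tr /trace1 (can2_eq kK kK).
- by move: sv; rewrite /k !klein2_comm.
Qed.

End Classify.

(** * Canonical matrix entries *)

Section NonvanishingProgression.
Variables (R : realType) (a0 a1 a2 a3 lam : R).
Hypotheses (a0_gt0 : 0 < a0) (a1_gt0 : 0 < a1) (a2_gt0 : 0 < a2) (a3_gt0 : 0 < a3).
Hypothesis lam_gt0 : 0 < lam.

(** If [a0 + a1 = l lam], the middle bounds squeeze [n] to [2 l], against its parity. *)
Lemma type0_chain_z_neq0 n l : type0 n lam a0 a1 a2 a3 ->
  chain_z a0 a1 lam 1 1 l != 0.
Proof.
move=> [[n3 on nlam] cond]; rewrite /chain_z !mulr1 subr_eq0; apply/eqP => El.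
have mem (P : R -> Prop) : (forall b, b \in [:: a0; a1; a2; a3] -> P b) ->
    [/\ P a0, P a1, P a2 & P a3].
  by move=> h; split; apply: h; rewrite !inE eqxx ?orbT.
have [c0 c1 c2 c3] := mem _ cond.
have lt_of (x y : nat) : x%:R * lam < y%:R * lam -> (x < y)%N.
  by rewrite ltr_pM2r // ltr_nat.
have [ln1 ln2] : (2 * l < n.+1)%N /\ (n < (2 * l).+1)%N.
  have c : [/\ 4 * a0 + 4 * a1 = (4 * l)%:R * lam, 4 * a2 + 4 * a3 = 4 * (n%:R * lam) - (4 * l)%:R * lam &
      (n.+1)%:R * lam = n%:R * lam + lam].
    split; [rewrite natrM -mulrA El; ring|rewrite natrM -mulrA El nlam; ring|by rewrite -natr1 mulrDl mul1r].
  case: c => E1 E2 E3.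
  have lM : (4 * l)%:R * lam = 2 * ((2 * l)%:R * lam) by rewrite !natrM; ring.
  have lS : ((2 * l).+1)%:R * lam = (2 * l)%:R * lam + lam by rewrite -natr1 mulrDl mul1r.
  split; apply: lt_of; rewrite ?E3 ?lS; move: E1 E2; rewrite lM;
    move: ((2 * l)%:R * lam) => L; move: c0 c1 c2 c3;
    case: (odd n./2); rewrite ?mulrDl ?mulrBl ?mul1r; move: (n%:R * lam) => N c0 c1 c2 c3 E1 E2; lra.
have nl : n = (2 * l)%N by apply/eqP; rewrite eqn_leq -ltnS ln2 -ltnS ln1.
by move: on; rewrite nl oddM.
Qed.

(** Already [z 1] is positive, and [z] increases. *)
Lemma type1_chain_z_neq0 n l : type1 n lam a0 a1 a2 a3 -> (0 < l)%N ->
  chain_z a0 a1 lam (if odd n then -1 else 1) (- if odd n then -1 else 1) l != 0.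
Proof.
move=> [n3 cond] l0; set u := (if odd n then -1 else 1 : R).
have mem (P : R -> Prop) : (forall b, b \in [:: a1; a2; a3] -> P b) ->
    [/\ P a1, P a2 & P a3].
  by move=> h; split; apply: h; rewrite !inE eqxx ?orbT.
have h1 : chain_z a0 a1 lam u (- u) 1 <= chain_z a0 a1 lam u (- u) l by exact: chain_z_le.
have := (a0_gt0, a1_gt0, a2_gt0, a3_gt0, lam_gt0) => -[[[[p0 p1] p2] p3] pl].
suff h : 0 < chain_z a0 a1 lam u (- u) 1 by rewrite gt_eqF // (lt_le_trans h).
rewrite /chain_z /u mul1r {h1 u}.
by case: (odd n) cond => -[nlam /mem[c1 c2 c3]];
  move: (n%:R : R) nlam c1 c2 c3 => N nlam c1 c2 c3; lra.
Qed.

End NonvanishingProgression.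

Section CanonicalForm.
Variables (R : realType).
Implicit Types (a : 'I_4 -> R) (lam : R).

Definition chain_entry (a : 'I_4 -> R) lam u v n (j : 'I_4) (i k : nat) : R[i] :=
  let D := chain_D (a (inord 0)) (a (inord 1)) (a (inord 2)) (a (inord 3)) lam u v in
  let T := chain_T (a (inord 0)) (a (inord 1)) (a (inord 2)) (a (inord 3)) lam u v in
  (D j i)%:C *+ (k == i) + (T j i)%:C *+ (k == chain_sg n (chain_q j) i).

Definition entry0 n lam a := chain_entry a lam 1 1 n.

Definition entry1 n lam a d j :=
  let u : R := if odd n then -1 else 1 in
  chain_entry (fun j => a (klein d j)) lam u (- u) n (klein d j).

Variable (H : hilbert R).
Implicit Types X : 'I_4 -> {linear H -> H}.
Local Notation "<| x , y |>" := (inner H x y) (format "<| x ,  y |>").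

(** The chain is grown again from a prescribed joint eigenvector; its length agrees with [n0],
    because both are the dimension of [H]. *)
Lemma entry_of_start X a lam n0 (e : nat -> H) u v :
  (forall j, 0 < a j) -> 0 < lam -> involution_system a lam X ->
  irreducible_family X -> nonscalar_family X -> orthobasis n0 e ->
  u ^+ 2 = 1 -> v ^+ 2 = 1 -> joint_vector (X (inord 0)) (X (inord 1)) u v ->
  (forall l, (0 < l)%N -> chain_z (a (inord 0)) (a (inord 1)) lam u v l != 0) ->
  exists2 e', orthobasis n0 e' & forall j i, (i < n0)%N ->
    X j (e' i) = \sum_(k < n0) chain_entry a lam u v n0 j i k *: e' k.
Proof.
move=> a_gt0 lam_gt0 sysX irrX nsX be u1 v1 [x [x1 Xx Yx]] z0.
have sysX' := sysX; rewrite -(fam4_eta X) -(fam4_eta a) in sysX'.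
have irrX' := irrX; rewrite -(fam4_eta X) in irrX'.
have nsX' := nsX; rewrite -(fam4_eta X) in nsX'.
have [|n [w [w' [_ _ _ _ [be' XE _ _]]]]] := chain_of_start (a_gt0 _) (a_gt0 _) (a_gt0 _) (a_gt0 _)
  lam_gt0 sysX' irrX' nsX' u1 v1 x1 Xx Yx.
  by move=> l y l0 E; have := z0 l l0; rewrite E eqxx.
move: (chain_vec _ _ _ _ _ _ _ _ _ _) be' XE => e' be' XE.
have nE : n = n0.
  have [+ _] := has_dim_setT (Some n) be; rewrite (has_dim_setT (Some n) be').
  by move=> /(_ erefl) [].
rewrite nE {n nE} in be' XE; exists e' => // j i ni.
have := XE j i ni; rewrite fam4_eta => ->.
have pick (s : R[i]) (m : nat) : (m < n0)%N -> \sum_(k < n0) (s *+ (k == m :> nat)) *: e' k = s *: e' m.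
  move=> mn; rewrite (bigD1 (Ordinal mn)) //= eqxx mulr1n big1 ?addr0 // => k.
  by rewrite -(inj_eq val_inj) /= => /negPf ->; rewrite mulr0n scale0r.
rewrite /chain_entry; under [RHS]eq_bigr do rewrite scalerDl.
by rewrite big_split /= !pick // chain_sg_lt.
Qed.

Lemma form0_entry X a lam n (e : nat -> H) :
  (forall j, 0 < a j) -> 0 < lam -> involution_system a lam X ->
  irreducible_family X -> nonscalar_family X -> orthobasis n e ->
  form0 n lam a X e ->
  exists2 e', orthobasis n e' & forall j i, (i < n)%N ->
    X j (e' i) = \sum_(k < n) entry0 n lam a j i k *: e' k.
Proof.
move=> a_gt0 lam_gt0 sysX irrX nsX be [t0 _ jv _].
apply: (entry_of_start a_gt0 lam_gt0 sysX irrX nsX be) => //; rewrite ?expr1n //.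
move=> l _; exact: (type0_chain_z_neq0 lam_gt0 _ t0).
Qed.

Lemma form1_entry X a lam n (e : nat -> H) d :
  (forall j, 0 < a j) -> 0 < lam -> involution_system a lam X ->
  irreducible_family X -> nonscalar_family X -> orthobasis n e ->
  form1 n lam a X e d ->
  exists2 e', orthobasis n e' & forall j i, (i < n)%N ->
    X j (e' i) = \sum_(k < n) entry1 n lam a d j i k *: e' k.
Proof.
move=> a_gt0 lam_gt0 sysX irrX nsX be [t1 _ sv].
have kb := klein_bij d; set u : R := if odd n then -1 else 1.
have u1 : u ^+ 2 = 1 by rewrite /u; case: (odd n); rewrite ?sqrrN expr1n.
have v1 : (- u) ^+ 2 = 1 by rewrite sqrrN.
have jv : joint_vector (X (klein d (inord 0))) (X (klein d (inord 1))) u (- u).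
  by rewrite klein0; move: sv; rewrite /small_vector /u; case: (odd n); rewrite ?opprK.
have z0 l : (0 < l)%N -> chain_z (a (klein d (inord 0))) (a (klein d (inord 1))) lam u (- u) l != 0.
  exact: (type1_chain_z_neq0 (a_gt0 _) (a_gt0 _) (a_gt0 _) (a_gt0 _) lam_gt0 t1).
have [e' be' XE] := entry_of_start (fun j => a_gt0 (klein d j)) lam_gt0
  (involution_system_perm kb sysX) (irreducible_perm kb irrX)
  (nonscalar_perm (klein d) nsX) be u1 v1 jv z0.
exists e' => // j i ni; have := XE (klein d j) i ni.
by rewrite kleinK.
Qed.

End CanonicalForm.

(** * Existence of systems of each form *)

Section ChainExistence.
Variable R : realType.
Implicit Types (lam u v w : R).

Lemma chain_exists (a0 a1 a2 a3 lam u v w w' : R) n :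
  0 < a0 -> 0 < a1 -> 0 < a2 -> 0 < a3 -> lam != 0 -> (3 <= n)%N ->
  u ^+ 2 = 1 -> v ^+ 2 = 1 -> w ^+ 2 = 1 -> w' ^+ 2 = 1 ->
  chain_cond n a0 a1 a2 a3 lam u v w w' ->
  (forall l, (0 < l)%N -> chain_z a0 a1 lam u v l != 0) ->
  exists (H : hilbert R) (X : 'I_4 -> {linear H -> H}) (e : nat -> H),
  [/\ involution_system (fam4 a0 a1 a2 a3) lam X, irreducible_family X,
      nonscalar_family X, orthobasis n e &
   forall j, family_trace n e (X j) =
   (fam4 (u + if odd n then 0 else w) (v + if odd n then 0 else w')
         (if odd n then w else 0) (if odd n then w' else 0) j)%:C].
Proof.
move=> a0p a1p a2p a3p lam0 n3 u1 v1 w1 w'1 [op zn] zN0.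
case: n n3 op zn => // N n3 op zn; set n := N.+1 in n3 op zn *.
pose z := chain_z a0 a1 lam u v; pose c := chain_c a0 a1 a2 a3 lam u v.
have zrel l : z l ^+ 2 + (if odd l then a2 else a0) ^+ 2 - (if odd l then a3 else a1) ^+ 2 =
  2 * (if odd l then a2 else a0) * z l * c l.
  by apply: chain_c_rel => //; case: l => [|l] //=; rewrite zN0.
have zS i : z i.+1 = z i + lam by rewrite /z /chain_z -natr1; ring.
have c0 : c 0%N = - u by [].
(* With [z n = A w + B w'] and [w], [w'] signs, the law of cosines at link [n] reduces to
   [2 A z c = 2 A z w]. *)
have cn : c n = w.
  have zn0 : z n != 0 by exact: zN0.
  have := zrel n; rewrite -/(z n) in zn; set A := if _ then a2 else a0; set B := if _ then a3 else a1.
  have A0 : 0 < A by rewrite /A; case: ifP.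
  have znE : z n = A * w + B * w' by rewrite zn /A /B; case: ifP.
  have -> : z n ^+ 2 + A ^+ 2 - B ^+ 2 = 2 * A * z n * w + (A ^+ 2) * (1 - w ^+ 2) + B ^+ 2 * (w' ^+ 2 - 1).
    by rewrite znE; ring.
  rewrite w1 w'1 !subrr !mulr0 !addr0 => /mulfI -> //.
  by rewrite !mulf_neq0 ?pnatr_eq0 // gt_eqF.
pose c' := partner_coef a0 a1 a2 a3 c z.
have c'n : c' n = w'.
  rewrite /c' /partner_coef cn {1 2}/z zn; case: (odd n).
    by rewrite [a2 * w]mulrC addrAC subrr add0r mulrC mulKf // gt_eqF.
  by rewrite [a0 * w]mulrC addrAC subrr add0r mulrC mulKf // gt_eqF.
have c'0 : c' 0%N = - v.
  rewrite /c' /partner_coef c0 /= /z /chain_z mul0r.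
  by field; rewrite gt_eqF.
have cint l : (0 < l < n)%N -> c l ^+ 2 < 1.
  move=> ln; have l0 : (0 < l)%N by case/andP: ln.
  have zl : z l != 0 by exact: zN0.
  have := op l ln; rewrite /link_open -/(z l) => opl.
  have := zrel l; set A := if _ then a2 else a0; set B := if _ then a3 else a1 => E.
  have A0 : 0 < A by rewrite /A; case: ifP.
  have [lo hi] : (A - B) ^+ 2 < z l ^+ 2 /\ z l ^+ 2 < (A + B) ^+ 2.
    by move: opl; rewrite /A /B; case: (odd l).
  have P : 0 < (2 * A * z l) ^+ 2.
    by rewrite exprn_even_gt0 //= !mulf_neq0 ?pnatr_eq0 // gt_eqF.
  rewrite -subr_gt0 -(pmulr_rgt0 _ P).
  have -> : (2 * A * z l) ^+ 2 * (1 - c l ^+ 2) =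
     ((A + B) ^+ 2 - z l ^+ 2) * (z l ^+ 2 - (A - B) ^+ 2).
    by rewrite mulrBr mulr1 -exprMn -E; ring.
  by rewrite mulr_gt0 // subr_gt0.
have zint l : (0 < l < n)%N -> z l != 0 by case/andP => l0 _; exact: zN0.
have c01 : c 0%N ^+ 2 = 1 by rewrite c0 sqrrN.
have cn1 : c n ^+ 2 = 1 by rewrite cn.
have [H [X [e [sysX irrX nsX be tr]]]] :=
  @chain_system_exists R N a0 a1 a2 a3 lam c z a0p a1p a2p a3p lam0 zS (fun l _ => zrel l)
    c01 cn1 cint zint n3.
exists H, X, e; split=> // j; rewrite /family_trace tr.
congr (_ %:C); rewrite -/c' -/n !chain_d_sum c0 cn c'0 c'n !opprK.
by case: (odd n); rewrite /= ?add0r ?addr0.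
Qed.

Lemma form0_exists (a : 'I_4 -> R) lam n : (forall j, 0 < a j) -> 0 < lam ->
  type0 n lam (a (inord 0)) (a (inord 1)) (a (inord 2)) (a (inord 3)) ->
  exists (H : hilbert R) (X : 'I_4 -> {linear H -> H}) (e : nat -> H),
  [/\ involution_system a lam X, irreducible_family X,
      nonscalar_family X, orthobasis n e & forall j, family_trace n e (X j) = 1].
Proof.
move=> ap lp t0; have [[n3 on _] _] := t0.
have z0 l : (0 < l)%N -> chain_z (a (inord 0)) (a (inord 1)) lam 1 1 l != 0.
  by move=> _; exact: (type0_chain_z_neq0 lp _ t0).
have s1 : (1 : R) ^+ 2 = 1 by rewrite expr1n.
have [H [X [e [sysX irrX nsX be tr]]]] := chain_exists (ap _) (ap _) (ap _) (ap _)
  (lt0r_neq0 lp) n3 s1 s1 s1 s1 (type0_chain lp t0) z0.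
rewrite fam4_eta in sysX; exists H, X, e; split=> // j.
by rewrite tr on !addr0; move: j; apply: ord4P; rewrite /fam4 inordK.
Qed.

Lemma form1_exists (a : 'I_4 -> R) lam n d : (forall j, 0 < a j) -> 0 < lam ->
  (let k := klein d in
   type1 n lam (a (k (inord 0))) (a (k (inord 1))) (a (k (inord 2))) (a (k (inord 3)))) ->
  exists (H : hilbert R) (X : 'I_4 -> {linear H -> H}) (e : nat -> H),
  [/\ involution_system a lam X, irreducible_family X,
      nonscalar_family X, orthobasis n e &
      forall j, family_trace n e (X j) = (trace1 n d j)%:C].
Proof.
move=> ap lp t1; have [n3 _] := t1; set k := klein d in t1.
set u : R := if odd n then -1 else 1.
have z0 l : (0 < l)%N -> chain_z (a (k (inord 0))) (a (k (inord 1))) lam u (- u) l != 0.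
  exact: (type1_chain_z_neq0 (ap _) (ap _) (ap _) (ap _) lp t1).
have s1 : (1 : R) ^+ 2 = 1 by rewrite expr1n.
have u1 : u ^+ 2 = 1 by rewrite /u; case: (odd n); rewrite ?sqrrN expr1n.
have v1 : (- u) ^+ 2 = 1 by rewrite sqrrN.
have [H [X [e [sysX irrX nsX be tr]]]] := chain_exists (ap _) (ap _) (ap _) (ap _)
  (lt0r_neq0 lp) n3 u1 v1 s1 s1 (type1_chain (ap _) (ap _) (ap _) (ap _) lp t1) z0.
rewrite (fam4_eta (fun j => a (k j))) in sysX.
have kb := klein_bij d.
exists H, (fun j => X (k j)), e; split=> //.
- have := involution_system_perm kb sysX.
  by rewrite (_ : (fun j => a (k (k j))) = a) //; apply/funext => j; rewrite /k kleinK.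
- exact: irreducible_perm.
- move=> j; rewrite tr; congr (_%:C).
  have trE i : fam4 (u + (if odd n then 0 else 1)) (- u + (if odd n then 0 else 1))
    (if odd n then 1 else 0) (if odd n then 1 else 0) i = trace1 n (inord 0) i.
    rewrite /trace1 /u; case: (odd n); move: i; apply: ord4P; rewrite /fam4 !inordK //= -(inj_eq val_inj) /= !inordK //=; lra.
  rewrite trE /trace1.
  have -> : (k j == inord 0) = (j == d) => //.
  by rewrite -(klein0 d) (can2_eq (kleinK d) (kleinK d)).
Qed.

End ChainExistence.

(** * Negative sums, and representations described by forms *)

Section SignChange.
Variables (R : realType) (H : hilbert R).
Implicit Types (X : 'I_4 -> {linear H -> H}) (b : bool).

Definition signed_family (b : bool) X (j : 'I_4) : {linear H -> H} :=
  ((-1) ^+ b : R[i]) \*: X j.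

Lemma signed_familyE b X j x : signed_family b X j x = (-1) ^+ b *: X j x.
Proof. by []. Qed.

Lemma signed_familyK b X j x :
  signed_family b (signed_family b X) j x = X j x.
Proof. by rewrite !signed_familyE scalerA -signr_addb addbb scale1r. Qed.

Lemma signed_system b a lam X : involution_system a lam X ->
  involution_system a ((-1) ^+ b * lam) (signed_family b X).
Proof.
move=> [XX Xsa Xsum]; split.
- by move=> j x; rewrite !signed_familyE linearZ /= XX scalerA -signr_addb addbb scale1r.
- by move=> j x y; rewrite !signed_familyE innerZl innerZr Xsa; case: b; rewrite /= ?expr1 ?expr0 ?rmorphN1 ?rmorph1.
- move=> x; rewrite rmorphM rmorph_sign -scalerA -Xsum scaler_sumr.
  by apply: eq_bigr => j _; rewrite signed_familyE !scalerA mulrC.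
Qed.

Lemma signed_irreducible b X : irreducible_family X ->
  irreducible_family (signed_family b X).
Proof.
move=> [x0 irr]; split=> // S linS clS Sinv; apply: irr => // j x Sx.
rewrite -(signed_familyK b) signed_familyE -[_ *: _]addr0.
by apply: linS.2; [exact: Sinv|exact: linS.1].
Qed.

Lemma signed_nonscalar b X : nonscalar_family X ->
  nonscalar_family (signed_family b X).
Proof.
move=> ns j c; have [x x0 Xx] := ns j (b (+) c); exists x => //.
by rewrite signed_familyE Xx scalerA -signr_addb addbA addbb.
Qed.

Lemma signed_trace b X n e j :
  family_trace n e (signed_family b X j) = (-1) ^+ b * family_trace n e (X j).
Proof.
rewrite /family_trace mulr_sumr; apply: eq_bigr => i _.
by rewrite signed_familyE innerZl.
Qed.

End SignChange.

Section Forms.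
Variable R : realType.
Implicit Types (a : 'I_4 -> R) (lam : R) (f : option 'I_4) (v : 'cV[option nat]_5).

(* [None] stands for the form with all traces equal to 1, [Some d] for the form
   in which the index [d] is distinguished. *)
Definition form_type n lam a f : Prop :=
  if f is Some d then
    let k := klein d in
    type1 n lam (a (k (inord 0))) (a (k (inord 1))) (a (k (inord 2))) (a (k (inord 3)))
  else type0 n lam (a (inord 0)) (a (inord 1)) (a (inord 2)) (a (inord 3)).

Definition form_trace n f j : R := if f is Some d then trace1 n d j else 1.

Definition form_entry n lam a f : 'I_4 -> nat -> nat -> R[i] :=
  if f is Some d then entry1 n lam a d else entry0 n lam a.

Definition trace_vector n (t : 'I_4 -> R) v : Prop :=
  v ord_max ord0 = Some n /\
  forall j, exists2 r, v (first4 j) ord0 = Some r & 2 * r%:R = n%:R + t j.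

Lemma form_type_ge3 n lam a f : form_type n lam a f -> (3 <= n)%N.
Proof. by case: f => [d|] [] // []. Qed.

(** The traces are 1 throughout, or they single out [d]: -1 among ones for odd [n], 2 among zeros
    for even [n]. *)
Lemma form_trace_inj n f f' : (0 < n)%N -> form_trace n f =1 form_trace n f' -> f = f'.
Proof.
have two1 : (2 == 1 :> R) = false by apply/eqP; lra.
have two0 : (2 == 0 :> R) = false by apply/eqP; lra.
have n11 : (-1 == 1 :> R) = false by apply/eqP; lra.
move=> n0; case: f f' => [d|] [d'|] //= E.
- have := E d; rewrite /form_trace /trace1 eqxx; case: (odd n).
    by case: eqP => [->//|_ /eqP]; rewrite n11.
  by case: eqP => [->//|_ /eqP]; rewrite two0.
- by have := E d; rewrite /form_trace /trace1 eqxx; case: (odd n) => /eqP; rewrite ?n11 ?two1.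
- by have := E d'; rewrite /form_trace /trace1 eqxx; case: (odd n) => /esym/eqP; rewrite ?n11 ?two1.
Qed.

Lemma trace_vector_inj n n' t t' v : trace_vector n t v -> trace_vector n' t' v ->
  n = n' /\ t =1 t'.
Proof.
rewrite /trace_vector => -[-> vE] [[nn'] vE']; split=> // j.
have [r vr rE] := vE j; have [r'] := vE' j; rewrite vr => -[<-].
by rewrite rE nn' => /addrI.
Qed.

Variables (chi : 'cV[R]_5).
Let a j := chi (first4 j) ord0.
Let lam := 2 * chi ord_max ord0 - \sum_j a j.
Hypothesis a_gt0 : forall j, 0 < a j.
Hypothesis lam_neq0 : lam != 0.
Let b := lam < 0.

Let lam_norm : (-1) ^+ b * lam = `|lam|.
Proof. by rewrite mulr_sign /b; case: ltrgt0P lam_neq0. Qed.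

Let norm_gt0 : 0 < `|lam|.
Proof. by rewrite normr_gt0. Qed.

Lemma rep_form (H : hilbert R) (pi : star_rep chi H) :
  irreducible_rep pi -> nondegenerate_rep pi ->
  exists n e f, [/\ orthobasis n e, form_type n `|lam| a f,
    forall j, family_trace n e (rep_symmetry pi j) = ((-1) ^+ b * form_trace n f j)%:C &
    exists2 e', orthobasis n e' & forall j i, (i < n)%N ->
      rep_symmetry pi j (e' i) =
      \sum_(k < n) ((-1) ^+ b * form_entry n `|lam| a f j i k) *: e' k].
Proof.
move=> /(rep_irreducible a_gt0) irr /(rep_nonscalar pi a_gt0) ns.
have sys := rep_system pi a_gt0.
have := signed_system b sys; rewrite lam_norm => sys'.
have irr' := signed_irreducible b irr; have ns' := signed_nonscalar b ns.
have [n [e [be fo]]] := classify_family a_gt0 norm_gt0 sys' irr' ns'.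
have undo j x : rep_symmetry pi j x = (-1) ^+ b *: signed_family b (rep_symmetry pi) j x.
  by rewrite -{1}(signed_familyK b).
have trE (X : 'I_4 -> {linear H -> H}) j :
  family_trace n e (X j) = (-1) ^+ b * family_trace n e (signed_family b X j).
  by rewrite signed_trace mulrA -signr_addb addbb mul1r.
have entE M e' : (forall j i, (i < n)%N -> signed_family b (rep_symmetry pi) j (e' i) =
    \sum_(k < n) M j i k *: e' k) -> forall j i, (i < n)%N -> rep_symmetry pi j (e' i) =
    \sum_(k < n) ((-1) ^+ b * M j i k) *: e' k.
  move=> h j i ni; rewrite undo h // scaler_sumr.
  by apply: eq_bigr => k _; rewrite scalerA.
case: fo => [f0|[d f1]].
  have [e' be' eE] := form0_entry a_gt0 norm_gt0 sys' irr' ns' be f0.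
  have [t0 tr _ _] := f0.
  exists n, e, None; split=> //.
    by move=> j; rewrite trE tr /= !mulr1 rmorph_sign.
  by exists e' => //; exact: entE.
have [e' be' eE] := form1_entry a_gt0 norm_gt0 sys' irr' ns' be f1.
have [t1 tr _] := f1.
exists n, e, (Some d); split=> //.
  by move=> j; rewrite trE tr /= rmorphM rmorph_sign.
by exists e' => //; exact: entE.
Qed.

Lemma gendim_trace_vector (H : hilbert R) (pi : star_rep chi H) n e t v :
  orthobasis n e -> (forall j, family_trace n e (rep_symmetry pi j) = (t j)%:C) ->
  has_gendim pi v <-> trace_vector n t v.
Proof.
move=> be tr; rewrite (rep_gendim pi a_gt0 v be) /trace_vector.
have eqC r j : (2 * r%:R = n%:R + \sum_(i < n) inner H (rep_symmetry pi j (e i)) (e i)) <->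
    (2 * r%:R = n%:R + t j).
  have -> : \sum_(i < n) inner H (rep_symmetry pi j (e i)) (e i) = (t j)%:C by rewrite -tr.
  rewrite -!(rmorph_nat (real_complex R)) -rmorphM -rmorphD.
  by split=> [/complexI|->].
by split=> -[vn vE]; split=> // j; have [r vr /eqC rE] := vE j; exists r.
Qed.

Lemma rep_exists_iff v :
  (exists (H : hilbert R) (pi : star_rep chi H),
     [/\ irreducible_rep pi, nondegenerate_rep pi & has_gendim pi v]) <->
  exists n f, form_type n `|lam| a f /\
    trace_vector n (fun j => (-1) ^+ b * form_trace n f j) v.
Proof.
split=> [[H [pi [irr nd gd]]]|[n [f [ft tv]]]].
  have [n [e [f [be ft tr _]]]] := rep_form irr nd.
  by exists n, f; split=> //; apply/(gendim_trace_vector v be tr).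
have [H [X [e [sysX irrX nsX be tr]]]] : exists (H : hilbert R) (X : 'I_4 -> {linear H -> H}) (e : nat -> H),
  [/\ involution_system a `|lam| X, irreducible_family X,
      nonscalar_family X, orthobasis n e &
      forall j, family_trace n e (X j) = (form_trace n f j)%:C].
  by case: f ft tv => [d|] /= ft _; [exact: form1_exists|exact: form0_exists].
have := signed_system b sysX; rewrite -lam_norm mulrA -signr_addb addbb mul1r => sys'.
have [pi piX] := rep_of_system a_gt0 sys'.
exists H, pi; split.
- by apply: (irreducible_rep_of_family piX); exact: signed_irreducible.
- apply/(rep_nonscalar pi a_gt0) => j c.
  by have [x x0 Xx] := signed_nonscalar b nsX j c; exists x => //; rewrite piX.
- have trpi j : family_trace n e (rep_symmetry pi j) = ((-1) ^+ b * form_trace n f j)%:C.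
    rewrite rmorphM rmorph_sign /= -tr -signed_trace.
    by apply: eq_bigr => i _; rewrite piX.
  exact/(gendim_trace_vector v be trpi).
Qed.

(** The generalized dimension determines [n] and the traces, these determine the form, and the form
    determines the matrices in the canonical basis. *)
Lemma rep_unique v (H1 H2 : hilbert R) (pi1 : star_rep chi H1) (pi2 : star_rep chi H2) :
  irreducible_rep pi1 -> nondegenerate_rep pi1 -> has_gendim pi1 v ->
  irreducible_rep pi2 -> nondegenerate_rep pi2 -> has_gendim pi2 v ->
  unitarily_equivalent pi1 pi2.
Proof.
move=> irr1 nd1 gd1 irr2 nd2 gd2.
have [n [e [f [be ft tr [e1 be1 E1]]]]] := rep_form irr1 nd1.
have [n' [e' [f' [be' ft' tr' [e2 be2 E2]]]]] := rep_form irr2 nd2.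
have tv := (gendim_trace_vector v be tr).1 gd1.
have tv' := (gendim_trace_vector v be' tr').1 gd2.
have [nn tt] := trace_vector_inj tv tv'; subst n'.
have ff : f = f'.
  apply: (@form_trace_inj n); first exact: leq_trans (form_type_ge3 ft).
  by move=> j; have /mulfI := tt j; apply; rewrite signr_eq0.
subst f'.
pose M j i k := (-1) ^+ b * form_entry n `|lam| a f j i k.
exact: (unitary_of_bases (M := M) a_gt0 be1 be2 E1 E2).
Qed.

End Forms.

(** * Roots and matrices *)

Section RootMatrices.
Variable R : realType.
Implicit Types (x y g L : R).

Lemma mx_of_rows_vec (s : seq (seq int)) y1 y2 y3 y4 y0 :
  mx_of_rows R s *m vec [:: y1; y2; y3; y4; y0] =
  vec [seq (nth (0 : int) r 0)%:~R * y1 + (nth (0 : int) r 1)%:~R * y2 + (nth (0 : int) r 2)%:~R * y3 + (nth (0 : int) r 3)%:~R * y4 + (nth (0 : int) r 4)%:~R * y0 |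
    r <- mkseq (nth [::] s) 5].
Proof.
apply/matrixP => i j; rewrite !mxE (nth_map [::]) ?size_mkseq // nth_mkseq //.
by rewrite !big_ord_recl big_ord0 addr0 !mxE /= !addrA.
Qed.

Lemma Cblack_vec y1 y2 y3 y4 y0 :
  Cblack R *m vec [:: y1; y2; y3; y4; y0] = vec [:: y1; y2; y3; y4; y1 + y2 + y3 + y4 - y0].
Proof. by rewrite mx_of_rows_vec /=; congr vec; do 5?[congr (_ :: _)]; ring. Qed.

Lemma Cox_vec y1 y2 y3 y4 y0 :
  Cox R *m vec [:: y1; y2; y3; y4; y0] =
  vec [:: y0 - y1; y0 - y2; y0 - y3; y0 - y4; y0 + (2 * y0 - (y1 + y2 + y3 + y4))].
Proof.
rewrite -mulmxA mx_of_rows_vec /= mx_of_rows_vec /=.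
by congr vec; do 5?[congr (_ :: _)]; ring.
Qed.

Lemma D15_vec y1 y2 y3 y4 y0 : let L := 2 * y0 - (y1 + y2 + y3 + y4) in
  D15 R *m vec [:: y1; y2; y3; y4; y0] =
  vec [:: y0 - y1 + L; L + y2; L + y3; L + y4; 2 * (y0 - y1) + L].
Proof. by rewrite mx_of_rows_vec /=; congr vec; do 5?[congr (_ :: _)]; ring. Qed.

(* [L = 2 y0 - (y1 + y2 + y3 + y4)] is invariant under the Coxeter map. *)
Lemma Cox_exp_vec s y1 y2 y3 y4 y0 : let L := 2 * y0 - (y1 + y2 + y3 + y4) in
  let f y := (if odd s then y0 - y else y) + s./2%:R * L in
  Cox R ^+ s *m vec [:: y1; y2; y3; y4; y0] =
  vec [:: f y1; f y2; f y3; f y4; y0 + s%:R * L].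
Proof.
move=> L; elim: s => [|s IHs] f.
  by rewrite expr0 mul1mx /f /= !mul0r !addr0.
rewrite exprS -mulmxA {}IHs Cox_vec /f /= uphalf_half.
have S2 : (s%:R : R) = (odd s)%:R + 2 * s./2%:R.
  by rewrite -{1}(odd_double_half s) natrD -mul2n natrM.
rewrite natrD -[s.+1%:R]natr1 {}S2; move: (s./2%:R : R) => h.
by case: (odd s) => /=; congr vec; do 5?[congr (_ :: _)]; rewrite /L /= ?mulr1n ?mulr0n; ring.
Qed.

Lemma coord_posE (t : 'I_5) : coord_pos t = (if t == 0%N :> nat then 4 else t.-1) :> nat.
Proof. by case: t => [[|[|[|[|[|t]]]]]]. Qed.

Lemma ge_at1_vec (z1 z2 z3 z4 z0 : R) (t : 'I_5) : t = 1%N :> nat ->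
  ge_at t (vec [:: z1; z2; z3; z4; z0]) <->
  [/\ z1 = 0, 0 < z2, 0 < z3, 0 < z4 & 0 < z0].
Proof.
move=> t1; rewrite /ge_at mxE coord_posE t1 /=.
split=> [[-> h]|[-> h2 h3 h4 h0]]; last first.
  split=> // j; rewrite -(inj_eq val_inj) /= t1 mxE coord_posE.
  by case: j => [[|[|[|[|[|j]]]]]].
have {}h (i : nat) (i5 : (i < 5)%N) : i != 1%N ->
    0 < [:: 0; z2; z3; z4; z0]`_(if i == 0%N then 4 else i.-1).
  have := h (Ordinal i5); rewrite -(inj_eq val_inj) /= t1 mxE coord_posE.
  exact.
by split=> //; [exact: (h 2%N)|exact: (h 3%N)|exact: (h 4%N)|exact: (h 0%N)].
Qed.

Lemma ge_at0_vec (z1 z2 z3 z4 z0 : R) (t : 'I_5) : t = 0%N :> nat ->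
  ge_at t (vec [:: z1; z2; z3; z4; z0]) <->
  [/\ z0 = 0, 0 < z1, 0 < z2, 0 < z3 & 0 < z4].
Proof.
move=> t0; rewrite /ge_at mxE coord_posE t0 /=.
split=> [[-> h]|[-> h1 h2 h3 h4]]; last first.
  split=> // j; rewrite -(inj_eq val_inj) /= t0 mxE coord_posE.
  by case: j => [[|[|[|[|[|j]]]]]].
have {}h (i : nat) (i5 : (i < 5)%N) : i != 0%N ->
    0 < [:: z1; z2; z3; z4; 0]`_(if i == 0%N then 4 else i.-1).
  have := h (Ordinal i5); rewrite -(inj_eq val_inj) /= t0 mxE coord_posE.
  exact.
by split=> //; [exact: (h 1%N)|exact: (h 2%N)|exact: (h 3%N)|exact: (h 4%N)].
Qed.

Lemma all_mem3 (T : eqType) (x y z : T) (P : T -> Prop) :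
  (forall b, b \in [:: x; y; z] -> P b) <-> [/\ P x, P y & P z].
Proof.
split=> [H|[Hx Hy Hz] b]; first by split; apply: H; rewrite !inE eqxx ?orbT.
by rewrite !inE => /or3P[] /eqP->.
Qed.

Lemma all_mem4 (T : eqType) (x y z w : T) (P : T -> Prop) :
  (forall b, b \in [:: x; y; z; w] -> P b) <-> [/\ P x, P y, P z & P w].
Proof.
split=> [H|[Hx Hy Hz Hw] b]; first by split; apply: H; rewrite !inE eqxx ?orbT.
by rewrite !inE => /or4P[] /eqP->.
Qed.

(* [g = (L + S) / 2] with [S = x1 + x2 + x3 + x4] covers both [L = lam], at
   [g = gamma], and [L = - lam], after the reflection of the last coordinate. *)
Lemma type1_matrix n L x1 x2 x3 x4 g (t : 'I_5) : t = 1%N :> nat -> (3 <= n)%N ->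
  0 < x1 -> 0 < x2 -> 0 < x3 -> 0 < x4 ->
  2 * g = L + (x1 + x2 + x3 + x4) ->
  ge_at t (D15 R *m Cox R ^+ (n - 3) *m vec [:: x1; x2; x3; x4; g]) <->
  L < 0 /\ type1 n (- L) x1 x2 x3 x4.
Proof.
move=> t1 n3 p1 p2 p3 p4 gE.
rewrite -mulmxA Cox_exp_vec D15_vec (ge_at1_vec _ _ _ _ _ t1) /type1.
have LE : 2 * g - (x1 + x2 + x3 + x4) = L by rewrite gE addrK.
rewrite LE; have on : odd n = ~~ odd (n - 3) by rewrite -{1}(subnK n3) addnS addn2 /= negbK.
have nE : (n%:R : R) = 3 + (odd (n - 3))%:R + 2 * (n - 3)./2%:R.
  rewrite -{1}(subnK n3) natrD -{1}(odd_double_half (n - 3)) natrD -mul2n natrM; ring.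
have nE3 : ((n - 3)%:R : R) = (odd (n - 3))%:R + 2 * (n - 3)./2%:R.
  by rewrite -{1}(odd_double_half (n - 3)) natrD -mul2n natrM.
rewrite n3 on nE nE3.
have h0 : (0 : R) <= (n - 3)./2%:R by rewrite ler0n.
move: ((n - 3)./2%:R : R) h0 => h h0.
clear n3 on nE nE3; case: (odd (n - 3)) => /=.
  split=> [[e1 e2 e3 e4 e0]|[L0 [_ [e1 /all_mem3[e2 e3 e4]]]]]; last by split; lra.
  by split; [lra|split=> //; split; [lra|apply/all_mem3; split; lra]].
split=> [[e1 e2 e3 e4 e0]|[L0 [_ [e1 /all_mem3[e2 e3 e4]]]]]; last by split; lra.
by split; [lra|split=> //; split; [lra|apply/all_mem3; split; lra]].
Qed.

(** [D02] is the Coxeter map itself, so the matrix is [Cox ^+ n./2]. Its last coordinate vanishes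
    exactly when [- n L] is the sum of the weights; the other four give the middle bounds. *)
Lemma type0_matrix n L x1 x2 x3 x4 g (t : 'I_5) : t = 0%N :> nat -> (3 <= n)%N -> odd n ->
  0 < x1 -> 0 < x2 -> 0 < x3 -> 0 < x4 ->
  2 * g = L + (x1 + x2 + x3 + x4) ->
  ge_at t (D02 R *m Cox R ^+ (n./2 - 1) *m vec [:: x1; x2; x3; x4; g]) <->
  L < 0 /\ type0 n (- L) x1 x2 x3 x4.
Proof.
move=> t0 n3 on p1 p2 p3 p4 gE.
have DC : D02 R *m Cox R ^+ (n./2 - 1) = Cox R ^+ n./2.
  have -> : D02 R = Cox R.
    rewrite /Cox; apply/matrixP => i j; rewrite !mxE !big_ord_recl big_ord0 !mxE.
    by case: i => [[|[|[|[|[|i]]]]]] //= _; case: j => [[|[|[|[|[|j]]]]]] //= _; rewrite /=; ring.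
  have -> : Cox R *m Cox R ^+ (n./2 - 1) = Cox R * Cox R ^+ (n./2 - 1) by [].
  by rewrite -exprS subn1 prednK // half_gt0 ltnW.
rewrite DC Cox_exp_vec (ge_at0_vec _ _ _ _ _ t0) /type0 on.
have LE : 2 * g - (x1 + x2 + x3 + x4) = L by rewrite gE addrK.
have nE : (n%:R : R) = 1 + 2 * n./2%:R.
  by rewrite -{1}(odd_double_half n) on natrD -mul2n natrM.
have hE : (n./2%:R : R) = (odd n./2)%:R + 2 * n./2./2%:R.
  by rewrite -{1}(odd_double_half n./2) natrD -mul2n natrM.
have h0 : (0 : R) <= n./2./2%:R by rewrite ler0n.
have h1 : (1 : R) <= n./2%:R by rewrite ler1n half_gt0 ltnW.
rewrite LE nE n3 hE; rewrite hE in h1; move: (n./2./2%:R : R) h0 h1 => h h0 h1.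
clear n3 on nE hE DC LE; case: (odd n./2) h1 => /= h1.
  split=> [[e0 e1 e2 e3 e4]|[L0 [[_ _ e0] /all_mem4[e1 e2 e3 e4]]]]; last by split; lra.
  have L0 : L < 0 by nra.
  by split=> //; split; [split=> //; lra|apply/all_mem4; split; lra].
split=> [[e0 e1 e2 e3 e4]|[L0 [[_ _ e0] /all_mem4[e1 e2 e3 e4]]]]; last by split; lra.
have L0 : L < 0 by nra.
by split=> //; split; [split=> //; lra|apply/all_mem4; split; lra].
Qed.

End RootMatrices.

Section Coordinates.
Variable T : Type.
Implicit Types (u : 'cV[T]_5) (tau : 'S_4).

Lemma first4E (j : 'I_4) : first4 j = j :> nat.
Proof. by rewrite /first4 lift_max. Qed.

Lemma col5P u u' : u ord_max ord0 = u' ord_max ord0 ->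
  (forall j, u (first4 j) ord0 = u' (first4 j) ord0) -> u = u'.
Proof.
move=> h0 h; apply/matrixP => i j; rewrite (ord1 j).
by have [k ->|->] := unliftP ord_max i; [exact: h|exact: h0].
Qed.

Lemma permv_max tau u : permv tau u ord_max ord0 = u ord_max ord0.
Proof. by rewrite mxE lift_perm_id. Qed.

Lemma permv_first4 tau u j : permv tau u (first4 j) ord0 = u (first4 (tau^-1%g j)) ord0.
Proof. by rewrite mxE lift_perm_lift. Qed.

End Coordinates.

Lemma vec_eta (T : nmodType) (u : 'cV[T]_5) : u = vec [:: u (first4 (inord 0)) ord0; u (first4 (inord 1)) ord0;
  u (first4 (inord 2)) ord0; u (first4 (inord 3)) ord0; u ord_max ord0].
Proof. by apply: col5P => [|]; [rewrite mxE|apply: ord4P; rewrite [RHS]mxE first4E inordK]. Qed.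

Section RootConditions.
Variable R : realType.
Implicit Types (a : 'I_4 -> R) (lam : R).

(** [Cblack] replaces [g] by the sum of the weights minus [g], that is [lam] by [- lam]. The extra
    factor for odd [k] thus makes the parity of [k] record the sign of [lam]. *)
Lemma Amx0_cond k lam (x1 x2 x3 x4 g : R) : (2 <= k)%N ->
  0 < x1 -> 0 < x2 -> 0 < x3 -> 0 < x4 -> lam != 0 ->
  2 * g = lam + (x1 + x2 + x3 + x4) ->
  ge_at (widen_ord (isT : 2 <= 5)%N ord0) (Amx R ord0 k *m vec [:: x1; x2; x3; x4; g]) <->
  (lam < 0) = ~~ odd k /\ type0 (if odd k then k else k.+1) `|lam| x1 x2 x3 x4.
Proof.
move=> k2 p1 p2 p3 p4 lam0 gE; rewrite /Amx eqxx; case: ifP => ok /=.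
  have k3 : (3 <= k)%N by case: k ok k2 => [|[|[|k]]].
  rewrite -mulmxA Cblack_vec (@type0_matrix R k (- lam)) //; last by lra.
  rewrite opprK oppr_lt0.
  by case: ltrgt0P lam0 => //= l0 _; split=> -[].
have n3 : (3 <= k.+1)%N by [].
have on : odd k.+1 by rewrite /= ok.
have -> : k./2 = k.+1./2 by rewrite -uphalfE uphalf_half ok.
rewrite (@type0_matrix R k.+1 lam) //.
by case: ltrgt0P lam0 => //= l0 _; split=> -[].
Qed.

Lemma Amx1_cond (t : 'I_2) k lam (x1 x2 x3 x4 g : R) : t != ord0 -> (5 <= k)%N ->
  0 < x1 -> 0 < x2 -> 0 < x3 -> 0 < x4 -> lam != 0 ->
  2 * g = lam + (x1 + x2 + x3 + x4) ->
  ge_at (widen_ord (isT : 2 <= 5)%N t) (Amx R t k *m vec [:: x1; x2; x3; x4; g]) <->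
  (lam < 0) = odd k /\ type1 (uphalf k) `|lam| x1 x2 x3 x4.
Proof.
move=> t0 k5 p1 p2 p3 p4 lam0 gE; rewrite /Amx (negPf t0).
have t1 : widen_ord (isT : 2 <= 5)%N t = 1%N :> nat by case: t t0 => [[|[|t]]].
have n3 : (3 <= uphalf k)%N by move: k5; lia.
case: ifP => ok /=.
  rewrite (@type1_matrix R (uphalf k) lam) //.
  by case: ltrgt0P lam0 => //= l0 _; split=> -[].
rewrite -mulmxA Cblack_vec (@type1_matrix R (uphalf k) (- lam)) //; last by lra.
rewrite opprK oppr_lt0.
by case: ltrgt0P lam0 => //= l0 _; split=> -[].
Qed.

(** The transposition and [klein d] both send the index 0 to [d], and [type1] is symmetric in the
    other three weights. *)
Lemma type1_transposition n lam a d : let tau := tperm (inord 0) d in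
  type1 n lam (a (tau (inord 0))) (a (tau (inord 1))) (a (tau (inord 2))) (a (tau (inord 3))) <->
  form_type n lam a (Some d).
Proof.
have ne (i j : nat) : (i < 4)%N -> (j < 4)%N -> i != j -> (inord i : 'I_4) != inord j.
  by move=> i4 j4; apply: contraNneq => /(congr1 val) /=; rewrite !inordK // => ->.
have sw b0 b1 b2 b3 c1 c2 c3 : perm_eq [:: b1; b2; b3] [:: c1; c2; c3] ->
    type1 n lam b0 b1 b2 b3 <-> type1 n lam b0 c1 c2 c3.
  move=> bc; rewrite /type1.
  have s : b1 + b2 + b3 = c1 + c2 + c3.
    have := perm_big _ bc (op := +%R) (x := 0) (P := xpredT) (F := id).
    by rewrite !big_cons !big_nil /= !addr0 !addrA.
  have s0 : b0 + b1 + b2 + b3 = b0 + c1 + c2 + c3 by lra.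
  have m (P : R -> Prop) : (forall b, b \in [:: b1; b2; b3] -> P b) <->
      (forall b, b \in [:: c1; c2; c3] -> P b).
    by split=> H b; [rewrite -(perm_mem bc)|rewrite (perm_mem bc)]; exact: H.
  by rewrite s s0; case: (odd n); split=> -[n3 [e /m]].
move: d; apply: ord4P; rewrite /form_type /= /klein !inordK //=.
- by rewrite tperm1 !perm1.
- by rewrite tpermL tpermR !tpermD ?ne //; apply: sw; apply/seq.permP => P /=; lia.
- by rewrite tpermL tpermR !tpermD ?ne //; apply: sw; apply/seq.permP => P /=; lia.
- by rewrite tpermL tpermR !tpermD ?ne //; apply: sw; apply/seq.permP => P /=; lia.
Qed.


Lemma deltaG_mulrn q i : (deltaG *+ q) i ord0 = (deltaG i ord0 * q)%N.
Proof. by elim: q => [|q IHq]; rewrite ?mulr0n ?mulrS mxE ?muln0 // IHq mulnS. Qed.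

Lemma root_vec0 k : root_vec ord0 k ord_max ord0 = (if odd k then k else k.+1) /\
  forall j, 2 * (root_vec ord0 k (first4 j) ord0)%:R =
    (if odd k then k else k.+1)%:R + (-1) ^+ (~~ odd k) :> R.
Proof.
have kE := odd_double_half k; have m2 : (k %% 2)%N = odd k by rewrite modn2.
have rE : root_vec ord0 k = (roots0 ord0)`_(odd k) + deltaG *+ k./2.
  by rewrite /root_vec /= m2 divn2.
split.
  rewrite rE mxE deltaG_mulrn !mxE /=; move: kE.
  by case: (odd k) => /=; rewrite !mxE /=; lia.
move=> j; rewrite rE mxE deltaG_mulrn.
have -> : (roots0 ord0)`_(odd k) (first4 j) ord0 = odd k.
  by move: j; apply: ord4P; case: (odd k); rewrite /= mxE first4E inordK.
have -> : deltaG (first4 j) ord0 = 1%N by move: j; apply: ord4P; rewrite mxE first4E inordK.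
have kR : (k%:R : R) = (odd k)%:R + 2 * k./2%:R by rewrite -{1}kE natrD -mul2n natrM.
have -> : ((if odd k then k else k.+1)%:R : R) = k%:R + (~~ odd k)%:R.
  by case: (odd k); rewrite ?addr0 // natr1.
rewrite mul1n natrD kR; move: (k./2%:R : R) => h.
by case: (odd k); rewrite /= ?expr0 ?expr1; lra.
Qed.

Lemma root_vec1 (t : 'I_2) k : t != ord0 -> root_vec t k ord_max ord0 = uphalf k /\
  forall j, 2 * (root_vec t k (first4 j) ord0)%:R =
    (uphalf k)%:R + (-1) ^+ (odd k) * trace1 (uphalf k) (inord 0) j :> R.
Proof.
move=> t0; rewrite /root_vec /roots0 (negPf t0) /=.
have := divn_eq k 4; have := ltn_pmod k (isT : 0 < 4)%N.
move: (k %/ 4)%N (k %% 4)%N => q r r4 ->.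
have in0 (j : nat) : (j < 4)%N -> ((inord j : 'I_4) == inord 0) = (j == 0)%N.
  by move=> j4; rewrite -(inj_eq val_inj) /= !inordK.
have [uE oE nE] : [/\ uphalf (q * 4 + r) = (q * 2 + uphalf r)%N, odd (q * 4 + r) = odd r &
   odd (uphalf (q * 4 + r)) = odd (uphalf r)] by split; lia.
rewrite /trace1 nE oE uE.
case: r r4 {uE oE nE} => [|[|[|[|r]]]] //= _; split; rewrite ?mxE ?deltaG_mulrn ?mxE /=; try lia;
  by apply: ord4P; rewrite in0 //= !mxE deltaG_mulrn !mxE first4E inordK //= ?expr0 ?expr1
    !natrD !natrM; lra.
Qed.

End RootConditions.

(** * The dictionary between forms and admissible triples *)

Section Admissibility.
Variable R : realType.
Implicit Types (v : 'cV[option nat]_5) (f : option 'I_4).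

Lemma trace_vectorP n (t : 'I_4 -> R) (u : 'cV[nat]_5) v : u ord_max ord0 = n ->
  (forall j, 2 * (u (first4 j) ord0)%:R = n%:R + t j) ->
  trace_vector n t v <-> v = map_mx Some u.
Proof.
move=> un ut; split=> [[vn vt]|->].
  apply: col5P => [|j]; first by rewrite mxE un.
  have [r -> rE] := vt j; rewrite mxE; congr Some.
  have /mulfI : (2 : R) != 0 by rewrite pnatr_eq0.
  by rewrite -ut in rE => /(_ _ _ rE) /eqP; rewrite eqr_nat => /eqP.
by split=> [|j]; rewrite mxE ?un //; exists (u (first4 j) ord0).
Qed.

Lemma tausP tau : tau \in taus <-> exists d, tau = tperm (inord 0) d.
Proof.
rewrite !inE; split=> [/or4P[]/eqP->|[d ->]].
- by exists (inord 0); rewrite tperm1.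
- by exists (inord 1).
- by exists (inord 2).
- by exists (inord 3).
- by move: d; apply: ord4P; rewrite ?tperm1 eqxx ?orbT.
Qed.

Definition form_t f : 'I_2 := if f is Some _ then inord 1 else ord0.

Definition form_tau f : 'S_4 := if f is Some d then tperm (inord 0) d else 1%g.

(** Recovers [k] from the dimension and the sign of [lam], with [b] meaning [lam < 0]: it inverts
    [uphalf k] for [t = 1], and the choice of the odd number among [k], [k.+1] for [t = 0]. *)
Definition form_k (b : bool) n f : nat :=
  if f is Some _ then (if b then n.*2.-1 else n.*2) else (if b then n.-1 else n).

Variables (chi : 'cV[R]_5).
Let a j := chi (first4 j) ord0.
Let lam := 2 * chi ord_max ord0 - \sum_j a j.
Hypothesis a_gt0 : forall j, 0 < a j.
Hypothesis lam_neq0 : lam != 0.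
Let b := lam < 0.

Lemma permv_chi (tau : 'S_4) : (tau^-1)%g = tau ->
  permv tau chi = vec [:: a (tau (inord 0)); a (tau (inord 1)); a (tau (inord 2));
    a (tau (inord 3)); chi ord_max ord0] /\
  2 * chi ord_max ord0 = lam + (a (tau (inord 0)) + a (tau (inord 1)) +
    a (tau (inord 2)) + a (tau (inord 3))).
Proof.
move=> tauV; split.
  by rewrite [LHS]vec_eta !permv_first4 permv_max tauV.
rewrite -(sum4 (fun j => a (tau j))) -(reindex_inj (@perm_inj _ tau) (P := xpredT) (F := a)).
by rewrite /lam subrK.
Qed.

(** The root carries the dimension and the traces; the matrix condition carries the inequalities of
    the form together with the sign of [lam]. *)
Lemma admissible_iff v (t : 'I_2) k (tau : 'S_4) :
  admissible chi v t k tau <->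
  exists n f, [/\ t = form_t f, k = form_k b n f, tau = form_tau f,
    form_type n `|lam| a f &
    trace_vector n (fun j => (-1) ^+ b * form_trace R n f j) v].
Proof.
have inord1 : (inord 1 : 'I_2) != ord0 by rewrite -(inj_eq val_inj) /= inordK.
have oneV : (1^-1)%g = 1%g :> 'S_4 by rewrite invg1.
have permv1 (T : Type) (u : 'cV[T]_5) : permv 1%g u = u.
  rewrite /permv invg1 lift_perm1; exact: row_perm1.
have [c1 g1] := permv_chi oneV; rewrite !perm1 in c1 g1.
have trV (s : 'I_2) m d : s != ord0 -> b = odd m ->
    trace_vector (uphalf m) (fun j => (-1) ^+ b * form_trace R (uphalf m) (Some d) j) v <->
    v = map_mx Some (permv (tperm (inord 0) d) (root_vec s m)).
  move=> s0 bE; have [r0 rj] := root_vec1 R m s0.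
  apply: trace_vectorP => [|j]; first by rewrite permv_max.
  have jE : (tperm (inord 0) d j == inord 0) = (j == d).
    by rewrite -{2}(tpermR (inord 0) d) (inj_eq perm_inj).
  by rewrite permv_first4 tpermV rj bE /form_trace /trace1 jE.
have trV0 m : b = ~~ odd m -> let n := if odd m then m else m.+1 in
    trace_vector n (fun j => (-1) ^+ b * form_trace R n None j) v <->
    v = map_mx Some (permv 1%g (root_vec ord0 m)).
  move=> bE n; have [r0 rj] := root_vec0 R m.
  by rewrite permv1; apply: (trace_vectorP v r0) => j; rewrite mulr1 bE; exact: rj.
split=> [[kt /tausP[d tauE] t0tau vE cond]|[n [f [-> -> -> ft tv]]]].
- have [t0|t0] := eqVneq t ord0.
    have tau1 := t0tau t0; subst t; rewrite tau1 in vE cond *.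
    rewrite c1 in cond.
    have [be ty] := (Amx0_cond kt (a_gt0 _) (a_gt0 _) (a_gt0 _) (a_gt0 _) lam_neq0 g1).1 cond.
    exists (if odd k then k else k.+1), None; split=> //; last exact/trV0.
    by rewrite /form_k /b be; case: (odd k).
  subst tau; clear t0tau.
  have [c2 g2] := permv_chi (tpermV (inord 0) d); rewrite c2 in cond.
  have k5 : (5 <= k)%N by move: kt; rewrite /kmin (negPf t0).
  have [be ty] := (Amx1_cond t0 k5 (a_gt0 _) (a_gt0 _) (a_gt0 _) (a_gt0 _) lam_neq0 g2).1 cond.
  exists (uphalf k), (Some d); split=> //.
  + by apply/val_inj; rewrite /= inordK //; case: t t0 {kt vE cond} => [[|[|t]]].
  + by rewrite /form_k /b be; move: k5; clear; case ok: (odd k); lia.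
  + exact/type1_transposition.
  + exact/(trV t).
have n3 := form_type_ge3 ft.
case: f ft tv => [d|] ft tv.
  have [c2 g2] := permv_chi (tpermV (inord 0) d).
  have [k5 ok uk] : [/\ (5 <= form_k b n (Some d))%N, b = odd (form_k b n (Some d)) &
      uphalf (form_k b n (Some d)) = n].
    by rewrite /=; move: n3; clear; case: b => n3; split; lia.
  split=> //.
  + by rewrite /kmin (negPf inord1).
  + by apply/tausP; exists d.
  + by move/eqP; rewrite (negPf inord1).
  + by apply/(trV _ _ _ inord1 ok); rewrite uk.
  rewrite c2; apply/(Amx1_cond inord1 k5 (a_gt0 _) (a_gt0 _) (a_gt0 _) (a_gt0 _) lam_neq0 g2).
  by rewrite uk; split=> //; exact/type1_transposition.
have on : odd n by case: ft => -[].
have [k2 ok uk] : [/\ (2 <= form_k b n None)%N, b = ~~ odd (form_k b n None) &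
    (if odd (form_k b n None) then form_k b n None else (form_k b n None).+1) = n].
  move: n3 on; clear; rewrite /=; case: b => n3 on; last by rewrite on; split=> //; exact: ltnW.
  have -> : odd n.-1 = false by lia.
  by split=> //; lia.
split=> //.
+ by apply/tausP; exists (inord 0); rewrite tperm1.
+ by apply/(trV0 _ ok); rewrite uk.
rewrite c1; apply/(Amx0_cond k2 (a_gt0 _) (a_gt0 _) (a_gt0 _) (a_gt0 _) lam_neq0 g1).
by rewrite uk; split.
Qed.

Lemma admissible_unique v (t t' : 'I_2) k k' (tau tau' : 'S_4) :
  admissible chi v t k tau -> admissible chi v t' k' tau' ->
  [/\ t = t', k = k' & tau = tau'].
Proof.
move=> /admissible_iff[n [f [-> -> -> ft tv]]] /admissible_iff[n' [f' [-> -> -> ft' tv']]].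
have [nn tt] := trace_vector_inj tv tv'; subst n'.
have -> : f = f'; last by [].
apply: (@form_trace_inj R n); first exact: leq_trans (form_type_ge3 ft).
by move=> j; have /mulfI := tt j; apply; rewrite signr_eq0.
Qed.

End Admissibility.

(** * Self-adjoint operators commuting with an irreducible family *)

Section Completeness.
Variables (R : realType) (H : hilbert R).

(** Completeness with an explicit rate that survives in the limit, so that later arguments avoid
    filters. *)
Lemma rnorm_complete (u : nat -> H) (d : nat -> R) :
  (forall n m, (n <= m)%N -> rnorm (u m - u n) <= d n) ->
  (forall e, 0 < e -> exists n, d n < e) ->
  exists l, forall n, rnorm (l - u n) <= d n.
Proof.
move=> ud d0.
have real_eps (e : R[i]) : 0 < e -> exists2 r : R, 0 < r & e = r%:C.
  by case: e => r s; rewrite ltcE /= => /andP[/eqP -> r0]; exists r.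
have : cauchy (u @ \oo).
  apply: cauchy_exP => e /real_eps[r r0 ->].
  have [n dn] := d0 r r0; exists (u n); exists n => // m /= nm.
  rewrite -ball_normE /= distrC rnormE ltcR.
  by apply: le_lt_trans dn; exact: ud.
move/cauchy_cvg => /cvg_ex[l ul]; exists l => n.
apply/ler_addgt0Pr => e e0.
have : \forall m \near \oo, `|l - u m| < e%:C.
  by move: ul => /cvgrPdist_lt; apply; rewrite ltcR.
case=> N _ /(_ (maxn N n) (leq_maxl _ _)) /= h.
have -> : l - u n = (l - u (maxn N n)) + (u (maxn N n) - u n) by rewrite addrA subrK.
apply: le_trans (rnormD _ _) _; rewrite addrC lerD //; first exact/ud/leq_maxr.
by apply: ltW; rewrite -ltcR -rnormE.
Qed.

End Completeness.

Section SquareRoot.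
Variables (R : realType) (H : hilbert R) (W : {linear H -> H}).
Hypothesis W_le : forall x, rnorm (W x) <= rnorm x.

(* [1 - lim sqrt_iter n] is a square root of [1 - W]. *)
Fixpoint sqrt_iter (n : nat) : {linear H -> H} :=
  if n is n'.+1 then (2^-1%:C : R[i]) \*: (W \+ (sqrt_iter n' \o sqrt_iter n'))
  else \0.

(** The same iteration with [W] replaced by 1: a scalar majorant for the norms of the iterates and
    of their increments. It increases to 1 at the slow rate [2 / (n + 2)]. *)
Fixpoint sqrt_bound (n : nat) : R :=
  if n is n'.+1 then (1 + sqrt_bound n' ^+ 2) / 2 else 0.

Lemma sqrt_iterS n x :
  sqrt_iter n.+1 x = (2^-1)%:C *: (W x + sqrt_iter n (sqrt_iter n x)).
Proof. by []. Qed.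

Lemma sqrt_boundS n : sqrt_bound n.+1 = (1 + sqrt_bound n ^+ 2) / 2.
Proof. by []. Qed.

Lemma sqrt_bound_itv n :
  [/\ 0 <= sqrt_bound n, sqrt_bound n <= 1 & 1 - sqrt_bound n <= 2 / n.+2%:R].
Proof.
elim: n => [|n [b0 b1 bn]]; first by split; rewrite //= subr0 divff ?pnatr_eq0.
move: bn => /=; rewrite !ler_pdivlMr ?ltr0n // -[n.+3%:R]natr1.
have : (2 : R) <= n.+2%:R by rewrite ler_nat.
move: (sqrt_bound n) b0 b1 (n.+2%:R : R) => b b0 b1 N N2 bn.
have N0 : 0 < N by lra.
split; [nra|nra|].
rewrite -(ler_pM2l (_ : 0 < N ^+ 2)); last by rewrite exprn_gt0.
set e := (1 - b) * N in bn; have e0 : 0 <= e by rewrite mulr_ge0 ?subr_ge0 // ltW.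
have -> : N ^+ 2 * ((1 - (1 + b ^+ 2) / 2) * (N + 1)) = (N * e - e ^+ 2 / 2) * (N + 1).
  by rewrite /e; field.
(* For [e <= 2 <= N] the left side increases with [e], and [e = 2] gives the right side. *)
have h : N * e - e ^+ 2 / 2 <= 2 * N - 2 by nra.
by apply: le_trans (_ : (2 * N - 2) * (N + 1) <= _); [rewrite ler_wpM2r //; lra|nra].
Qed.

Lemma sqrt_iter_le n x : rnorm (sqrt_iter n x) <= sqrt_bound n * rnorm x.
Proof.
elim: n x => [|n IHn] x /=; first by rewrite mul0r /rnorm normr0.
rewrite rnormZ ger0_norm ?invr_ge0 // mulrAC [leRHS]mulrC ler_wpM2l ?invr_ge0 //.
apply: le_trans (rnormD _ _) _; rewrite mulrDl mul1r lerD // expr2 -mulrA.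
have [b0 _ _] := sqrt_bound_itv n.
by apply: le_trans (IHn _) _; rewrite ler_wpM2l.
Qed.

(** From [p p - q q = p (p - q) + (p - q) q] the increments obey the recursion of the increments of
    [sqrt_bound]. *)
Lemma sqrt_iter_step n x :
  rnorm (sqrt_iter n.+1 x - sqrt_iter n x) <= (sqrt_bound n.+1 - sqrt_bound n) * rnorm x.
Proof.
elim: n x => [|n IHn] x.
  rewrite sqrt_iterS /= !addr0 subr0 rnormZ ger0_norm ?invr_ge0 // subr0.
  by rewrite expr0n addr0 mul1r ler_wpM2l ?invr_ge0.
rewrite [sqrt_iter n.+2 x]sqrt_iterS [sqrt_iter n.+1 x in X in _ - X]sqrt_iterS.
have [b0 _ _] := sqrt_bound_itv n; have [b0' _ _] := sqrt_bound_itv n.+1.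
set p := sqrt_iter n.+1; set q := sqrt_iter n.
have -> : (2^-1)%:C *: (W x + p (p x)) - (2^-1)%:C *: (W x + q (q x)) =
   (2^-1)%:C *: (p (p x - q x) + (p (q x) - q (q x))).
  by rewrite linearB /=; lmod.
rewrite rnormZ ger0_norm ?invr_ge0 //.
have h1 : rnorm (p (p x - q x)) <= sqrt_bound n.+1 * ((sqrt_bound n.+1 - sqrt_bound n) * rnorm x).
  by apply: le_trans (sqrt_iter_le _ _) _; rewrite ler_wpM2l.
have h2 : rnorm (p (q x) - q (q x)) <= (sqrt_bound n.+1 - sqrt_bound n) * (sqrt_bound n * rnorm x).
  have db : 0 <= sqrt_bound n.+1 - sqrt_bound n by rewrite subr_ge0 /=; have := sqr_ge0 (sqrt_bound n - 1); rewrite sqrrB1; lra.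
  by apply: le_trans (IHn _) _; rewrite ler_wpM2l // sqrt_iter_le.
apply: le_trans (_ : 2^-1 * (_ + _) <= _).
  by rewrite ler_wpM2l ?invr_ge0 //; apply: le_trans (rnormD _ _) _; exact: lerD h1 h2.
rewrite le_eqVlt; apply/orP; left; apply/eqP.
by rewrite (sqrt_boundS n.+1) (sqrt_boundS n); field.
Qed.

Lemma sqrt_iter_cauchy n m x : (n <= m)%N ->
  rnorm (sqrt_iter m x - sqrt_iter n x) <= (sqrt_bound m - sqrt_bound n) * rnorm x.
Proof.
elim: m => [|m IHm]; first by rewrite leqn0 => /eqP ->; rewrite !subrr mul0r /rnorm normr0.
rewrite leq_eqVlt => /orP[/eqP->|]; first by rewrite !subrr mul0r /rnorm normr0.
rewrite ltnS => /IHm h.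
have -> : sqrt_iter m.+1 x - sqrt_iter n x =
  (sqrt_iter m.+1 x - sqrt_iter m x) + (sqrt_iter m x - sqrt_iter n x) by rewrite addrA subrK.
apply: le_trans (rnormD _ _) _.
have -> : sqrt_bound m.+1 - sqrt_bound n = (sqrt_bound m.+1 - sqrt_bound m) + (sqrt_bound m - sqrt_bound n).
  by rewrite addrA subrK.
by rewrite mulrDl lerD // sqrt_iter_step.
Qed.

Lemma sqrt_iter_limit : exists g : H -> H, forall x n,
  rnorm (g x - sqrt_iter n x) <= (2 / n.+2%:R) * rnorm x.
Proof.
suff /choice[g hg] : forall x, exists y, forall n,
    rnorm (y - sqrt_iter n x) <= (2 / n.+2%:R) * rnorm x by exists g.
move=> x; apply: (rnorm_complete (u := fun n => sqrt_iter n x)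
  (d := fun n => (2 / n.+2%:R) * rnorm x)) => [n m nm|e e0].
  apply: le_trans (sqrt_iter_cauchy x nm) _; rewrite ler_wpM2r ?rnorm_ge0 //.
  have [_ bm _] := sqrt_bound_itv m; have [_ _ bn] := sqrt_bound_itv n.
  by apply: le_trans bn; rewrite lerD2r.
exists (Num.truncn (2 * rnorm x / e)).
rewrite mulrAC ltr_pdivrMr ?ltr0n // [ltRHS]mulrC -ltr_pdivrMr //.
apply: lt_trans (truncnS_gt _) _; by rewrite ltr_nat.
Qed.

Lemma le_of_small (a b C : R) : (forall n, a <= b + (2 / n.+2%:R) * C) -> a <= b.
Proof.
move=> h; apply/ler_addgt0Pr => e e0.
pose n := Num.truncn (2 * C / e); apply: le_trans (h n) _; rewrite lerD2l.
rewrite mulrAC ler_pdivrMr ?ltr0n // [leRHS]mulrC -ler_pdivrMr //.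
apply: ltW; apply: lt_trans (truncnS_gt _) _; by rewrite ltr_nat.
Qed.

Lemma eq0_of_small (y : H) (C : R) : (forall n, rnorm y <= (2 / n.+2%:R) * C) -> y = 0.
Proof.
move=> h; apply: rnorm0_eq0; apply/eqP; rewrite eq_le rnorm_ge0 andbT.
by apply: (@le_of_small _ _ C) => n; rewrite add0r.
Qed.

Lemma sqrt_iter_commute (Z : {linear H -> H}) : (forall x, Z (W x) = W (Z x)) ->
  forall n x, Z (sqrt_iter n x) = sqrt_iter n (Z x).
Proof.
move=> ZW; elim=> [|n IHn] x; first by rewrite /= linear0.
by rewrite !sqrt_iterS linearZ linearD /= ZW !IHn.
Qed.

Lemma rnormZC (c : R[i]) (x : H) : rnorm (c *: x) = complex.Re `|c| * rnorm x.
Proof.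
apply: complexI; rewrite rmorphM -!rnormE normrZ; congr (_ * _); exact: rnormE.
Qed.

(** Each property holds for the iterates up to a defect of at most [2 / (n + 2)] times a constant,
    and [eq0_of_small] passes to the limit. *)
Lemma sqrt_exists : exists g : H -> H,
  [/\ forall x, rnorm (g x) <= rnorm x,
      forall c x y, g (c *: x + y) = c *: g x + g y,
      forall x, 2 *: g x = W x + g (g x) &
      forall (Z : {linear H -> H}) M, (forall x, rnorm (Z x) <= M * rnorm x) ->
        (forall x, Z (W x) = W (Z x)) -> forall x, Z (g x) = g (Z x)].
Proof.
have [g gE] := sqrt_iter_limit.
have gE' x n : rnorm (sqrt_iter n x - g x) <= (2 / n.+2%:R) * rnorm x.
  by rewrite -rnormN opprB.
have e_ge0 n : 0 <= 2 / n.+2%:R :> R by rewrite divr_ge0.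
have h_le n x : rnorm (sqrt_iter n x) <= rnorm x.
  apply: le_trans (sqrt_iter_le _ _) _; have [_ b1 _] := sqrt_bound_itv n.
  by rewrite ler_piMl // rnorm_ge0.
have g_le x : rnorm (g x) <= rnorm x.
  apply: (@le_of_small _ _ (rnorm x)) => n; rewrite -[g x](subrK (sqrt_iter n x)).
  by apply: le_trans (rnormD _ _) _; rewrite addrC lerD.
exists g; split=> // [c x y|x|Z M ZM ZW x].
- apply/eqP; rewrite -subr_eq0; apply/eqP.
  apply: (@eq0_of_small _ (rnorm (c *: x + y) + complex.Re `|c| * rnorm x + rnorm y)) => n.
  have -> : g (c *: x + y) - (c *: g x + g y) =
    (g (c *: x + y) - sqrt_iter n (c *: x + y)) + c *: (sqrt_iter n x - g x) + (sqrt_iter n y - g y).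
    by rewrite linearP /=; lmod.
  have c0 : 0 <= complex.Re `|c| by rewrite normc_def /= sqrtr_ge0.
  apply: le_trans (rnormD _ _) _; rewrite !mulrDr lerD //.
  apply: le_trans (rnormD _ _) _; rewrite lerD // rnormZC mulrCA ler_wpM2l //.
- apply/eqP; rewrite -subr_eq0; apply/eqP.
  apply: (@eq0_of_small _ (2 * rnorm x + rnorm x + rnorm x)) => n.
  have -> : 2 *: g x - (W x + g (g x)) = 2 *: (g x - sqrt_iter n.+1 x) +
      sqrt_iter n (sqrt_iter n x - g x) + (sqrt_iter n (g x) - g (g x)).
    have -> : 2 *: (g x - sqrt_iter n.+1 x) = 2 *: g x - (W x + sqrt_iter n (sqrt_iter n x)).
      rewrite scalerBr sqrt_iterS scalerA -(rmorph_nat (real_complex R)) -rmorphM.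
      by rewrite divff ?pnatr_eq0 // scale1r.
    by rewrite linearB /=; lmod.
  apply: le_trans (rnormD _ _) _; rewrite !mulrDr lerD //; last first.
    by apply: le_trans (gE' _ _) _; rewrite ler_wpM2l.
  apply: le_trans (rnormD _ _) _; rewrite lerD //; last exact: le_trans (h_le _ _) _.
  rewrite -(rmorph_nat (real_complex R)) rnormZ ger0_norm // mulrCA ler_wpM2l //.
  apply: le_trans (gE _ _) _; rewrite ler_wpM2r ?rnorm_ge0 // ler_wpM2l //.
  by rewrite lef_pV2 ?posrE ?ltr0n // ler_nat.
- apply/eqP; rewrite -subr_eq0; apply/eqP.
  apply: (@eq0_of_small _ (M * rnorm x + rnorm (Z x))) => n.
  have -> : Z (g x) - g (Z x) = Z (g x - sqrt_iter n x) + (sqrt_iter n (Z x) - g (Z x)).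
    by rewrite linearB /= sqrt_iter_commute // addrA subrK.
  apply: le_trans (rnormD _ _) _; rewrite mulrDr lerD //.
  apply: le_trans (ZM _) _; rewrite mulrCA.
  (* [M] may be negative, but then its bound forces [x = 0]. *)
  have [M0|M0] := lerP 0 M; first by rewrite ler_wpM2l.
  have x0 : rnorm x = 0.
    apply/eqP; rewrite eq_le rnorm_ge0 andbT leNgt; apply/negP => x0.
    have := le_trans (rnorm_ge0 _) (ZM x); rewrite pmulr_lge0 // leNgt M0 //.
  have := gE x n; rewrite x0 !mulr0 => h.
  by rewrite mulr_le0_ge0 ?rnorm_ge0 // ltW.
Qed.

End SquareRoot.

Section Schur.
Variables (R : realType) (H : hilbert R).
Local Notation "<| x , y |>" := (inner H x y) (format "<| x ,  y |>").
Variables (I : Type) (X : I -> {linear H -> H}).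
Hypothesis irrX : irreducible_family X.
Hypothesis X_bounded : forall j, exists M, forall x, rnorm (X j x) <= M * rnorm x.

Lemma rnorm_sqr (x : H) : (rnorm x ^+ 2)%:C = <|x, x|>.
Proof. by rewrite -inner_norm rnormE rmorphXn. Qed.

Lemma Re_innerE (x : H) : complex.Re <|x, x|> = rnorm x ^+ 2.
Proof. by rewrite -rnorm_sqr. Qed.

Lemma Re_inner_le (x y : H) : complex.Re <|x, y|> <= rnorm x * rnorm y.
Proof.
have [->|y0] := eqVneq y 0.
  by rewrite inner0r /= mulr_ge0 ?rnorm_ge0.
have r0 : rnorm y != 0 by apply: contra_neq y0; exact: rnorm0_eq0.
pose e := ((rnorm y)^-1)%:C *: y.
have e1 : <|e, e|> = 1.
  rewrite /e innerZl innerRr -rnorm_sqr -!rmorphM /=.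
  by rewrite expr2 mulKf // mulVf.
have yE : y = (rnorm y)%:C *: e by rewrite /e scalerA -rmorphM mulfV // scale1r.
have h : complex.Re <|x, e|> <= rnorm x.
  rewrite -lecR -rnormE; apply: le_trans (inner_unit_le x e1); exact: Re_le_normc.
rewrite {1}yE innerRr; apply: le_trans (_ : rnorm y * complex.Re <|x, e|> <= _).
  by case: <|x, e|> => a b /=; rewrite mul0r subr0.
by rewrite mulrC ler_wpM2r ?rnorm_ge0.
Qed.

(* A positive part argument: [T ^+ 2 = Q ^+ 2] with [Q >= 0] commuting with [T],
   and one of the two closed invariant subspaces [Ker (T - Q)], [Ker (T + Q)] is
   everything. *)
Lemma selfadj_sign (T : {linear H -> H}) :
  (forall x, rnorm (T x) <= rnorm x) -> (forall x y, <|T x, y|> = <|x, T y|>) ->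
  (forall j x, X j (T x) = T (X j x)) ->
  (forall x, 0 <= complex.Re <|T x, x|>) \/ (forall x, complex.Re <|T x, x|> <= 0).
Proof.
(* [W] is [1 - T^2], again a contraction, and [g] solves [2 g = W + g^2]; hence [Q = 1 - g]
   satisfies [Q^2 = 1 - W = T^2], and [|g x| <= |x|] makes [Q] nonnegative. *)
move=> T_le T_sa XT; pose W : {linear H -> H} := idfun \- (T \o T).
have WE x : W x = x - T (T x) by [].
have W_le x : rnorm (W x) <= rnorm x.
  rewrite -ler_sqr ?nnegrE ?rnorm_ge0 // -lecR !rnorm_sqr WE.
  have -> : <|x - T (T x), x - T (T x)|> = <|x, x|> - (<|T x, T x|> + (<|T x, T x|> - <|T (T x), T (T x)|>)).
    have e1 : <|T (T x), x|> = <|T x, T x|> by rewrite T_sa.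
    have e2 : <|x, T (T x)|> = <|T x, T x|> by rewrite -T_sa.
    by rewrite !innerE e1 e2; ring.
  rewrite lerBlDr lerDl addr_ge0 ?innerxx_ge0 // subr_ge0 -!inner_norm ler_sqr ?nnegrE //.
  by rewrite !rnormE lecR T_le.
have [g [g_le g_lin g_eq g_comm]] := sqrt_exists W_le.
have g0 : g 0 = 0 by apply: rnorm0_eq0; apply/eqP; rewrite eq_le rnorm_ge0 andbT (le_trans (g_le 0)) // /rnorm normr0.
have gB x y : g (x - y) = g x - g y.
  by rewrite -[x - y]addrC -scaleN1r g_lin scaleN1r addrC.
pose Q x := x - g x.
have QB x y : Q (x - y) = Q x - Q y by rewrite /Q gB; lmod.
have Qlin c x y : Q (c *: x + y) = c *: Q x + Q y by rewrite /Q g_lin; lmod.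
have QQ x : Q (Q x) = T (T x).
  have -> : Q (Q x) = x - 2 *: g x + g (g x) by rewrite {1}/Q /Q gB scaler_nat; lmod.
  by rewrite g_eq WE; lmod.
have TW x : T (W x) = W (T x) by rewrite !WE linearB.
have TQ x : T (Q x) = Q (T x).
  rewrite /Q linearB /= (g_comm T 1) // => y; by rewrite mul1r T_le.
have XQ j x : X j (Q x) = Q (X j x).
  have [M hM] := X_bounded j.
  by rewrite /Q linearB /= (g_comm (X j) M) // => y; rewrite !WE linearB /= !XT.
have Q_ge0 x : 0 <= complex.Re <|Q x, x|>.
  rewrite /Q innerDl innerNl raddfB /= subr_ge0 Re_innerE.
  by apply: le_trans (Re_inner_le _ _) _; rewrite expr2 ler_wpM2r ?rnorm_ge0.
pose S := [set x | T x - Q x = 0].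
have clS : closed S.
  apply: (@closed_kernel _ _ H (fun x => T x - Q x) (3%:C)) => [x y|x].
    by rewrite linearB /= QB; lmod.
  rewrite !rnormE -rmorphM lecR.
  apply: le_trans (rnormD _ _) _; rewrite rnormN /Q.
  have := rnormD x (- g x); rewrite rnormN; have := T_le x; have := g_le x; lra.
have linS : linear_subspace S.
  split=> [|c x y]; rewrite /S /=; first by rewrite /Q linear0 g0 !subrr.
  move=> Sx Sy; rewrite linearP /= Qlin.
  have -> : c *: T x + T y - (c *: Q x + Q y) = c *: (T x - Q x) + (T y - Q y) by lmod.
  by rewrite Sx Sy scaler0 addr0.
have [_ irr] := irrX; have [] := irr S linS clS.
- by move=> j x; rewrite /S /= -XT -XQ -linearB => -> /=; rewrite linear0.
- move=> S0; right => x.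
  (* [T] and [Q] commute and have equal squares, so [(T - Q) (T + Q) = 0]; a trivial kernel of
     [T - Q] leaves [T = - Q]. *)
  have : S (T x + Q x).
    rewrite /S /= linearD /= TQ.
    have -> : Q (T x + Q x) = Q (T x) + Q (Q x) by rewrite -{1}[T x]scale1r Qlin scale1r.
    by rewrite QQ; lmod.
  rewrite S0 /= => /eqP; rewrite addr_eq0 => /eqP ->.
  by rewrite innerNl raddfN /= oppr_le0.
- move=> S1; left => x; have : S x by rewrite S1.
  by rewrite /S /= => /eqP; rewrite subr_eq0 => /eqP ->.
Qed.

(** By [selfadj_sign], every [T - c] has a quadratic form of constant sign. Two different values of
    [<|T x, x|>] on unit vectors would contradict this at their midpoint, so the form is a multiple
    of the squared norm. *)
Lemma schur_selfadj (T : {linear H -> H}) M :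
  (forall x, rnorm (T x) <= M * rnorm x) -> (forall x y, <|T x, y|> = <|x, T y|>) ->
  (forall j x, X j (T x) = T (X j x)) -> exists c : R, forall x, T x = c%:C *: x.
Proof.
move=> T_le T_sa XT.
have sgn c : (forall x, c * rnorm x ^+ 2 <= complex.Re <|T x, x|>) \/
    (forall x, complex.Re <|T x, x|> <= c * rnorm x ^+ 2).
  pose N : R := `|M| + `|c| + 1; have N0 : 0 < N by rewrite ltr_wpDl // addr_ge0.
  pose T' : {linear H -> H} := (N^-1)%:C \*: (T \- (c%:C \*: idfun)).
  have T'E x : T' x = (N^-1)%:C *: (T x - c%:C *: x) by [].
  have T'_le x : rnorm (T' x) <= rnorm x.
    rewrite T'E rnormZ ger0_norm ?invr_ge0 ?(ltW N0) // mulrC ler_pdivrMr //.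
    apply: le_trans (rnormD _ _) _; rewrite rnormN rnormZ.
    have := T_le x; have := rnorm_ge0 x; have := ler_norm M; rewrite /N.
    by move: (rnorm x) (`|M|) (`|c|) => r m d hm r0 hT; nra.
  have T'_sa x y : <|T' x, y|> = <|x, T' y|>.
    by rewrite !T'E !innerE T_sa; ring.
  have XT' j x : X j (T' x) = T' (X j x) by rewrite !T'E linearZ linearB linearZ /= XT.
  have re x : complex.Re <|T' x, x|> = N^-1 * (complex.Re <|T x, x|> - c * rnorm x ^+ 2).
    rewrite T'E !innerE -rnorm_sqr; case: <|T x, x|> => a b /=; ring.
  have [h|h] := selfadj_sign T'_le T'_sa XT'; [left|right] => x; have := h x; rewrite re.
    by rewrite pmulr_rge0 ?invr_gt0 // subr_ge0.
  by rewrite pmulr_rle0 ?invr_gt0 // subr_le0.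
have [[x0 x0n] _] := irrX.
have r0 : 0 < rnorm x0 ^+ 2.
  by rewrite exprn_gt0 // lt_neqAle rnorm_ge0 andbT eq_sym; apply: contra_neq x0n; exact: rnorm0_eq0.
pose c := complex.Re <|T x0, x0|> / rnorm x0 ^+ 2.
have cE x : complex.Re <|T x, x|> = c * rnorm x ^+ 2.
  have [->|xn] := eqVneq x 0; first by rewrite inner0r /rnorm normr0 /= expr0n mulr0.
  have r1 : 0 < rnorm x ^+ 2.
    by rewrite exprn_gt0 // lt_neqAle rnorm_ge0 andbT eq_sym; apply: contra_neq xn; exact: rnorm0_eq0.
  pose d := complex.Re <|T x, x|> / rnorm x ^+ 2.
  have dE : complex.Re <|T x, x|> = d * rnorm x ^+ 2 by rewrite /d divfK // gt_eqF.
  have cE0 : complex.Re <|T x0, x0|> = c * rnorm x0 ^+ 2 by rewrite /c divfK // gt_eqF.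
  suff -> : c = d by [].
  have [h|h] := sgn ((c + d) / 2); have := h x; have := h x0;
    rewrite dE cE0 !ler_pM2r //; lra.
exists c => x; apply/eqP; rewrite -subr_eq0; apply/eqP.
pose S z := T z - c%:C *: z.
have S_sa u v : <|S u, v|> = <|u, S v|> by rewrite /S !innerE T_sa.
have S0 z : complex.Re <|S z, z|> = 0.
  rewrite /S !innerE raddfB /= cE -rnorm_sqr; case: <|T z, z|> => a b /=; ring.
have SD u w : S (u + w) = S u + S w by rewrite /S linearD /=; lmod.
(* The form of [S] vanishes; evaluated at [x + S x], it gives [2 |S x|^2 = 0]. *)
rewrite -/(S x); clearbody S.
have := S0 (x + S x); rewrite SD !innerDl !innerDr !raddfD /= !S0 [<|S (S x), x|>]S_sa !Re_innerE.
by move=> h; apply: rnorm0_eq0; apply/eqP; rewrite -sqrf_eq0; apply/eqP; lra.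
Qed.

End Schur.

(** * Systems with sum zero *)

Section TwoDimensional.
Variables (R : realType) (H : hilbert R).
Local Notation "<| x , y |>" := (inner H x y) (format "<| x ,  y |>").

(** The off-diagonal entry of [X X = 1] is [bt] times the trace. If [bt = 0], the matrix is diagonal
    with signs, and equal signs would make [X] a scalar. *)
Lemma family_trace2 (X : {linear H -> H}) e : orthobasis 2 e ->
  (forall x, X (X x) = x) -> (forall x y, <|X x, y|> = <|x, X y|>) ->
  (forall b : bool, exists2 x, x != 0 & X x = (-1) ^+ b *: x) ->
  family_trace 2 e X = 0.
Proof.
move=> be XX Xsa ns; rewrite /family_trace !big_ord_recl big_ord0 addr0 /=.
have E x : x = <|x, e 0%N|> *: e 0%N + <|x, e 1%N|> *: e 1%N.
  by rewrite [LHS]be.2 !big_ord_recl big_ord0 addr0.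
have o00 : <|e 0%N, e 0%N|> = 1 by rewrite be.1.
have o11 : <|e 1%N, e 1%N|> = 1 by rewrite be.1.
have o01 : <|e 0%N, e 1%N|> = 0 by rewrite be.1.
rewrite /bump /=; set al := <|X (e 0%N), e 0%N|>; set de := <|X (e 1%N), e 1%N|>.
pose bt := <|X (e 0%N), e 1%N|>.
have E0 : X (e 0%N) = al *: e 0%N + bt *: e 1%N by exact: E.
have : <|X (X (e 0%N)), e 1%N|> = 0 by rewrite XX.
rewrite Xsa {1}E0 innerDl !innerZl -!Xsa -/bt -/de.
rewrite [al * bt]mulrC -mulrDr => /eqP; rewrite mulf_eq0 => /orP[/eqP bt0|/eqP //].
have E0' : X (e 0%N) = al *: e 0%N by rewrite E0 bt0 scale0r addr0.
have E1 : X (e 1%N) = de *: e 1%N.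
  rewrite [LHS]E -/de Xsa innerC -/bt bt0 conjC0 scale0r add0r //.
have sq (s : R[i]) k : (k < 2)%N -> X (e k) = s *: e k -> s ^+ 2 = 1.
  move=> k2 Xk; have := XX (e k); rewrite Xk linearZ /= Xk scalerA => /(congr1 (fun u => <|u, e k|>)).
  by rewrite innerZl be.1 // eqxx mulr1.
have al1 := sq _ 0%N isT E0'; have de1 := sq _ 1%N isT E1.
move/eqP: (de1); rewrite -al1 eqf_sqr => /orP[/eqP da|/eqP ->]; last by rewrite subrr.
move/eqP: al1; rewrite sqrf_eq1 => al1.
have [t t1 alE] : exists2 t : R, t ^+ 2 = 1 & al = t%:C.
  by case/orP: al1 => /eqP ->; [exists 1|exists (-1)]; rewrite ?sqrrN ?expr1n ?rmorphN1 ?rmorph1.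
by case: (scalar_contra be ns t1) => -[|[|]] // _; rewrite -alE // E1 da.
Qed.

(** As [Y0] fixes [x], the anticommutators put [y1] and [y2] into the -1 eigenspace of [Y0]. The
    triple relation then expresses [Y1 (Y2 x)] through [x], [y1], [y2], and [Y1 (Y1 y2) = y2] makes
    [y2] a multiple of [y1]. *)
Lemma two_dim_span (Y0 Y1 Y2 : {linear H -> H}) (c01 c02 c12 s : R[i]) (x : H) :
  (forall u, Y0 (Y0 u) = u) -> (forall u, Y1 (Y1 u) = u) ->
  (forall u v, <|Y0 u, v|> = <|u, Y0 v|>) -> (forall u v, <|Y1 u, v|> = <|u, Y1 v|>) ->
  (forall u, Y0 (Y1 u) + Y1 (Y0 u) = c01 *: u) ->
  (forall u, Y0 (Y2 u) + Y2 (Y0 u) = c02 *: u) ->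
  (forall u, Y1 (Y2 u) + Y2 (Y1 u) = c12 *: u) ->
  Y0 (Y1 (Y2 x)) - Y2 (Y1 (Y0 x)) = s *: x ->
  <|x, x|> = 1 -> Y0 x = x -> Y1 x - (c01 / 2) *: x != 0 ->
  exists2 e : nat -> H, orthonormal_upto 2 e &
    forall i, (i < 2)%N -> [/\ span_proj 2 e (Y0 (e i)) = Y0 (e i),
      span_proj 2 e (Y1 (e i)) = Y1 (e i) & span_proj 2 e (Y2 (e i)) = Y2 (e i)].
Proof.
move=> YY0 YY1 sa0 sa1 a01 a02 a12 V x1 Yx; set y1 := Y1 x - _ => y1n.
have two : (2 : R[i]) != 0 by rewrite pnatr_eq0.
have half (u : R[i]) : u / 2 + u / 2 = u.
  by rewrite -mulrDl -[u + u]mulr2n -[u *+ 2]mulr_natr mulfK.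
have [h hE] : exists h, c01 = h + h by exists (c01 / 2); rewrite half.
have [k kE] : exists k, c02 = k + k by exists (c02 / 2); rewrite half.
have [t tE] : exists t, s + c12 = t + t by exists ((s + c12) / 2); rewrite half.
have h2 : c01 / 2 = h by rewrite hE -mulr2n -[h *+ 2]mulr_natr mulfK.
rewrite {}h2 in y1 y1n *.
have Y01 : Y0 (Y1 x) = c01 *: x - Y1 x by rewrite -a01 Yx addrK.
have Y02 : Y0 (Y2 x) = c02 *: x - Y2 x by rewrite -a02 Yx addrK.
have Y1x : Y1 x = y1 + h *: x by rewrite /y1 subrK.
have Y0y1 : Y0 y1 = - y1.
  by rewrite /y1 linearB linearZ /= Yx Y01 hE; lmod.
have Y1y1 : Y1 y1 = (1 - h ^+ 2) *: x - h *: y1.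
  by rewrite {1}/y1 linearB linearZ /= YY1 Y1x; lmod.
have xy1 : <|x, y1|> = 0.
  have : <|Y0 x, y1|> = <|x, Y0 y1|> by exact: sa0.
  rewrite Yx Y0y1 innerNr => /eqP; rewrite -addr_eq0 -mulr2n mulrn_eq0 /= => /eqP //.
pose y2 := Y2 x - k *: x.
have Y2x : Y2 x = y2 + k *: x by rewrite /y2 subrK.
clearbody y1 y2; set g := 1 - h ^+ 2.
(* [g] is, up to conjugation, the squared norm of [y1]. *)
have gn : g != 0.
  have : <|Y1 x, y1|> = <|x, Y1 y1|> by exact: sa1.
  rewrite Y1x Y1y1 !innerE xy1 x1 !mulr0 subr0 addr0 mulr1 => E.
  by move: y1n; rewrite -innerxx_eq0 E fmorph_eq0.
have Y12x : Y1 (Y2 x) = t *: x - h *: y2 + k *: y1.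
  apply: (scalerI two); rewrite -[2 *: Y1 _]/((1 + 1) *: _) scalerDl !scale1r.
  have E1 : Y2 (Y1 x) = c12 *: x - Y1 (Y2 x) by rewrite -a12 addrAC subrr add0r.
  have E2 : Y0 (Y1 (Y2 x)) = c01 *: Y2 x - (c02 *: Y1 x - Y1 (Y2 x)).
    rewrite -a01 Y02 linearB linearZ /=; lmod.
  have E3 : Y1 (Y2 x) + Y1 (Y2 x) = (t + t) *: x - c01 *: Y2 x + c02 *: Y1 x.
    by rewrite -tE scalerDl -V Yx E1 E2; lmod.
  by rewrite E3 hE kE Y1x Y2x; lmod.
have Y1y2 : Y1 y2 = (t - h * k) *: x - h *: y2.
  have -> : y2 = Y2 x - k *: x by rewrite Y2x addrK.
  by rewrite linearB linearZ /= Y12x Y1x Y2x; lmod.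
have gy2 : g *: y2 = (t - h * k) *: y1.
  have := YY1 y2; rewrite {1}Y1y2 linearB [Y1 (_ *: x)]linearZ [Y1 (_ *: y2)]linearZ /= Y1y2 Y1x => E.
  transitivity (y2 - h ^+ 2 *: y2); first by rewrite /g; lmod.
  by rewrite -{1}E; lmod.
have y2E : y2 = (g^-1 * (t - h * k)) *: y1 by rewrite -scalerA -gy2 scalerA mulVf // scale1r.
have [c c0 c1] := ex_unit y1n.
pose e i := if i is 0%N then x else c *: y1.
have oe : orthonormal_upto 2 e.
  have ne : <|c *: y1, x|> = 0 by rewrite innerZl innerC xy1 conjC0 mulr0.
  by case=> [|[|i]] [|[|j]] // _ _; rewrite /e //= innerC ne conjC0.
exists e => //.
have pD (a : R[i]) u w : span_proj 2 e u = u -> span_proj 2 e w = w ->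
    span_proj 2 e (a *: u + w) = a *: u + w by move=> pu pw; rewrite span_projP pu pw.
have pZ (a : R[i]) u : span_proj 2 e u = u -> span_proj 2 e (a *: u) = a *: u.
  by move=> pu; rewrite -[_ *: _]addr0; apply: pD => //; exact: span_proj0.
have pA u w : span_proj 2 e u = u -> span_proj 2 e w = w -> span_proj 2 e (u + w) = u + w.
  by move=> pu pw; rewrite -[u]scale1r; exact: pD.
have pN u : span_proj 2 e u = u -> span_proj 2 e (- u) = - u.
  by move=> pu; rewrite -scaleN1r; exact: pZ.
have px : span_proj 2 e x = x by exact: (span_proj_id (i := 0%N) oe).
have py1 : span_proj 2 e y1 = y1.
  have -> : y1 = c^-1 *: e 1%N by rewrite /e scalerA mulVf // scale1r.
  by apply: (pZ); exact: span_proj_id.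
have py2 : span_proj 2 e y2 = y2 by rewrite y2E; exact: (pZ).
have pY2x : span_proj 2 e (Y2 x) = Y2 x.
  by rewrite Y2x; apply: (pA) => //; exact: (pZ).
case=> [|[|i]] // _; rewrite [e _]/=.
  split; first by rewrite Yx.
    by rewrite Y1x; apply: (pA) => //; exact: (pZ).
  by [].
split; rewrite linearZ /=; apply: (pZ).
- by rewrite Y0y1; exact: (pN).
- by rewrite Y1y1; apply: (pA); [|apply: (pN)]; exact: (pZ).
have -> : y1 = Y1 x - h *: x by rewrite Y1x addrK.
rewrite linearB linearZ /=.
have -> : Y2 (Y1 x) = c12 *: x - Y1 (Y2 x) by rewrite -a12 addrAC subrr add0r.
rewrite Y12x.
apply: (pA); last by apply: (pN); exact: (pZ).
apply: (pA); first exact: (pZ).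
apply: (pN); apply: (pA); last exact: (pZ).
by apply: (pA); [|apply: (pN)]; exact: (pZ).
Qed.

End TwoDimensional.

Section ZeroSum.
Variables (R : realType) (H : hilbert R).
Local Notation "<| x , y |>" := (inner H x y) (format "<| x ,  y |>").
Variables (X : 'I_4 -> {linear H -> H}) (a : 'I_4 -> R).
Hypothesis a_gt0 : forall j, 0 < a j.
Hypothesis sysX : involution_system a 0 X.
Hypothesis irrX : irreducible_family X.
Hypothesis nsX : nonscalar_family X.

Let XX j x : X j (X j x) = x. Proof. by have [h _ _] := sysX. Qed.
Let Xsa j x y : <|X j x, y|> = <|x, X j y|>. Proof. by have [_ h _] := sysX. Qed.

Let Xsum x : (a (inord 0))%:C *: X (inord 0) x + (a (inord 1))%:C *: X (inord 1) x +
  (a (inord 2))%:C *: X (inord 2) x + (a (inord 3))%:C *: X (inord 3) x = 0.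
Proof. by have [_ _ h] := sysX; have := h x; rewrite sum4 scale0r. Qed.

Let X_rnorm j x : rnorm (X j x) = rnorm x.
Proof. exact: rnorm_isometry. Qed.

Let X_bounded j : exists M, forall x, rnorm (X j x) <= M * rnorm x.
Proof. by exists 1 => x; rewrite X_rnorm mul1r. Qed.

(* Squaring [a i X i + a j X j = - (a k X k + a l X l)] expresses the
   anticommutator of one pair through that of the other pair. *)
Lemma anticommutator_scalar i j k l : (forall m : 'I_4, m \in [:: i; j; k; l]) ->
  (forall x, (a i)%:C *: X i x + (a j)%:C *: X j x = - ((a k)%:C *: X k x + (a l)%:C *: X l x)) ->
  exists c : R, forall x, X i (X j x) + X j (X i x) = c%:C *: x.
Proof.
move=> all4 sum0.
pose T : {linear H -> H} := (X i \o X j) \+ (X j \o X i).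
pose T' : {linear H -> H} := (X k \o X l) \+ (X l \o X k).
have TE x : T x = X i (X j x) + X j (X i x) by [].
have T'E x : T' x = X k (X l x) + X l (X k x) by [].
pose r := a k ^+ 2 + a l ^+ 2 - a i ^+ 2 - a j ^+ 2.
have TT' x : (a i * a j)%:C *: T x = r%:C *: x + (a k * a l)%:C *: T' x.
  have lin m (s t : R) u v : X m (s%:C *: u + t%:C *: v) = s%:C *: X m u + t%:C *: X m v.
    by rewrite linearD !linearZ.
  have linN m u : X m (- u) = - X m u by rewrite linearN.
  have := sum0 ((a i)%:C *: X i x + (a j)%:C *: X j x); rewrite [in RHS](sum0 x) !linN !lin !XX => E.
  have -> : (a i * a j)%:C *: T x = ((a i)%:C *: ((a i)%:C *: x + (a j)%:C *: X i (X j x)) +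
    (a j)%:C *: ((a i)%:C *: X j (X i x) + (a j)%:C *: x)) - (a i ^+ 2 + a j ^+ 2)%:C *: x.
    by rewrite TE; lmod.
  by rewrite E T'E /r; lmod.
have aij : ((a i * a j)%:C : R[i]) != 0 by rewrite fmorph_eq0 mulf_neq0 // gt_eqF.
apply: (@schur_selfadj _ _ _ X irrX X_bounded T 2).
- move=> x; rewrite TE mulr_natl mulr2n; apply: le_trans (rnormD _ _) _.
  by rewrite !X_rnorm.
- by move=> x y; rewrite !TE !innerE !Xsa addrC.
- move=> m x.
  have TXi : X i (T x) = T (X i x) by rewrite !TE linearD /= !XX addrC.
  have TXj : X j (T x) = T (X j x) by rewrite !TE linearD /= !XX addrC.
  (* [T] commutes with [X i] and [X j] directly, and with the other two because it is a combination
     of the identity and [T']. *)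
  have T'X n : X n (T' x) = T' (X n x) -> X n (T x) = T (X n x).
    move=> E; apply: (scalerI aij); rewrite -linearZ /= !TT' linearD !linearZ /= E //.
  have := all4 m; rewrite !inE => /or4P[]/eqP-> //; apply: T'X; rewrite !T'E linearD /= !XX addrC //.
Qed.

Lemma zero_sum_basis : exists e : nat -> H, orthobasis 2 e.
Proof.
have all4 (s : seq nat) : (forall m, (m < 4)%N -> m \in s) -> forall m : 'I_4, m \in map inord s.
  by move=> h m; apply/mapP; exists (m : nat); rewrite ?inord_val // h.
have [c01 h01] : exists c : R, forall x, X (inord 0) (X (inord 1) x) + X (inord 1) (X (inord 0) x) = c%:C *: x.
  apply: (@anticommutator_scalar (inord 0) (inord 1) (inord 2) (inord 3)).
    by apply: (all4 [:: 0; 1; 2; 3]%N); case=> [|[|[|[|m]]]].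
  by move=> x; apply/eqP; rewrite -addr_eq0 -(Xsum x) addrA.
have [c02 h02] : exists c : R, forall x, X (inord 0) (X (inord 2) x) + X (inord 2) (X (inord 0) x) = c%:C *: x.
  apply: (@anticommutator_scalar (inord 0) (inord 2) (inord 1) (inord 3)).
    by apply: (all4 [:: 0; 2; 1; 3]%N); case=> [|[|[|[|m]]]].
  by move=> x; apply/eqP; rewrite -addr_eq0 -(Xsum x); apply/eqP; lmod.
have [c12 h12] : exists c : R, forall x, X (inord 1) (X (inord 2) x) + X (inord 2) (X (inord 1) x) = c%:C *: x.
  apply: (@anticommutator_scalar (inord 1) (inord 2) (inord 0) (inord 3)).
    by apply: (all4 [:: 1; 2; 0; 3]%N); case=> [|[|[|[|m]]]].
  by move=> x; apply/eqP; rewrite -addr_eq0 -(Xsum x); apply/eqP; lmod.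
(* The fourth symmetry is a combination of the other three, so invariance and commutation need to be
   checked for those only. *)
have X3E x : X (inord 3) x = ((a (inord 3))^-1)%:C *: - ((a (inord 0))%:C *: X (inord 0) x +
    (a (inord 1))%:C *: X (inord 1) x + (a (inord 2))%:C *: X (inord 2) x).
  have a3 : ((a (inord 3))%:C : R[i]) != 0 by rewrite fmorph_eq0 gt_eqF.
  apply: (scalerI a3); rewrite scalerA -rmorphM mulfV ?gt_eqF // scale1r.
  by apply/eqP; rewrite -addr_eq0 addrC Xsum.
have S0 := XX (inord 0); have S1 := XX (inord 1); have S2 := XX (inord 2).
have sa0 := Xsa (inord 0); have sa1 := Xsa (inord 1); have sa2 := Xsa (inord 2).
have ns0 := nsX (inord 0).
have n0 := X_rnorm (inord 0); have n1 := X_rnorm (inord 1); have n2 := X_rnorm (inord 2).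
have span3 n e x : span_proj n e (X (inord 0) x) = X (inord 0) x ->
    span_proj n e (X (inord 1) x) = X (inord 1) x ->
    span_proj n e (X (inord 2) x) = X (inord 2) x ->
    span_proj n e (X (inord 3) x) = X (inord 3) x.
  move=> p0 p1 p2; rewrite X3E.
  have pD (s : R[i]) u w : span_proj n e u = u -> span_proj n e w = w ->
    span_proj n e (s *: u + w) = s *: u + w by move=> pu pw; rewrite span_projP pu pw.
  have pZ (s : R[i]) u : span_proj n e u = u -> span_proj n e (s *: u) = s *: u.
    by move=> pu; rewrite -[_ *: _]addr0; apply: pD => //; exact: span_proj0.
  apply: (pZ); rewrite -scaleN1r; apply: (pZ).
  by rewrite -addrA; apply: (pD) => //; apply: (pD) => //; exact: (pZ).
have spanX n e : (forall i, (i < n)%N -> [/\ span_proj n e (X (inord 0) (e i)) = X (inord 0) (e i),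
      span_proj n e (X (inord 1) (e i)) = X (inord 1) (e i) &
      span_proj n e (X (inord 2) (e i)) = X (inord 2) (e i)]) ->
    forall j i, (i < n)%N -> span_proj n e (X j (e i)) = X j (e i).
  by move=> h; apply: ord4P => i /h[p0 p1 p2] //; exact: span3.
have commX (T : {linear H -> H}) :
    (forall x, X (inord 0) (T x) = T (X (inord 0) x)) ->
    (forall x, X (inord 1) (T x) = T (X (inord 1) x)) ->
    (forall x, X (inord 2) (T x) = T (X (inord 2) x)) -> forall j x, X j (T x) = T (X j x).
  move=> t0 t1 t2; apply: ord4P => // x.
  by rewrite !X3E t0 t1 t2 [RHS]linearZ /= linearN /= !linearD /= !linearZ /= !linearN; lmod.
move: (X (inord 0)) (X (inord 1)) (X (inord 2)) h01 h02 h12 S0 S1 S2 sa0 sa1 sa2 ns0 n0 n1 n2 spanX commX {X3E span3}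
  => Y0 Y1 Y2 h01 h02 h12 S0 S1 S2 sa0 sa1 sa2 ns0 n0 n1 n2 spanX commX.
have [s V] : exists s : R[i], forall x, Y0 (Y1 (Y2 x)) - Y2 (Y1 (Y0 x)) = s *: x.
  (* The adjoint of [Y0 Y1 Y2] is [Y2 Y1 Y0], so the difference is skew-adjoint; the factor ['i]
     makes the Schur lemma applicable. *)
  pose T : {linear H -> H} := 'i \*: ((Y0 \o (Y1 \o Y2)) \- (Y2 \o (Y1 \o Y0))).
  have TE x : T x = 'i *: (Y0 (Y1 (Y2 x)) - Y2 (Y1 (Y0 x))) by [].
  have iE u : 'i *: (- 'i *: u) = u :> H by rewrite scalerA mulrN -expr2 sqrCi opprK scale1r.
  have [|||t Tt] := @schur_selfadj _ _ _ X irrX X_bounded T 2.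
  - move=> x; rewrite TE rnormZC normCi /= mul1r mulr_natl mulr2n.
    apply: le_trans (rnormD _ _) _; rewrite rnormN.
    by rewrite n0 n1 n2 n2 n1 n0.
  - move=> x y; rewrite !TE innerZl innerZr conjCi !innerE !(sa0, sa1, sa2); ring.
  - have e01 u : Y1 (Y0 u) = c01%:C *: u - Y0 (Y1 u) by rewrite -h01 addrAC subrr add0r.
    have e12 u : Y2 (Y1 u) = c12%:C *: u - Y1 (Y2 u) by rewrite -h12 addrAC subrr add0r.
    have linZ (Y : {linear H -> H}) (r : R) u : Y (r%:C *: u) = r%:C *: Y u by rewrite linearZ.
    apply: commX => x; rewrite !TE linearZ linearB /=; congr (_ *: _).
    + by rewrite e12 linearB linZ !S0 e12; lmod.
    + have f u : Y1 (Y2 (Y1 u)) = c12%:C *: Y1 u - Y2 u by rewrite -h12 S1 addrK.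
      rewrite !(e01 (Y1 _)) !S1 !f !linearB !linZ (e01 x) (e12 x); lmod.
    + have f : Y0 (Y1 (Y2 x)) = c01%:C *: Y2 x - Y1 (Y0 (Y2 x)) by rewrite -h01 addrK.
      by rewrite f linearB linZ !S2 (e01 x); lmod.
  exists (- 'i * t%:C) => x; rewrite -scalerA -Tt TE.
  by rewrite -{1}(iE (Y0 (Y1 (Y2 x)) - Y2 (Y1 (Y0 x)))) scalerA mulrC -scalerA.
have [x0 x0n Yx0] := ns0 false; rewrite expr0 scale1r in Yx0.
have [d d0 d1] := ex_unit x0n; set x := d *: x0 in d1.
have Yx : Y0 x = x by rewrite /x linearZ /= Yx0.
have half (y : {linear H -> H}) c : y x - (c / 2) *: x = 0 -> y x = (c / 2) *: x.
  by move/eqP; rewrite subr_eq0 => /eqP.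
have [y1|y1] := eqVneq (Y1 x - (c01%:C / 2) *: x) 0; last first.
  have [e oe eE] := two_dim_span S0 S1 sa0 sa1 h01 h02 h12 (V x) d1 Yx y1.
  by exists e; apply: (irreducible_span irrX) => //; exact: spanX.
(* If [Y2 x] is not a multiple of [x], exchange [Y1] and [Y2]; at [x] this changes the sign of the
   triple relation. *)
have [y2|y2] := eqVneq (Y2 x - (c02%:C / 2) *: x) 0; last first.
  have V' : Y0 (Y2 (Y1 x)) - Y1 (Y2 (Y0 x)) = (- s) *: x.
    rewrite scaleNr -V Yx.
    have e21 u : Y2 (Y1 u) = c12%:C *: u - Y1 (Y2 u) by rewrite -h12 addrAC subrr add0r.
    by rewrite e21 linearB linearZ /= Yx; lmod.
  have h21 u : Y2 (Y1 u) + Y1 (Y2 u) = c12%:C *: u by rewrite addrC.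
  have [e oe eE] := two_dim_span S0 S2 sa0 sa2 h02 h01 h21 V' d1 Yx y2.
  exists e; apply: (irreducible_span irrX) => //; apply: spanX => i /eE[p0 p2 p1].
  by split.
(* Now [x] spans an invariant line, so [H] is that line and [Y0] is the identity, against
   nonscalarity. *)
pose e (i : nat) := x.
have oe : orthonormal_upto 1 e by case=> [|i] [|j].
have pZ (r : R[i]) : span_proj 1 e (r *: x) = r *: x.
  rewrite -[r *: x]addr0 span_projP span_proj0.
  by rewrite (span_proj_id (i := 0%N) oe).
have be : orthobasis 1 e.
  apply: (irreducible_span irrX) => //; apply: spanX => i _; rewrite /e.
  rewrite Yx (half _ _ y1) (half _ _ y2) !pZ; split=> //.
  by have := pZ 1; rewrite scale1r.
case: (scalar_contra be ns0 (expr1n _ 2)) => i _.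
by rewrite /e Yx scale1r.
Qed.

End ZeroSum.

Section ZeroSumDimension.
Variables (R : realType) (H : hilbert R).
Local Notation "<| x , y |>" := (inner H x y) (format "<| x ,  y |>").
Variables (X : 'I_4 -> {linear H -> H}) (a : 'I_4 -> R).
Hypothesis a_gt0 : forall j, 0 < a j.
Hypothesis sysX : involution_system a 0 X.
Hypothesis irrX : irreducible_family X.
Hypothesis nsX : nonscalar_family X.

Lemma zero_sum_trace e j : orthobasis 2 e -> family_trace 2 e (X j) = 0.
Proof. by move=> be; have [XX Xsa _] := sysX; exact: (family_trace2 be (XX j) (Xsa j) (nsX j)). Qed.

(** Pair the vanishing sum with a unit vector [x] fixed by [X j]; the other terms are at least
    [- a k]. If [a j] were at least their sum, equality would force [X k x = - x] for all [k != j],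
    and [x] would span an invariant line. *)
Lemma zero_sum_lt j : a j < \sum_(k | k != j) a k.
Proof.
have [XX Xsa Xsum] := sysX; rewrite ltNge; apply/negP => aj_ge.
have [x0 x0n] := nsX j false; rewrite expr0 scale1r => Xx0.
have [d d0 d1] := ex_unit x0n; set x := d *: x0 in d1.
have Xx : X j x = x by rewrite /x linearZ /= Xx0.
clearbody x.
have sqE k : rnorm (X k x + x) ^+ 2 = 2 * (1 + complex.Re <|X k x, x|>).
  have X1 : <|X k x, X k x|> = 1 by rewrite Xsa XX.
  have reC : complex.Re <|x, X k x|> = complex.Re <|X k x, x|> by rewrite -Xsa.
  rewrite -Re_innerE !innerE X1 d1 !raddfD /= reC; ring.
have fix_neg k : k != j -> X k x = - x.
  have h (i : 'I_4) : i != j -> 0 <= a i * (1 + complex.Re <|X i x, x|>).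
    move=> _; apply: mulr_ge0; first exact: ltW.
    have := sqE i; have := sqr_ge0 (rnorm (X i x + x)); lra.
  have s0 : \sum_(i | i != j) a i * (1 + complex.Re <|X i x, x|>) <= 0.
    have := congr1 (fun u => complex.Re <|u, x|>) (Xsum x).
    rewrite scale0r inner0l inner_suml raddf_sum (bigD1 j) //= Xx innerZl d1 mulr1 /=.
    under eq_bigr => i _ do rewrite innerZl.
    have reM (r : R) (z : R[i]) : complex.Re (r%:C * z) = r * complex.Re z.
      by case: z => p q /=; rewrite mul0r subr0.
    under eq_bigr => i _ do rewrite reM.
    under [in X in _ -> X]eq_bigr => i _ do rewrite mulrDr mulr1.
    rewrite big_split /= => /eqP; rewrite addr_eq0 => /eqP aE.
    by rewrite -[X in _ + X]opprK -aE subr_le0.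
  move=> kj; have : a k * (1 + complex.Re <|X k x, x|>) = 0.
    apply/eqP; rewrite eq_le h // andbT; apply: le_trans s0.
    by rewrite (bigD1 k) //= lerDl; apply: sumr_ge0 => i /andP[ij _]; exact: h.
  move/eqP; rewrite mulf_eq0 gt_eqF //= => /eqP r0.
  have := sqE k; rewrite r0 mulr0 => /eqP; rewrite sqrf_eq0 => /eqP /rnorm0_eq0 /eqP.
  by rewrite addr_eq0 => /eqP.
pose e (i : nat) := x.
have oe : orthonormal_upto 1 e by case=> [|i] [|i'].
have px : span_proj 1 e x = x by exact: (span_proj_id (i := 0%N) oe).
have be : orthobasis 1 e.
  apply: (irreducible_span irrX) => // k i _; rewrite /e.
  have [->|kj] := eqVneq k j; first by rewrite Xx.
  rewrite fix_neg // -scaleN1r -[_ *: x]addr0 span_projP span_proj0 px //.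
case: (scalar_contra be (nsX j) (expr1n _ 2)) => i _.
by rewrite /e Xx scale1r.
Qed.

End ZeroSumDimension.

(** * Existence of systems with sum zero *)

Section ZeroSumExistence.
Variable R : realType.

(** One plane and one triangle with sides [a], [b], [|mu|]; nondegeneracy makes the sine [t]
    nonzero. *)
Lemma swap_pairing (a b mu : R) : 0 < a -> 0 < b -> mu != 0 ->
  (a - b) ^+ 2 < mu ^+ 2 -> mu ^+ 2 < (a + b) ^+ 2 ->
  exists d t, t != 0 /\ pairing_data a b (@rev_ord 2) (fun i => (-1) ^+ i * d) (fun=> t)
    (fun i => (-1) ^+ i * mu).
Proof.
move=> a0 b0 mu0 lo hi.
pose d := (mu ^+ 2 + a ^+ 2 - b ^+ 2) / (2 * a * mu).
have dE : 2 * a * mu * d = mu ^+ 2 + a ^+ 2 - b ^+ 2.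
  by rewrite /d mulrC divfK // !mulf_neq0 ?pnatr_eq0 // gt_eqF.
have d1 : 0 < 1 - d ^+ 2.
  have P : 0 < (2 * a * mu) ^+ 2.
    by rewrite exprn_even_gt0 //= !mulf_neq0 ?pnatr_eq0 // gt_eqF.
  rewrite -(pmulr_rgt0 _ P).
  have -> : (2 * a * mu) ^+ 2 * (1 - d ^+ 2) =
     ((a + b) ^+ 2 - mu ^+ 2) * (mu ^+ 2 - (a - b) ^+ 2).
    by rewrite mulrBr mulr1 -exprMn dE; ring.
  by rewrite mulr_gt0 // subr_gt0.
have sg2 (i : 'I_2) : (-1) ^+ i * (-1) ^+ i = 1 :> R.
  by rewrite -signr_odd -signr_addb addbb.
have rev (i : 'I_2) : (-1) ^+ rev_ord i = - (-1) ^+ i :> R.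
  by case: i => [[|[|i]]] //= _; rewrite ?expr0 ?expr1 ?opprK.
exists d, (Num.sqrt (1 - d ^+ 2)); split; first by rewrite sqrtr_eq0 -ltNge.
split; split=> // i.
- exact: rev_ordK.
- by rewrite rev mulNr subrr mulr0.
- by rewrite exprMn expr2 sg2 mul1r sqr_sqrtr ?ltW // addrC subrK.
- by rewrite rev mulNr subrr mulr0.
- rewrite exprMn [_ ^+ i ^+ 2]expr2 sg2 mul1r -dE.
  transitivity ((-1) ^+ i * (-1) ^+ i * (2 * a * mu * d)); first by rewrite sg2 mul1r.
  by move: ((-1) ^+ i : R) => s; ring.
Qed.

Lemma zero_sum_exists (a : 'I_4 -> R) : (forall j, 0 < a j) ->
  (forall j, a j < \sum_(k | k != j) a k) ->
  exists (H : hilbert R) (X : 'I_4 -> {linear H -> H}),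
  [/\ involution_system a 0 X, irreducible_family X & nonscalar_family X].
Proof.
move=> a_gt0 poly.
have poly' j : 2 * a j < a (inord 0) + a (inord 1) + a (inord 2) + a (inord 3).
  by rewrite -(sum4 a) (bigD1 j) //=; have := poly j; lra.
have := (poly' (inord 0), poly' (inord 1), poly' (inord 2), poly' (inord 3)).
have := (a_gt0 (inord 0), a_gt0 (inord 1), a_gt0 (inord 2), a_gt0 (inord 3)).
rewrite -(fam4_eta a).
have [-> -> -> ->] := fam4E (a (inord 0)) (a (inord 1)) (a (inord 2)) (a (inord 3)).
move: (a (inord 0)) (a (inord 1)) (a (inord 2)) (a (inord 3)) => a0 a1 a2 a3.
move=> [[[p0 p1] p2] p3] [[[q0 q1] q2] q3].
(* [mu] is a diagonal cutting the quadrilateral into two nondegenerate triangles. The polygon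
   inequalities make the interval of such lengths nonempty, and its midpoint is taken. *)
have [mu [mu0 [lo1 lo2] [lo3 lo4] [hi1 hi2]]] : exists mu, [/\ 0 < mu,
    a0 - a1 < mu /\ a1 - a0 < mu, a2 - a3 < mu /\ a3 - a2 < mu & mu < a0 + a1 /\ mu < a2 + a3].
  pose L := Num.max (Num.max (a0 - a1) (a1 - a0)) (Num.max (a2 - a3) (a3 - a2)).
  pose U := Num.min (a0 + a1) (a2 + a3).
  have LU : L < U by rewrite /L /U !gt_max !lt_min; lra.
  have L0 : 0 <= L by rewrite /L !le_max; have [h|h] := leP a0 a1; lra.
  have [m1 m2] : L < (L + U) / 2 /\ (L + U) / 2 < U by lra.
  exists ((L + U) / 2); move: m1 m2; rewrite {1}/L {3}/U !gt_max lt_min => /andP[/andP[-> ->] /andP[-> ->]] /andP[-> ->].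
  split=> //; lra.
have sqb (x y : R) : - y < x -> x < y -> x ^+ 2 < y ^+ 2 by exact: sqr_lt_of_bounds.
have lo : (a0 - a1) ^+ 2 < mu ^+ 2 by apply: sqb; lra.
have hi : mu ^+ 2 < (a0 + a1) ^+ 2 by apply: sqb; lra.
have lo' : (a2 - a3) ^+ 2 < (- mu) ^+ 2 by rewrite sqrrN; apply: sqb; lra.
have hi' : (- mu) ^+ 2 < (a2 + a3) ^+ 2 by rewrite sqrrN; apply: sqb; lra.
have mun : mu != 0 by rewrite gt_eqF.
have mun' : - mu != 0 by rewrite oppr_eq0.
have [dK [tK [tK0 pK]]] := swap_pairing p0 p1 mun lo hi.
have [dL [tL [tL0 pL']]] := swap_pairing p2 p3 mun' lo' hi'.
have pL : pairing_data a2 a3 (@rev_ord 2) (fun i => (-1) ^+ i * dL) (fun=> tL)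
    (fun i : 'I_2 => 0 - (-1) ^+ i * mu).
  by move: pL'; congr (pairing_data _ _ _ _ _ _); apply/funext => i; rewrite sub0r mulrN.
exists (chilbert R 2), (pairing_system a0 a1 a2 a3 0 (@rev_ord 2) (@rev_ord 2)
   (fun i => (-1) ^+ i * dK) (fun=> tK) (fun i => (-1) ^+ i * dL) (fun=> tL) (fun i => (-1) ^+ i * mu)).
have rev0 : rev_ord (ord0 : 'I_2) != ord0 by [].
split.
- exact: pairing_systemP.
- apply: pairing_system_irreducible => //.
    move=> i j; case: i => [[|[|i]]] //= ip; case: j => [[|[|j]]] //= jp; rewrite ?expr0 ?expr1 => E;
      first [by apply: val_inj | by exfalso; move: E mu0; lra].
  move=> P [i Pi] PK _ j; have := PK _ tK0 Pi; move: Pi.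
  by case: i => [[|[|i]]] //= ip; case: j => [[|[|j]]] //= jp Pi Pr;
    [move: Pi|move: Pr|move: Pr|move: Pi]; congr P; exact: val_inj.
- by apply: pairing_system_nonscalar => //; exists ord0.
Qed.

End ZeroSumExistence.

(** * Assembly of both parts *)

Lemma chi_coords (R : realType) (x1 x2 x3 x4 x0 : R) :
  let chi : 'cV[R]_5 := vec [:: x1; x2; x3; x4; x0] in
  [/\ chi (first4 (inord 0)) ord0 = x1, chi (first4 (inord 1)) ord0 = x2,
      chi (first4 (inord 2)) ord0 = x3, chi (first4 (inord 3)) ord0 = x4 &
      chi ord_max ord0 = x0].
Proof. by split; rewrite mxE ?first4E ?inordK. Qed.

(** Since the total is [2 g], either side says that each [a j] is smaller than [g]. *)
Lemma polygon_iff (R : realType) (a : 'I_4 -> R) g :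
  a (inord 0) + a (inord 1) + a (inord 2) + a (inord 3) = 2 * g ->
  (forall j, a j < \sum_(k | k != j) a k) <->
  [/\ a (inord 0) + a (inord 1) + a (inord 2) > g, a (inord 0) + a (inord 2) + a (inord 3) > g,
      a (inord 0) + a (inord 1) + a (inord 3) > g & a (inord 1) + a (inord 2) + a (inord 3) > g].
Proof.
move=> s; have E j : (a j < \sum_(k | k != j) a k) = (a j < g).
  have := sum4 a; rewrite s (bigD1 j) //= => {s}.
  by move: (\sum_(_ | _) _) => S aS; apply/idP/idP; lra.
split=> [h|[h3 h1 h2 h0]].
  by split; [have := h (inord 3)|have := h (inord 1)|have := h (inord 2)|have := h (inord 0)];
    rewrite E; lra.
by apply: ord4P; rewrite E; lra.
Qed.

Local Close Scope complex_scope.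
Local Close Scope classical_set_scope.

Theorem theorem3 (R : realType) (alpha beta xi delta gamma : R)
    (alpha_gt0 : 0 < alpha) (beta_gt0 : 0 < beta)
    (xi_gt0 : 0 < xi) (delta_gt0 : 0 < delta) :
  let chi : 'cV[R]_5 := vec [:: alpha; beta; xi; delta; gamma] in
  (alpha + beta + xi + delta <> 2%:R * gamma ->
     forall v : 'cV[option nat]_5,
     [/\ (exists (H : hilbert R) (pi : star_rep chi H),
            [/\ irreducible_rep pi, nondegenerate_rep pi & has_gendim pi v])
         <-> (exists (t : 'I_2) (k : nat) (tau : 'S_4),
                admissible chi v t k tau),
         (forall (t t' : 'I_2) (k k' : nat) (tau tau' : 'S_4),
            admissible chi v t k tau -> admissible chi v t' k' tau' ->
            [/\ t = t', k = k' & tau = tau'])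
       & (forall (H1 H2 : hilbert R)
                 (pi1 : star_rep chi H1) (pi2 : star_rep chi H2),
            irreducible_rep pi1 -> nondegenerate_rep pi1 -> has_gendim pi1 v ->
            irreducible_rep pi2 -> nondegenerate_rep pi2 -> has_gendim pi2 v ->
            unitarily_equivalent pi1 pi2)])
  /\
  (alpha + beta + xi + delta = 2%:R * gamma ->
     (forall (H : hilbert R) (pi : star_rep chi H),
        irreducible_rep pi -> nondegenerate_rep pi ->
        has_gendim pi (map_mx Some (vec [:: 1; 1; 1; 1; 2]%N)))
     /\
     ((exists (H : hilbert R) (pi : star_rep chi H),
         irreducible_rep pi /\ nondegenerate_rep pi)
      <-> [/\ alpha + beta + xi > gamma, alpha + xi + delta > gamma,
              alpha + beta + delta > gamma & beta + xi + delta > gamma])).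
Proof.
move=> chi.
have [c1 c2 c3 c4 c0] := chi_coords alpha beta xi delta gamma; rewrite -/chi in c1 c2 c3 c4 c0.
clearbody chi; pose a j := chi (first4 j) ord0.
have a_gt0 j : 0 < a j by move: j; apply: ord4P; rewrite /a ?c1 ?c2 ?c3 ?c4.
have sE : \sum_j a j = alpha + beta + xi + delta by rewrite sum4 /a c1 c2 c3 c4.
have lamE : 2 * chi ord_max ord0 - \sum_j a j = 2 * gamma - (alpha + beta + xi + delta).
  by rewrite sE c0.
split=> [neq v|eq].
  have lam_neq0 : 2 * chi ord_max ord0 - \sum_j a j != 0.
    by rewrite lamE subr_eq0 eq_sym; apply/eqP.
  split.
  - rewrite (rep_exists_iff a_gt0 lam_neq0).
    split=> [[n [f [ft tv]]]|[t [k [tau /(admissible_iff a_gt0 lam_neq0)[n [f [_ _ _ ft tv]]]]]]].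
      eexists; eexists; eexists; apply/(admissible_iff a_gt0 lam_neq0).
      by exists n, f; split.
    by exists n, f.
  - by move=> t t' k k' tau tau'; exact: (admissible_unique a_gt0 lam_neq0).
  - by move=> H1 H2 pi1 pi2; exact: (rep_unique a_gt0 lam_neq0).
have lam0 : 2 * chi ord_max ord0 - \sum_j a j = 0 by rewrite lamE eq subrr.
have aE : a (inord 0) + a (inord 1) + a (inord 2) + a (inord 3) = 2 * gamma.
  by rewrite /a c1 c2 c3 c4.
have sys H (pi : star_rep chi H) : involution_system a 0 (rep_symmetry pi).
  by rewrite -lam0; exact: rep_system.
split=> [H pi irr /(rep_nonscalar pi a_gt0) ns|].
  have irr' := rep_irreducible a_gt0 irr.
  have [e be] := zero_sum_basis a_gt0 (sys H pi) irr' ns.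
  have tr j : family_trace 2 e (rep_symmetry pi j) = (real_complex R 0).
    by rewrite (zero_sum_trace (sys H pi) ns j be).
  apply/(gendim_trace_vector a_gt0 _ be tr); split=> [|j]; first by rewrite !mxE.
  exists 1%N; last by rewrite addr0 mulr1.
  by rewrite !mxE first4E; move: j; apply: ord4P; rewrite inordK.
rewrite -[alpha]c1 -[beta]c2 -[xi]c3 -[delta]c4; apply: iff_trans (polygon_iff aE).
split=> [[H [pi [irr /(rep_nonscalar pi a_gt0) ns]]] j|poly].
  exact: (zero_sum_lt a_gt0 (sys H pi) (rep_irreducible a_gt0 irr) ns).
have [H [X [sysX irrX nsX]]] := zero_sum_exists a_gt0 poly.
rewrite -lam0 in sysX.
have [pi piX] := rep_of_system a_gt0 sysX.
exists H, pi; split; first exact: (irreducible_rep_of_family piX).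
apply/(rep_nonscalar pi a_gt0) => j b.
by have [x x0 Xx] := nsX j b; exists x => //; rewrite piX.
Qed.
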